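(* Let $n\in\mathbb{N}$ and $s\in\mathbb{R}$. Then $WS_{\mathcal{B}}^{s,p}[\mathbb{R}_I^n]$ contains $W_{\mathcal{B}}^{s,p}[\mathbb{R}_I^n]$ as a continuous dense embedding.
   Context: Let $I_n=\prod_{i=n+1}^\infty[-\tfrac12,\tfrac12]$ and $\mathbb{R}_I^n=\mathbb{R}^n\times I_n$, with open sets $U\times I_n$ ($U\subset\mathbb{R}^n$ open), the corresponding Borel $\sigma$-algebra, and the measure $\lambda_\infty(A\times I_n)=\lambda_n(A)$, where $\lambda_n$ is Lebesgue measure on $\mathbb{R}^n$. Thus functions on $\mathbb{R}_I^n$ are functions of the first $n$ coordinates, and analysis on $\mathbb{R}_I^n$ parallels that on $\mathbb{R}^n$. $KS^2$: enumerate the countable dense set of points with rational (first $n$) coordinates as $\{x_1,x_2,\dots\}$; for $(j,i)\in\mathbb{N}\times\mathbb{N}$ let $\mathcal{B}_j(x_i)$ be the closed cube in $\mathbb{R}^n$ centered at $x_i$ with sides parallel to the axes and edge $\frac{1}{2^j\sqrt n}$ (viewed as cube $\times I_n$); enumerate all these cubes as $\{\mathcal{B}_r\}_{r\in\mathbb{N}}$ and let $\zeta_r$ be the characteristic function of $\mathcal{B}_r$. Fix $\tau_r>0$ with $\sum_r\tau_r=1$. $KS^2[\mathbb{R}_I^n]$ is the completion of $L^2[\mathbb{R}_I^n]$ for the inner product $(f,g)=\sum_r\tau_r\big[\int\zeta_rf\,d\lambda_\infty\big]\overline{\big[\int\zeta_rg\,d\lambda_\infty\big]}$. Bessel potential: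 $\mathcal{S}[\mathbb{R}_I^n]$ is the Schwartz space (smooth $f$ with $\sup|x^\beta\partial^\alpha f|<\infty$ for all multi-indices $\alpha,\beta$) and $\mathcal{S}^*[\mathbb{R}_I^n]$ the space of sequentially continuous functionals on it. For $s\in\mathbb{R}$, $\mathcal{P}^s:\mathcal{S}[\mathbb{R}_I^n]\to\mathcal{S}[\mathbb{R}_I^n]$ is $\mathcal{P}^sf(x)=\int_{\mathbb{R}_I^n}(1+|\xi|^2)^{s/2}\widehat f(\xi)e^{2\pi i\xi\cdot x}\,d\xi$ (with $\xi\in\mathbb{R}^n$ the first $n$ coordinates), extended to $\mathcal{S}^*[\mathbb{R}_I^n]$ by $\langle\mathcal{P}^sf,\varphi\rangle=\langle f,\mathcal{P}^s\varphi\rangle$. Define $W_{\mathcal{B}}^{s,p}[\mathbb{R}_I^n]=\{f\in\mathcal{S}^*[\mathbb{R}_I^n]:\mathcal{P}^sf\in L^2[\mathbb{R}_I^n]\}$ with norm $\|\mathcal{P}^sf\|_{L^2}$, and $WS_{\mathcal{B}}^{s,p}[\mathbb{R}_I^n]=\{f\in\mathcal{S}^*[\mathbb{R}_I^n]:\mathcal{P}^sf\in KS^2[\mathbb{R}_I^n]\}$ with inner product $\langle\mathcal{P}^sf,\mathcal{P}^sg\rangle_{KS^2[\mathbb{R}_I^n]}$ and norm $\|\mathcal{P}^sf\|_{KS^2[\mathbb{R}_I^n]}$; $\mathcal{P}^s:WS_{\mathcal{B}}^{s,p}[\mathbb{R}_I^n]\to KS^2[\mathbb{R}_I^n]$ is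 a unitary isomorphism. The index $p$ plays no role in these definitions. *)

(* Defs.v *)
From HB Require Import structures.
From mathcomp Require Import all_boot all_order all_algebra.
From mathcomp Require Import all_classical all_reals all_analysis.
From mathcomp Require Import complex.

Set Implicit Arguments.
Unset Strict Implicit.
Unset Printing Implicit Defensive.

Import Order.TTheory GRing.Theory Num.Theory.
Import numFieldNormedType.Exports.
Import ComplexField.Normc.

Local Open Scope classical_set_scope.
Local Open Scope ring_scope.
Local Open Scope complex_scope.

Local Notation Re := complex.Re.
Local Notation Im := complex.Im.
Local Notation borel T := (g_sigma_algebraType (@open T)).

(** * The space R^n x I_n and its Lebesgue measure *)

(* Lebesgue measure on R^n as an iterated product of [lebesgue_measure], on the
   product sigma-algebra of [n.-tuple R]. *)
Section lebesgue_tuple.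
Variable R : realType.

Definition tcons n (p : R * n.-tuple R) : n.+1.-tuple R :=
  [tuple of p.1 :: p.2].

Lemma measurable_tcons n : measurable_fun [set: R * n.-tuple R] (@tcons n).
Proof. exact: measurable_cons. Qed.

Section step.
Variables (n : nat) (mu : {sigma_finite_measure set (n.-tuple R) -> \bar R}).

Definition lebesgue_step : set (n.+1.-tuple R) -> \bar R :=
  pushforward (@lebesgue_measure R \x mu)%E (@tcons n).

Let step_measure : {measure set (n.+1.-tuple R) -> \bar R} :=
  @measure_function_pushforward__canonical__measure_function_Measure
    _ _ _ _ _ (@lebesgue_measure R \x mu)%E _ (@measurable_tcons n).

Let step0 : lebesgue_step set0 = 0%E.
Proof. exact: (measure0 step_measure). Qed.

Let step_ge0 A : (0 <= lebesgue_step A)%E.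
Proof. exact: (measure_ge0 step_measure). Qed.

Let step_sigma_additive : semi_sigma_additive lebesgue_step.
Proof. exact: (@measure_semi_sigma_additive _ _ _ step_measure). Qed.

HB.instance Definition _ := isMeasure.Build _ _ _ lebesgue_step
  step0 step_ge0 step_sigma_additive.

Lemma lebesgue_step_sigma_finite : sigma_finite setT lebesgue_step.
Proof.
have [F FT Foo] : sigma_finite setT (@lebesgue_measure R \x mu)%E.
  have /sigma_finiteP[F [TF ndF Foo]] :=
    sigma_finiteT (@lebesgue_measure R : {sigma_finite_measure set _ -> \bar R}).
  have /sigma_finiteP[G [TG ndG Goo]] := sigma_finiteT mu.
  exists (fun k => F k `*` G k) => [|k].
    rewrite -setXTT TF TG predeqE => -[x y]; split => [[/= [i _ Fx] [k _ Gy]]|].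
      exists (maxn i k) => //; split => /=.
      - by move: x Fx; exact/subsetPset/ndF/leq_maxl.
      - by move: y Gy; exact/subsetPset/ndG/leq_maxr.
    by move=> [k _ []/= ? ?]; split; exists k.
  have [? ?] := Foo k; have [? ?] := Goo k.
  split; first exact: measurableX.
  by rewrite product_measure1E// lte_mul_pinfty// ge0_fin_numE.
pose g (t : n.+1.-tuple R) : R * n.-tuple R := (thead t, [tuple of behead t]).
have mg : measurable_fun setT g.
  apply: measurable_fun_pair; first exact: measurable_tnth.
  exact: measurable_behead.
have gK : cancel (@tcons n) g.
  move=> [x t]; rewrite /g /tcons /=; congr (_, _); exact: val_inj.
exists (fun k => g @^-1` F k) => [|k].
  by rewrite -preimage_bigcup -FT preimage_setT.
have [mF Fk] := Foo k; split; first by rewrite -[X in measurable X]setTI; exact: mg.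
rewrite /lebesgue_step /pushforward (_ : _ @^-1` _ = F k)//.
by apply/seteqP; split => p /=; rewrite gK.
Qed.

HB.instance Definition _ := Measure_isSigmaFinite.Build _ _ _ lebesgue_step
  lebesgue_step_sigma_finite.

End step.

Fixpoint lebesgue_tuple n : {sigma_finite_measure set (n.-tuple R) -> \bar R} :=
  match n with
  | 0 => \d_[tuple]
  | n'.+1 => lebesgue_step (lebesgue_tuple n')
  end.

End lebesgue_tuple.

Section space.
Variable R : realType.

Definition unit_itv := {t : R | t \in `[- 2^-1, 2^-1]}.

Fact unit_itv0_subproof : (0 : R) \in `[- 2^-1, 2^-1].
Proof. by rewrite in_itv /= oppr_le0 invr_ge0 ler0n. Qed.

Definition unit_itv0 : unit_itv := Sub 0 unit_itv0_subproof.

HB.instance Definition _ := Choice.on unit_itv.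
HB.instance Definition _ := isPointed.Build unit_itv unit_itv0.

(* The k-th factor of I_n is the coordinate of index n + 1 + k.  The open sets
   are the U x I_n with U open in R^n, that is, the initial topology of the
   projection on the first n coordinates. *)
Definition RI (n : nat) :=
  initial_topology (@fst 'rV[R]_n (nat -> unit_itv)).

Definition proj_n n (y : borel (RI n)) : 'rV[R]_n := y.1.

Definition row_of_tuple n (t : n.-tuple R) : borel 'rV[R]_n :=
  \row_i tnth t i.

Lemma measurable_row_of_tuple n : measurable_fun setT (@row_of_tuple n).
Proof.
have := @measurability _ _ (n.-tuple R) (borel 'rV[R]_n) setT (@row_of_tuple n)
  (@open 'rV[R]_n) erefl.
apply=> _ [U oU <-].
rewrite setTI.
pose B (p : 'rV[rat]_n * nat) : set 'rV[R]_n :=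
  ball (map_mx (ratr : rat -> R) p.1) p.2.+1%:R^-1.
have -> : U = \bigcup_(p in [set p | B p `<=` U]) B p.
  apply/seteqP; split => [x Ux|x [p /= pU Bx]]; last exact: pU.
  have := oU; rewrite openE => /(_ _ Ux); rewrite /interior -nbhs_ballE.
  move=> [e /= e0 eU].
  have e2 : 0 < e / 2 by rewrite divr_gt0.
  have [k ke] : exists k, k.+1%:R^-1 < e / 2.
    exists (Num.truncn (e / 2)^-1).
    by rewrite invf_plt ?posrE// truncnS_gt// ltW// invr_gt0.
  have k0 : (0 : R) < k.+1%:R^-1 by rewrite invr_gt0.
  have /choice [q qP] : forall i : 'I_n,
      exists q : rat, ball (x ord0 i) k.+1%:R^-1 (ratr q).
    move=> i; have : x ord0 i - k.+1%:R^-1 < x ord0 i + k.+1%:R^-1.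
      by rewrite ltrD2l (lt_trans _ k0)// oppr_lt0.
    move=> /rat_in_itvoo [q]; rewrite in_itv/= => /andP[h1 h2]; exists q.
    by rewrite /ball /= ltr_distlC h1 h2.
  have qx : ball x k.+1%:R^-1 (map_mx ratr (\row_i q i)).
    by split=> // i j; rewrite !mxE (ord1 i); exact: qP.
  exists (\row_i q i, k) => /=; last exact: ball_sym.
  move=> z Bz; apply: eU; apply: (@le_ball _ _ _ (k.+1%:R^-1 + k.+1%:R^-1)).
    by rewrite [leRHS]splitr ltW// ltrD.
  exact: ball_triangle qx Bz.
rewrite preimage_bigcup bigcup_mkcond.
apply: countable_bigcupT_measurable => [|p]; first exact: countableP.
case: ifPn => // _.
rewrite (_ : _ @^-1` _ = \bigcap_(i in [set: 'I_n])
    (fun t : n.-tuple R => tnth t i) @^-1` ball (ratr (p.1 ord0 i) : R) p.2.+1%:R^-1).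
  apply: fin_bigcap_measurable => // i _.
  rewrite -[X in measurable X]setTI; apply: measurable_tnth => //.
  by rewrite ball_itv; exact: measurable_itv.
apply/seteqP; split => t /=.
  by move=> [_ h] i _; have := h ord0 i; rewrite !mxE.
move=> h; split=> [|i j]; first by rewrite invr_gt0.
by rewrite (ord1 i) !mxE; exact: h.
Qed.

Definition section0 n (x : borel 'rV[R]_n) : borel (RI n) :=
  (x, fun=> unit_itv0).

Lemma measurable_section0 n :
  measurable_fun [set: borel 'rV[R]_n] (@section0 n : _ -> borel (RI n)).
Proof.
have := @measurability _ _ (borel 'rV[R]_n) (borel (RI n)) setT (@section0 n)
  (@open (RI n)) erefl.
apply=> _ [_ [U oU <-] <-].
by rewrite setTI; exact: sub_sigma_algebra.
Qed.

Definition embed n (t : n.-tuple R) : borel (RI n) :=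
  section0 (row_of_tuple t).

Lemma measurable_embed n :
  measurable_fun setT (@embed n).
Proof.
move=> _ A mA; rewrite setTI [X in measurable X](_ : _ =
  (setT `&` @row_of_tuple n @^-1` (@section0 n @^-1` A))) ?setTI//.
rewrite -[X in measurable X]setTI.
apply: measurable_row_of_tuple => //; rewrite -[X in measurable X]setTI.
exact: measurable_section0.
Qed.

(* Measurable subsets of R^n x I_n are the A x I_n with A Borel, so the
   pushforward along x |-> (x, 0) is the measure A x I_n |-> lambda_n A; see
   [lambda_RIE]. *)
Let lambda_measure n : {measure set (borel (RI n)) -> \bar R} :=
  @measure_function_pushforward__canonical__measure_function_Measure
    _ _ _ _ _ (@lebesgue_tuple R n) _
    (@measurable_embed n).

Definition lambda_rV n : set (borel 'rV[R]_n) -> \bar R :=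
  pushforward (@lebesgue_tuple R n) (@row_of_tuple n).

Definition lambda_RI n : set (borel (RI n)) -> \bar R :=
  pushforward (@lebesgue_tuple R n) (@embed n).

Let lambda0 n : @lambda_RI n set0 = 0%E.
Proof. exact: (measure0 (lambda_measure n)). Qed.

Let lambda_ge0 n A : (0 <= @lambda_RI n A)%E.
Proof. exact: (measure_ge0 (lambda_measure n)). Qed.

Let lambda_sigma_additive n : semi_sigma_additive (@lambda_RI n).
Proof. exact: (@measure_semi_sigma_additive _ _ _ (lambda_measure n)). Qed.

HB.instance Definition _ n := isMeasure.Build _ _ _ (@lambda_RI n)
  (@lambda0 n) (@lambda_ge0 n) (@lambda_sigma_additive n).

Lemma lambda_RIE n (A : set 'rV[R]_n) :
  lambda_RI (@proj_n n @^-1` A) = lambda_rV A.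
Proof. by []. Qed.

End space.

(** * Complex-valued integrals and the space L^2 *)

Section complex_integral.
Context d (T : measurableType d) (R : realType).
Variable mu : {measure set T -> \bar R}.

Definition cmeasurable (f : T -> R[i]) : Prop :=
  measurable_fun setT (fun y => Re (f y)) /\
  measurable_fun setT (fun y => Im (f y)).

Definition cintegral (f : T -> R[i]) : R[i] :=
  Rintegral mu setT (fun y => Re (f y)) +i* Rintegral mu setT (fun y => Im (f y)).

Definition sqint (f : T -> R[i]) : \bar R :=
  (\int[mu]_y (normc (f y) ^+ 2)%:E)%E.

Definition L2 (f : T -> R[i]) : Prop := cmeasurable f /\ (sqint f < +oo)%E.

Definition L2norm (f : T -> R[i]) : R := Num.sqrt (fine (sqint f)).

End complex_integral.

(** * Schwartz functions and tempered distributions *)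

Lemma continuous_lin (R : realType) (T : topologicalType) (a b : R)
    (u v : T -> R) :
  continuous u -> continuous v -> continuous (fun x => a * u x + b * v x).
Proof.
move=> cu cv x; apply: cvgD; apply: cvgM;
  by [exact: cvg_cst|exact: cu|exact: cv].
Qed.

Section schwartz.
Variables (R : realType) (n : nat).
Local Notation "''e_' i" := (delta_mx 0 i : 'rV[R]_n).
Implicit Types (u v : 'rV[R]_n -> R) (f g : 'rV[R]_n -> R[i]).

Definition partials (l : seq 'I_n) u : 'rV[R]_n -> R :=
  foldr (fun i v x => 'D_('e_i) v x) u l.

Definition smooth u : Prop :=
  forall l, continuous (partials l u) /\
            forall x i, derivable (partials l u) x 'e_i.

Definition multiindex := {ffun 'I_n -> nat}.

(* [partials (word a)] is the iterated derivative of multi-index [a]. *)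
Definition word (a : multiindex) : seq 'I_n :=
  flatten [seq nseq (a i) i | i <- enum 'I_n].

Definition cderiv (a : multiindex) f (x : 'rV[R]_n) : R[i] :=
  partials (word a) (fun z => Re (f z)) x +i*
  partials (word a) (fun z => Im (f z)) x.

Definition monomial (b : multiindex) (x : 'rV[R]_n) : R :=
  \prod_i x ord0 i ^+ b i.

Definition weighted (a b : multiindex) f : set R :=
  range (fun x => normc ((monomial b x)%:C * cderiv a f x)).

Definition schwartz f : Prop :=
  [/\ smooth (fun x => Re (f x)), smooth (fun x => Im (f x)) &
      forall a b, has_ubound (weighted a b f)].

(* Functions on R^n x I_n are functions of the first n coordinates, so Schwartz
   functions are taken on R^n. *)
Definition schwartzb : pred ('rV[R]_n -> R[i]) := fun f => `[< schwartz f >].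

Lemma partials_lin l (a b : R) u v : smooth u -> smooth v ->
  partials l (fun x => a * u x + b * v x) =
  (fun x => a * partials l u x + b * partials l v x).
Proof.
move=> su sv; elim: l => [//|i l IH] /=.
rewrite IH; apply/funext => x.
have du : derivable (a \*: partials l u) x 'e_i by apply: derivableZ; exact: (su l).2.
have dv : derivable (b \*: partials l v) x 'e_i by apply: derivableZ; exact: (sv l).2.
rewrite [LHS](deriveD du dv).
by rewrite (deriveZ a ((su l).2 x i)) (deriveZ b ((sv l).2 x i)).
Qed.

Lemma partials_cst0 l : partials l (cst 0) = cst 0.
Proof.
elim: l => [//|i l IH] /=; rewrite IH; apply/funext => x; exact: derive_cst.
Qed.

Lemma smooth_cst0 : smooth (cst 0).
Proof.
move=> l; rewrite partials_cst0; split; first exact: cst_continuous.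
by move=> x i; exact: derivable_cst.
Qed.

Lemma smooth_lin (a b : R) u v : smooth u -> smooth v ->
  smooth (fun x => a * u x + b * v x).
Proof.
move=> su sv l; rewrite partials_lin//; split.
  exact: continuous_lin (su l).1 (sv l).1.
move=> x i.
have du : derivable (a \*: partials l u) x 'e_i by apply: derivableZ; exact: (su l).2.
have dv : derivable (b \*: partials l v) x 'e_i by apply: derivableZ; exact: (sv l).2.
exact: derivableD du dv.
Qed.

Lemma Re_lin (c : R[i]) f g :
  (fun x => Re ((c *: f + g) x)) =
  (fun x => 1 * (Re c * Re (f x) + - Im c * Im (f x)) + 1 * Re (g x)).
Proof.
apply/funext => x; rewrite !mul1r.
have -> : (c *: f + g) x = c * f x + g x by [].
by case: c (f x) (g x) => [? ?] [? ?] [? ?] /=; rewrite mulNr.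
Qed.

Lemma Im_lin (c : R[i]) f g :
  (fun x => Im ((c *: f + g) x)) =
  (fun x => 1 * (Im c * Re (f x) + Re c * Im (f x)) + 1 * Im (g x)).
Proof.
apply/funext => x; rewrite !mul1r.
have -> : (c *: f + g) x = c * f x + g x by [].
by case: c (f x) (g x) => [? ?] [? ?] [? ?] /=; rewrite [X in X + _]addrC.
Qed.

Lemma cderiv_lin a (c : R[i]) f g : schwartz f -> schwartz g ->
  cderiv a (c *: f + g) = c *: cderiv a f + cderiv a g.
Proof.
move=> [f1 f2 _] [g1 g2 _]; apply/funext => x.
have sR := @smooth_lin (Re c) (- Im c) _ _ f1 f2.
have sI := @smooth_lin (Im c) (Re c) _ _ f1 f2.
rewrite [LHS]/cderiv Re_lin Im_lin.
rewrite (@partials_lin _ 1 1 _ _ sR g1) (@partials_lin _ 1 1 _ _ sI g2).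
rewrite (@partials_lin _ (Re c) (- Im c) _ _ f1 f2).
rewrite (@partials_lin _ (Im c) (Re c) _ _ f1 f2) !mul1r mulNr.
have -> : (c *: cderiv a f + cderiv a g) x = c * cderiv a f x + cderiv a g x.
  by [].
rewrite /cderiv; move: (partials _ _ x) (partials _ _ x) => p q.
by case: c {sR sI} => ? ? /=; congr (_ +i* (_ + _)); rewrite addrC.
Qed.

Fact schwartz_submod_closed : submod_closed schwartzb.
Proof.
split.
  apply/asboolP; split.
  - exact: smooth_cst0.
  - exact: smooth_cst0.
  - move=> a b; exists 0 => _ [x _ <-].
    have p0 l : partials l (fun=> 0 : R) x = 0.
      by have -> : partials l (fun=> 0) = cst 0 by exact: partials_cst0.
    rewrite (_ : cderiv a _ x = 0) ?mulr0 ?normc0//.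
    by rewrite /cderiv/= !p0.
move=> c f g /asboolP sf /asboolP sg; apply/asboolP.
have [f1 f2 f3] := sf; have [g1 g2 g3] := sg; split.
- rewrite Re_lin.
  exact: (@smooth_lin 1 1 _ _ (@smooth_lin (Re c) (- Im c) _ _ f1 f2) g1).
- rewrite Im_lin.
  exact: (@smooth_lin 1 1 _ _ (@smooth_lin (Im c) (Re c) _ _ f1 f2) g2).
- move=> a b; have [M fM] := f3 a b; have [N gN] := g3 a b.
  exists (normc c * M + N) => _ [x _ <-].
  rewrite cderiv_lin//.
  have -> : (c *: cderiv a f + cderiv a g) x = c * cderiv a f x + cderiv a g x by [].
  rewrite mulrDr mulrCA (le_trans (le_normcD _ _))//.
  apply: lerD; last by apply: gN; exists x.
  rewrite normcM ler_wpM2l//; last by apply: fM; exists x.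
  by case: c => ? ?; exact: sqrtr_ge0.
Qed.

Record schwartz_fun := SchwartzFun {
  schwartz_val :> 'rV[R]_n -> R[i];
  _ : schwartzb schwartz_val }.

HB.instance Definition _ := [isSub for schwartz_val].
HB.instance Definition _ := [Choice of schwartz_fun by <:].
HB.instance Definition _ :=
  GRing.SubChoice_isSubLmodule.Build _ _ _ schwartz_fun schwartz_submod_closed.

Definition seminorm (a b : multiindex) f : R := sup (weighted a b f).

Definition cvg_schwartz (phi_ : nat -> schwartz_fun) (phi : schwartz_fun) : Prop :=
  forall a b, seminorm a b (phi_ k - phi) @[k --> \oo] --> 0.

(* S^* is the set of those T satisfying [tempered]; it sits in the R[i]-module of
   all functions S -> R[i]. *)
Definition functional := schwartz_fun -> R[i].

HB.instance Definition _ := GRing.Lmodule.on functional.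

Definition tempered (T : functional) : Prop :=
  (forall (c : R[i]) (phi psi : schwartz_fun),
     T (c *: phi + psi) = c * T phi + T psi) /\
  (forall (phi_ : nat -> schwartz_fun) (phi : schwartz_fun),
     cvg_schwartz phi_ phi -> normc (T (phi_ k) - T phi) @[k --> \oo] --> 0).

(** * Bessel potentials *)

Definition dot (x y : 'rV[R]_n) : R := \sum_i x ord0 i * y ord0 i.

Definition cis (t : R) : R[i] := cos t +i* sin t.

Definition fourier f (xi : 'rV[R]_n) : R[i] :=
  cintegral (@lambda_RI R n)
    (fun y => f (proj_n y) * cis (- (2 * pi * dot xi (proj_n y)))).

Definition bessel_fun (s : R) f (x : 'rV[R]_n) : R[i] :=
  cintegral (@lambda_RI R n)
    (fun y => ((1 + dot (proj_n y) (proj_n y)) `^ (s / 2))%:C *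
              fourier f (proj_n y) * cis (2 * pi * dot (proj_n y) x)).

(* [bessel_fun s phi] is a Schwartz function whenever [phi] is, so the default
   value of [insubd] is never used. *)
Definition bessel (s : R) (phi : schwartz_fun) : schwartz_fun :=
  insubd (0 : schwartz_fun) (bessel_fun s phi).

Definition Bessel (s : R) (T : functional) : functional :=
  fun phi => T (bessel s phi).

(* The functional on S attached to a function on R^n x I_n. *)
Definition regular (g : RI R n -> R[i]) : functional :=
  fun phi => cintegral (@lambda_RI R n) (fun y => g y * phi (proj_n y)).

End schwartz.

(** * The space KS^2 *)

Section kuelbs_steadman.
Variables (R : realType) (n : nat).
Local Notation RIn := (borel (RI R n)).

(* [center] enumerates the x_i and [cube_index] enumerates the pairs (j, i) with
   j >= 1: [cube_index r = (j, i)] stands for the pair (j + 1, i). *)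
Record cube_system := CubeSystem {
  center : nat -> 'rV[rat]_n;
  center_bij : bijective center;
  cube_index : nat -> nat * nat;
  cube_index_bij : bijective cube_index;
  tau : nat -> R;
  tau_gt0 : forall r, 0 < tau r;
  tau_sum1 : series tau @ \oo --> (1 : R) }.

Variable D : cube_system.

Definition edge (r : nat) : R :=
  (2 ^+ (cube_index D r).1.+1 * Num.sqrt n%:R)^-1.

Definition cube (r : nat) : set RIn :=
  [set y | forall k : 'I_n,
    `|proj_n y ord0 k - ratr (center D (cube_index D r).2 ord0 k)| <= edge r / 2].

Definition zeta (r : nat) (y : RIn) : R[i] := (\1_(cube r) y)%:C.

Definition cseries (u : nat -> R[i]) : R[i] :=
  limn (series (fun r => Re (u r))) +i* limn (series (fun r => Im (u r))).

Definition KS_form (f g : RIn -> R[i]) : R[i] :=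
  cseries (fun r => (tau D r)%:C *
    cintegral (@lambda_RI R n) (fun y => zeta r y * f y) *
    (cintegral (@lambda_RI R n) (fun y => zeta r y * g y))^*).

Definition ip_norm (ip : functional R n -> functional R n -> R[i])
    (T : functional R n) : R := Num.sqrt (Re (ip T T)).

(* A completion of L^2 for [KS_form], realized inside S^*.  The condition
   P^s f \in KS^2 for f in S^* presupposes that the points of the completion are
   tempered distributions, with g in L^2 identified with [regular g].  A
   completion is unique up to an isometry fixing L^2, but this does not single out
   the distributions attached to its new points; all such realizations are
   considered.  There are some: the abstract completion has dimension at most that
   of the continuum, and so many Dirac masses are independent modulo L^2, hence
   the identity of L^2 extends to a linear injection of it into S^*. *)
Record KS2_space := KS2Space {
  KS2 :> set (functional R n);
  KS2_ip : functional R n -> functional R n -> R[i];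
  KS2_tempered : KS2 `<=` [set T | tempered T];
  KS2_lin : forall (c : R[i]) T U, KS2 T -> KS2 U -> KS2 (c *: T + U);
  KS2_ip_lin : forall (c : R[i]) T U V, KS2 T -> KS2 U -> KS2 V ->
    KS2_ip (c *: T + U) V = c * KS2_ip T V + KS2_ip U V;
  KS2_ip_conj : forall T U, KS2 T -> KS2 U -> KS2_ip U T = (KS2_ip T U)^*;
  KS2_ip_ge0 : forall T, KS2 T -> 0 <= KS2_ip T T;
  KS2_ip_eq0 : forall T, KS2 T -> KS2_ip T T = 0 -> T = 0;
  KS2_complete : forall T_ : nat -> functional R n, (forall k, KS2 (T_ k)) ->
    (forall e : R, 0 < e -> exists N, forall k l, (N <= k)%N -> (N <= l)%N ->
       ip_norm KS2_ip (T_ k - T_ l) < e) ->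
    exists2 T, KS2 T & ip_norm KS2_ip (T_ k - T) @[k --> \oo] --> 0;
  KS2_L2 : forall g, L2 (@lambda_RI R n) g -> KS2 (regular g);
  KS2_ip_L2 : forall f g, L2 (@lambda_RI R n) f -> L2 (@lambda_RI R n) g ->
    KS2_ip (regular f) (regular g) = KS_form f g;
  KS2_dense : forall T, KS2 T -> forall e : R, 0 < e ->
    exists2 g, L2 (@lambda_RI R n) g &
      ip_norm KS2_ip (T - regular g) < e }.

End kuelbs_steadman.

(** * The spaces W and WS *)

Section sobolev.
Variables (R : realType) (n : nat) (D : cube_system R n) (K : KS2_space D).
Variable s : R.
Implicit Types T : functional R n.

(* The density g of a regular distribution is unique up to a null set, so the
   value does not depend on the representative that [xget] picks. *)
Definition distr_L2norm T : R :=
  xget 0 [set a | exists g, [/\ L2 (@lambda_RI R n) g, T = regular g &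
                               a = L2norm (@lambda_RI R n) g]].

Definition W : set (functional R n) :=
  [set T | tempered T /\
           exists2 g, L2 (@lambda_RI R n) g & Bessel s T = regular g].

Definition W_norm T : R := distr_L2norm (Bessel s T).

Definition WS : set (functional R n) :=
  [set T | tempered T /\ KS2 K (Bessel s T)].

Definition WS_ip T U : R[i] := KS2_ip K (Bessel s T) (Bessel s U).

Definition WS_norm T : R := ip_norm WS_ip T.

End sobolev.

(* For the linear inclusion, boundedness is continuity. *)
Definition dense_continuous_embedding (R : realType) (V : zmodType)
    (A : set V) (normA : V -> R) (B : set V) (normB : V -> R) : Prop :=
  [/\ A `<=` B,
      exists C : R, forall v, A v -> normB v <= C * normA v &
      forall v, B v -> forall e : R, 0 < e -> exists2 a, A a & normB (v - a) < e].

(* Main.v *)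
(* A new point of KS^2 is an arbitrary tempered distribution, so density rests on
   the L^2 functions alone: L^2 is dense in KS^2, and it suffices to approximate a
   function g of L^2, in the norm of KS^2, by functions G in L^2 with G = P^s a for
   a tempered a.  Truncate g to a bounded integrable h, which costs little in L^2,
   and let G = h * p_e with p_e the Poisson kernel whose Fourier transform is
   exp(-e(|xi_1| + ... + |xi_n|)).  Since (1 + |xi|^2)^(-s/2) hat(G) is integrable, it
   is the Fourier transform of a bounded function a, and P^s a = G by inversion on
   Schwartz functions.  As e -> 0 the integral of G over a cube tends to that of h,
   because 1_B * p_e -> 1_B off the faces of the cube B; these integrals are bounded
   uniformly in the cube and in e, and sum tau_r = 1, so G -> h in KS^2.
   Boundedness: a cube has measure at most 1, so by Cauchy-Schwarz each squared
   coefficient is at most a constant times the squared L^2 norm. *)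

Require Import Defs.
From HB Require Import structures.
From mathcomp Require Import all_boot all_order all_algebra.
From mathcomp Require Import all_classical all_reals all_analysis.
From mathcomp Require Import complex measurable_realfun ring lra.

Set Implicit Arguments.
Unset Strict Implicit.
Unset Printing Implicit Defensive.

Import Order.TTheory GRing.Theory Num.Theory.
Import numFieldNormedType.Exports.
Import ComplexField.Normc.

Local Open Scope classical_set_scope.
Local Open Scope ring_scope.
Local Open Scope complex_scope.

Local Notation Re := complex.Re.
Local Notation Im := complex.Im.
Local Notation borel T := (g_sigma_algebraType (@open T)).

(** * Real integrals *)

(** The window is a product of one-variable exponentials because exp(-e|t|) times a shifted cosine,
    and its transform the Cauchy kernel, both have elementary primitives: total mass and tails come
    from atan, and the n-dimensional facts by factoring. Its exponential decay also absorbs (1 +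
    |xi|^2)^(-s/2), which grows when s is negative. Much of the work is spent on test functions. P^s
    acts on distributions by duality, so P^s phi has to be a Schwartz function, and its transform
    has to be the symbol times that of phi; both rest on stability of the Schwartz class under the
    Fourier transform and on inversion. The obstacle there is that the seminorms bound derivatives
    only in sorted order of the coordinates. Transforms are therefore split into real cosine
    integrals with a shift, on which derivatives and multiplication by coordinates act by simple
    rules that keep the order of words. Complex integrals are bounded through real and imaginary
    parts, at the cost of a factor 2, so 4 for squares. In KS^2 itself squared norms are compared,
    by the parallelogram law. *)

Section real_integrals.
Context d (T : measurableType d) (R : realType).
Variable mu : {measure set T -> \bar R}.
Implicit Types f g : T -> R.

Definition rintegrable f := mu.-integrable setT (EFin \o f).

Lemma rintegrable_measurable f : rintegrable f -> measurable_fun setT f.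
Proof. by move=> /(measurable_int mu)/measurable_EFinP. Qed.

Lemma le_rintegrable f g : measurable_fun setT f ->
  (forall x, `|f x| <= g x) -> rintegrable g -> rintegrable f.
Proof.
move=> mf fg; apply: le_integrable => //; first exact/measurable_EFinP.
by move=> x _ /=; rewrite lee_fin (le_trans (fg x))// ler_norm.
Qed.

Lemma rintegrableD f g : rintegrable f -> rintegrable g ->
  rintegrable (fun x => f x + g x).
Proof.
move=> fi gi; rewrite /rintegrable (_ : _ \o _ = (EFin \o f) \+ (EFin \o g))%E//.
exact: integrableD.
Qed.

Lemma rintegrableZ c f : rintegrable f -> rintegrable (fun x => c * f x).
Proof.
move=> fi; rewrite /rintegrable (_ : _ \o _ = fun x => c%:E * (EFin \o f) x)%E//.
exact: integrableZl.
Qed.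

Lemma rintegrableN f : rintegrable f -> rintegrable (fun x => - f x).
Proof.
by move=> fi; rewrite (_ : (fun _ => _) = fun x => -1 * f x);
  [exact: rintegrableZ|apply/funext => x; rewrite mulN1r].
Qed.

Lemma rintegrable_norm f : rintegrable f -> rintegrable (fun x => `|f x|).
Proof. exact: integrable_norm. Qed.

Lemma le_norm_Rintegral f g : measurable_fun setT f ->
  (forall x, `|f x| <= g x) -> rintegrable g ->
  `|\int[mu]_x f x| <= \int[mu]_x g x.
Proof.
move=> mf fg gi; have fi := le_rintegrable mf fg gi.
apply: le_trans (le_normr_Rintegral _ fi) _ => //.
by apply: le_Rintegral => //; exact: rintegrable_norm.
Qed.

Lemma EFin_Rintegral f : rintegrable f ->
  ((\int[mu]_x f x)%:E = \int[mu]_x (f x)%:E)%E.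
Proof. by move=> fi; rewrite /Rintegral fineK// integrable_fin_num. Qed.

Lemma Rintegral_cvg (f_ : nat -> T -> R) f g :
  (forall k, measurable_fun setT (f_ k)) -> measurable_fun setT f ->
  {ae mu, forall x, f_ k x @[k --> \oo] --> f x} ->
  rintegrable g -> (forall k x, `|f_ k x| <= g x) ->
  \int[mu]_x f_ k x @[k --> \oo] --> \int[mu]_x f x.
Proof.
move=> mf_ mf ff gi fg.
have cf : {ae mu, forall x, setT x -> (EFin \o f_ k) x @[k --> \oo] --> (EFin \o f) x}.
  by apply: filterS ff => x fx _; apply/fine_cvgP; split; [exact: nearW|exact: fx].
have [] := @dominated_convergence _ T R mu setT measurableT
  (fun k => EFin \o f_ k) (EFin \o f) (EFin \o g).
- by move=> k; exact/measurable_EFinP.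
- exact/measurable_EFinP.
- exact: cf.
- exact: gi.
- by apply: aeW => x k _ /=; rewrite lee_fin.
move=> fi _ cvgf.
by apply: fine_cvg; rewrite EFin_Rintegral.
Qed.

End real_integrals.

(** * Fubini for real-valued iterated integrals *)

Section fubini.
Context d1 d2 (T1 : measurableType d1) (T2 : measurableType d2) (R : realType).
Variables (m1 : {sigma_finite_measure set T1 -> \bar R}).
Variables (m2 : {sigma_finite_measure set T2 -> \bar R}).
Variable f : T1 * T2 -> R.
Hypothesis fi : rintegrable (m1 \x m2)%E f.

Let mf : measurable_fun setT (EFin \o f).
Proof. exact: measurable_int fi. Qed.

Let F := fubini_F m2 (EFin \o f).
Let G := fubini_G m1 (EFin \o f).

Let Fi : m1.-integrable setT F. Proof. exact: integrable_fubini_F. Qed.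
Let Gi : m2.-integrable setT G.
Proof.
have mG : measurable_fun setT G by exact: (@measurable_fubini_G _ _ _ _ R m1 m2 _ fi).
apply/integrableP; split=> //; apply: le_lt_trans ((@integrable21ltyP _ _ _ _ R m1 m2 _ mf).1 fi).
apply: ge0_le_integral => //.
- by apply: measurableT_comp => //; exact: mG.
- apply: (measurable_fun_fubini_tonelli_G (abse \o (EFin \o f))) => [|y /=].
    exact: measurableT_comp.
  exact: normr_ge0.
- move=> y _; apply: le_abse_integral => //.
  exact: measurableT_comp.
Qed.

(** An integrable function is finite almost everywhere, so sending its infinite values to 0 with
    [fine] changes it on a null set only. This is what makes Fubini available for iterated
    [Rintegral]. *)
Let ae_fine d (T : measurableType d) (m : {measure set T -> \bar R}) H :
  m.-integrable setT H -> ae_eq m setT (EFin \o (fine \o H)) H.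
Proof.
move=> Hi; have := integrable_ae measurableT Hi.
by apply: filterS => x /= h _; rewrite fineK//; exact: h.
Qed.

Lemma rintegrable_fubini1 : rintegrable m1 (fun x => \int[m2]_y f (x, y)).
Proof.
apply/integrableP; split.
  apply/measurable_EFinP/measurableT_comp => //.
  exact: measurable_int Fi.
have /integrableP[mF] := Fi; apply: le_lt_trans.
rewrite le_eqVlt; apply/orP; left; apply/eqP; apply: ae_eq_integral => //.
- apply: measurableT_comp => //; apply/measurable_EFinP/measurableT_comp => //.
- exact: measurableT_comp.
by have := ae_fine Fi; apply: filterS => x h ? /=; rewrite -h.
Qed.

Lemma rintegrable_fubini2 : rintegrable m2 (fun y => \int[m1]_x f (x, y)).
Proof.
apply/integrableP; split.
  apply/measurable_EFinP/measurableT_comp => //.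
  exact: measurable_int Gi.
have /integrableP[mG] := Gi; apply: le_lt_trans.
rewrite le_eqVlt; apply/orP; left; apply/eqP; apply: ae_eq_integral => //.
- apply: measurableT_comp => //; apply/measurable_EFinP/measurableT_comp => //.
- exact: measurableT_comp.
by have := ae_fine Gi; apply: filterS => x h ? /=; rewrite -h.
Qed.

Lemma Rintegral_fubini1 :
  \int[m1]_x \int[m2]_y f (x, y) = \int[(m1 \x m2)%E]_z f z.
Proof.
congr fine; rewrite -integral12_prod_meas1//.
apply: ae_eq_integral => //; last exact: ae_fine.
- by apply/measurable_EFinP/measurableT_comp => //; exact: measurable_int Fi.
- exact: measurable_int Fi.
Qed.

Lemma Rintegral_fubini2 :
  \int[m2]_y \int[m1]_x f (x, y) = \int[(m1 \x m2)%E]_z f z.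
Proof.
congr fine; rewrite -integral21_prod_meas1//.
apply: ae_eq_integral => //; last exact: ae_fine.
- by apply/measurable_EFinP/measurableT_comp => //; exact: measurable_int Gi.
- exact: measurable_int Gi.
Qed.

End fubini.

Section product.
Context d1 d2 (T1 : measurableType d1) (T2 : measurableType d2) (R : realType).
Variables (m1 : {sigma_finite_measure set T1 -> \bar R}).
Variables (m2 : {sigma_finite_measure set T2 -> \bar R}).

Lemma rintegrable_prod (f : T1 -> R) (g : T2 -> R) :
  rintegrable m1 f -> rintegrable m2 g ->
  rintegrable (m1 \x m2)%E (fun z => f z.1 * g z.2).
Proof.
move=> fi gi.
have mf := rintegrable_measurable fi; have mg := rintegrable_measurable gi.
have mh : measurable_fun setT (fun z : T1 * T2 => f z.1 * g z.2).
  by apply: measurable_funM; apply: measurableT_comp.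
apply/integrable12ltyP; first exact/measurable_EFinP.
have -> : (\int[m1]_x \int[m2]_y `|(EFin \o (fun z : T1 * T2 => (f z.1 * g z.2)%R)) (x, y)|
  = \int[m1]_x (`|(f x)%:E| * \int[m2]_y `|(g y)%:E|))%E.
  apply: eq_integral => x _.
  rewrite -ge0_integralZl//.
  - by apply: eq_integral => y _; rewrite -abseM.
  - by apply/measurable_EFinP; exact: measurableT_comp.
have /integrableP[_ gb] := gi; have /integrableP[_ fb] := fi.
rewrite ge0_integralZr//; [|by apply/measurable_EFinP; exact: measurableT_comp|exact: integral_ge0].
apply: lte_mul_pinfty => //; first exact: integral_ge0.
by rewrite ge0_fin_numE//; exact: integral_ge0.
Qed.

End product.

(** * Change of variables along a pushforward *)

Section pushforward.
Context d1 d2 (T1 : measurableType d1) (T2 : measurableType d2) (R : realType).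
Variables (phi : T1 -> T2) (mphi : measurable_fun setT phi).
Variable mu : {measure set T1 -> \bar R}.

Lemma fine_integral_pushforward (f : T2 -> R) : measurable_fun setT f ->
  rintegrable mu (f \o phi) ->
  fine (\int[pushforward mu phi]_y (f y)%:E)%E = \int[mu]_x f (phi x).
Proof.
move=> /measurable_EFinP mf fi; congr fine.
have fi' : mu.-integrable (phi @^-1` setT) ((EFin \o f) \o phi).
  by rewrite preimage_setT; exact: fi.
have := @integral_pushforward _ _ _ _ R phi mphi mu setT _ mf fi' measurableT.
by rewrite preimage_setT.
Qed.

Lemma ge0_integral_pushforwardT (f : T2 -> \bar R) : measurable_fun setT f ->
  (forall y, 0 <= f y)%E ->
  (\int[pushforward mu phi]_y f y = \int[mu]_x f (phi x))%E.
Proof.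
move=> mf f0.
by rewrite (ge0_integral_pushforward mphi mu measurableT mf)// preimage_setT.
Qed.

End pushforward.

(** * Lebesgue measure on row vectors *)

Section row_measure.
Variables (R : realType) (n : nat).
Local Notation E := (borel 'rV[R]_n).

Let rV_measure : {measure set E -> \bar R} :=
  @measure_function_pushforward__canonical__measure_function_Measure
    _ _ _ _ _ (lebesgue_tuple R n) _ (@measurable_row_of_tuple R n).

Let rV0 : @lambda_rV R n set0 = 0%E.
Proof. exact: (measure0 rV_measure). Qed.

Let rV_ge0 A : (0 <= @lambda_rV R n A)%E.
Proof. exact: (measure_ge0 rV_measure). Qed.

Let rV_sigma_additive : semi_sigma_additive (@lambda_rV R n).
Proof. exact: (@measure_semi_sigma_additive _ _ _ rV_measure). Qed.

HB.instance Definition _ := isMeasure.Build _ _ _ (@lambda_rV R n)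
  rV0 rV_ge0 rV_sigma_additive.

Definition tuple_of_row (x : E) : n.-tuple R := [tuple x ord0 i | i < n].

Lemma row_of_tupleK : cancel (@row_of_tuple R n) tuple_of_row.
Proof. by move=> t; apply: eq_from_tnth => i; rewrite tnth_mktuple mxE. Qed.

Lemma continuous_measurable_row (u : 'rV[R]_n -> R) :
  continuous u -> measurable_fun [set: E] (u : E -> R).
Proof.
move=> /continuousP cu; apply: (measurability _ (RGenOpens.measurableE R)).
move=> _ [_ [a [b ->] <-]]; rewrite setTI; apply: sub_sigma_algebra.
exact/cu/interval_open.
Qed.

Lemma continuous_coord (i : 'I_n) : continuous (fun x : 'rV[R]_n => x ord0 i).
Proof. exact: coord_continuous. Qed.

Lemma measurable_coord (i : 'I_n) : measurable_fun setT (fun x : E => x ord0 i).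
Proof. by apply: continuous_measurable_row; exact: continuous_coord. Qed.

Lemma measurable_tuple_of_row : measurable_fun setT tuple_of_row.
Proof.
apply/measurable_fun_tnthP => i; rewrite (_ : _ \o _ = fun x : E => x ord0 i).
  exact: measurable_coord.
by apply/funext => x /=; rewrite tnth_mktuple.
Qed.

Lemma lambda_rV_sigma_finite : sigma_finite setT (@lambda_rV R n).
Proof.
have [F FT Foo] := sigma_finiteT (lebesgue_tuple R n).
exists (fun k => tuple_of_row @^-1` F k) => [|k].
  by rewrite -preimage_bigcup -FT preimage_setT.
have [mF Fk] := Foo k; split.
  by rewrite -[X in measurable X]setTI; exact: measurable_tuple_of_row.
rewrite /lambda_rV /pushforward (_ : _ @^-1` _ = F k)//.
by apply/seteqP; split => p /=; rewrite row_of_tupleK.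
Qed.

HB.instance Definition _ := Measure_isSigmaFinite.Build _ _ _ (@lambda_rV R n)
  lambda_rV_sigma_finite.

End row_measure.

(** * Passage between the product space, row vectors and tuples *)

Section transfer.
Variables (R : realType) (n : nat).
Local Notation E := (borel 'rV[R]_n).
Local Notation RIn := (borel (RI R n)).
Local Notation mu := (@lambda_rV R n).

Lemma measurable_proj_n : measurable_fun setT (@proj_n R n : RIn -> E).
Proof.
have := @measurability _ _ RIn E setT (@proj_n R n) (@open 'rV[R]_n) erefl.
apply=> _ [U oU <-]; rewrite setTI; apply: sub_sigma_algebra.
by exists U.
Qed.

Lemma ge0_integral_RI (f : RIn -> \bar R) : measurable_fun setT f ->
  (forall y, 0 <= f y)%E ->
  (\int[@lambda_RI R n]_y f y = \int[mu]_x f (section0 x))%E.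
Proof.
move=> mf f0.
exact: (@ge0_integral_pushforwardT _ _ _ _ R _ (@measurable_section0 R n) mu).
Qed.

Lemma rintegrable_RI (f : RIn -> R) : measurable_fun setT f ->
  rintegrable (@lambda_RI R n) f <-> rintegrable mu (f \o @section0 R n).
Proof.
move=> mf.
have e : (\int[@lambda_RI R n]_y `|(EFin \o f) y| =
    \int[mu]_x `|(EFin \o (f \o @section0 R n)) x|)%E.
  rewrite ge0_integral_RI//; apply: measurableT_comp => //.
  exact/measurable_EFinP.
split=> /integrableP[_ fi]; apply/integrableP; split.
- apply/measurable_EFinP/measurableT_comp => //; exact: measurable_section0.
- by rewrite -e.
- exact/measurable_EFinP.
- by rewrite e.
Qed.

Lemma Rintegral_RI (f : RIn -> R) : measurable_fun setT f ->
  rintegrable mu (f \o @section0 R n) ->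
  \int[@lambda_RI R n]_y f y = \int[mu]_x f (section0 x).
Proof.
exact: (@fine_integral_pushforward _ _ _ _ R _ (@measurable_section0 R n) mu).
Qed.

Lemma ge0_integral_rV (f : E -> \bar R) : measurable_fun setT f ->
  (forall y, 0 <= f y)%E ->
  (\int[mu]_x f x = \int[lebesgue_tuple R n]_t f (row_of_tuple t))%E.
Proof.
move=> mf f0.
exact: (@ge0_integral_pushforwardT _ _ _ _ R _ (@measurable_row_of_tuple R n)
  (lebesgue_tuple R n)).
Qed.

Lemma rintegrable_rV (f : E -> R) : measurable_fun setT f ->
  rintegrable mu f <-> rintegrable (lebesgue_tuple R n) (f \o @row_of_tuple R n).
Proof.
move=> mf.
have e : (\int[mu]_y `|(EFin \o f) y| =
    \int[lebesgue_tuple R n]_x `|(EFin \o (f \o @row_of_tuple R n)) x|)%E.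
  rewrite ge0_integral_rV//; apply: measurableT_comp => //.
  exact/measurable_EFinP.
split=> /integrableP[_ fi]; apply/integrableP; split.
- apply/measurable_EFinP/measurableT_comp => //; exact: measurable_row_of_tuple.
- by rewrite -e.
- exact/measurable_EFinP.
- by rewrite e.
Qed.

Lemma Rintegral_rV (f : E -> R) : measurable_fun setT f ->
  rintegrable (lebesgue_tuple R n) (f \o @row_of_tuple R n) ->
  \int[mu]_x f x = \int[lebesgue_tuple R n]_t f (row_of_tuple t).
Proof.
exact: (@fine_integral_pushforward _ _ _ _ R _ (@measurable_row_of_tuple R n)
  (lebesgue_tuple R n)).
Qed.

End transfer.

(** * Integrals over tuples, one coordinate at a time *)

Section tuple_integrals.
Variable R : realType.
Local Notation leb := (@lebesgue_measure R).
Let prodm n : {measure set (measurableTypeR R * n.-tuple R)%type -> \bar R} :=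
  (leb \x lebesgue_tuple R n)%E.

Lemma ge0_integral_tcons n (f : n.+1.-tuple R -> \bar R) :
  measurable_fun setT f -> (forall t, 0 <= f t)%E ->
  (\int[lebesgue_tuple R n.+1]_t f t =
   \int[leb]_a \int[lebesgue_tuple R n]_t f (tcons (a, t)))%E.
Proof.
move=> mf f0.
have -> : (\int[lebesgue_tuple R n.+1]_t f t =
    \int[(leb \x lebesgue_tuple R n)%E]_z f (tcons z))%E.
  exact: (@ge0_integral_pushforwardT _ _ (measurableTypeR R * n.-tuple R)%type
    (n.+1.-tuple R) R _ (@measurable_tcons R n)
    (prodm n)).
have mft : measurable_fun setT (f \o @tcons R n).
  by apply: measurableT_comp => //; exact: measurable_tcons.
exact: (@fubini_tonelli1 _ _ (measurableTypeR R) (n.-tuple R) R leb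
  (lebesgue_tuple R n) (f \o @tcons R n) mft (fun=> f0 _)).
Qed.

Lemma rintegrable_tcons n (f : n.+1.-tuple R -> R) : measurable_fun setT f ->
  rintegrable (lebesgue_tuple R n.+1) f <->
  rintegrable (leb \x lebesgue_tuple R n)%E (f \o @tcons R n).
Proof.
move=> mf.
have e : (\int[lebesgue_tuple R n.+1]_y `|(EFin \o f) y| =
    \int[(leb \x lebesgue_tuple R n)%E]_x `|(EFin \o (f \o @tcons R n)) x|)%E.
  apply: (@ge0_integral_pushforwardT _ _ (measurableTypeR R * n.-tuple R)%type
    (n.+1.-tuple R) R _ (@measurable_tcons R n)
    (prodm n) (fun y => `|(EFin \o f) y|%E)) => //.
  by apply: measurableT_comp => //; exact/measurable_EFinP.
split=> /integrableP[_ fi]; apply/integrableP; split.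
- apply/measurable_EFinP/measurableT_comp => //; exact: measurable_tcons.
- by rewrite -e.
- exact/measurable_EFinP.
- by rewrite e.
Qed.

Lemma Rintegral_tcons n (f : n.+1.-tuple R -> R) :
  rintegrable (lebesgue_tuple R n.+1) f ->
  \int[lebesgue_tuple R n.+1]_t f t =
  \int[(leb \x lebesgue_tuple R n)%E]_z f (tcons z).
Proof.
move=> fi; have mf := rintegrable_measurable fi.
have fi' : rintegrable (leb \x lebesgue_tuple R n)%E (f \o @tcons R n).
  exact/rintegrable_tcons.
exact: (@fine_integral_pushforward _ _ (measurableTypeR R * n.-tuple R)%type
  (n.+1.-tuple R) R _ (@measurable_tcons R n)
  (prodm n)).
Qed.

Lemma tnth_tcons0 n a (t : n.-tuple R) : tnth (tcons (a, t)) ord0 = a.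
Proof. by []. Qed.

Lemma tnth_tconsS n a (t : n.-tuple R) i :
  tnth (tcons (a, t)) (lift ord0 i) = tnth t i.
Proof. exact: tnthS. Qed.

Lemma ge0_integral_prod_tuple n (f : 'I_n -> R -> R) :
  (forall i, measurable_fun setT (f i)) -> (forall i x, 0 <= f i x) ->
  (\int[lebesgue_tuple R n]_t (\prod_i f i (tnth t i))%:E =
   \prod_i \int[leb]_a (f i a)%:E)%E.
Proof.
elim: n f => [|n IH] f mf f0.
  rewrite big_ord0; under eq_integral do rewrite big_ord0.
  by rewrite integral_cst//= diracT mul1e.
have mp m (g : 'I_m -> R -> R) : (forall i, measurable_fun setT (g i)) ->
    measurable_fun setT (fun t : m.-tuple R => \prod_i g i (tnth t i)).
  move=> mg; apply: measurable_prod => i _.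
  by apply: measurableT_comp => //; exact: measurable_tnth.
have inner a : (\int[lebesgue_tuple R n]_t (\prod_i f i (tnth (tcons (a, t)) i))%:E =
    (f ord0 a)%:E * \prod_i \int[leb]_b (f (lift ord0 i) b)%:E)%E.
  rewrite -(IH (fun i => f (lift ord0 i)))// -ge0_integralZl//; last first.
  - by rewrite lee_fin.
  - by move=> t _; rewrite lee_fin prodr_ge0.
  - by apply/measurable_EFinP; exact: (mp n (fun i => f (lift ord0 i))).
  apply: eq_integral => t _; rewrite -EFinM big_ord_recl tnth_tcons0.
  by congr (_ * _)%:E; apply: eq_bigr => i _; rewrite tnth_tconsS.
rewrite ge0_integral_tcons; last first.
- by move=> t; rewrite lee_fin prodr_ge0.
- by apply/measurable_EFinP; exact: mp.
under eq_integral do rewrite inner.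
rewrite big_ord_recl ge0_integralZr//; last first.
- by apply: prode_ge0 => i _; apply: integral_ge0 => ? _; rewrite lee_fin.
- by move=> ? _; rewrite lee_fin.
- by apply/measurable_EFinP; exact: mf.
Qed.

End tuple_integrals.

(** * Exponential windows and Poisson kernels *)

Section one_dimensional.
Variable R : realType.
Local Notation leb := (@lebesgue_measure R).
Implicit Types (e a t x d : R).

Lemma is_derive_comp1 (f g : R -> R) x df dg :
  is_derive (g x) 1 f df -> is_derive x 1 g dg ->
  is_derive x 1 (fun t => f (g t)) (df * dg).
Proof. exact: is_derive1_comp. Qed.

Lemma is_derive_affine (a b x : R) : is_derive x 1 (fun t => a * t + b) a.
Proof.
have -> : (fun t : R => a * t + b) = a \*: id + cst b by [].
apply: is_derive_eq; by rewrite /= addr0 [_ *: _]mulr1.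
Qed.

Lemma is_derive_mul (f g : R -> R) x df dg :
  is_derive x 1 f df -> is_derive x 1 g dg ->
  is_derive x 1 (fun t => f t * g t) (df * g x + f x * dg).
Proof.
move=> hf hg; apply: (is_derive_eq (is_deriveM hf hg)).
by rewrite addrC; congr (_ + _); rewrite [LHS]mulrC.
Qed.

Lemma is_derive_lin (f g : R -> R) (a b : R) x df dg :
  is_derive x 1 f df -> is_derive x 1 g dg ->
  is_derive x 1 (fun t => a * f t + b * g t) (a * df + b * dg).
Proof.
move=> hf hg; exact: (is_derive_eq (is_deriveD (is_deriveZ a hf) (is_deriveZ b hg))).
Qed.

Lemma derive_continuous (F f : R -> R) : (forall x, is_derive x 1 F (f x)) ->
  continuous F.
Proof.
move=> dF x; apply: differentiable_continuous; apply/derivable1_diffP.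
by have [] := dF x.
Qed.

Lemma integral_FTC2y (F f : R -> R) (a l : R) : (forall x, is_derive x 1 F (f x)) ->
  continuous f -> (forall x, a <= x -> 0 <= f x) ->
  F x @[x --> +oo] --> l ->
  (\int[leb]_(x in `[a, +oo[) (f x)%:E = (l - F a)%:E)%E.
Proof.
move=> dF cf f0 Fl; rewrite EFinB.
have cfa : {within `[a, +oo[, continuous f}.
  by apply: continuous_subspaceT => x; exact: cf.
have Fa : F x @[x --> a^'+] --> F a.
  by apply: cvg_at_right_filter; exact: (derive_continuous dF).
have dFx x : a < x -> derivable F x 1 by move=> _; have [] := dF x.
apply: (ge0_continuous_FTC2y f0 cfa Fl dFx Fa) => x _.
by rewrite derive1E; have h := dF x; exact: derive_val.
Qed.

Lemma integral_reflect (G : R -> R) a : continuous G -> (forall x, 0 <= G x) ->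
  (\int[leb]_(x in `]-oo, a]) (G x)%:E = \int[leb]_(x in `[(- a)%R, +oo[) (G (- x))%:E)%E.
Proof.
move=> cG G0; rewrite -[in LHS](opprK a) ge0_integration_by_substitutionNy//.
by apply: continuous_subspaceT => x; exact: cG.
Qed.

Lemma integral_split_at (G : R -> R) a : measurable_fun setT G -> (forall x, 0 <= G x) ->
  (\int[leb]_x (G x)%:E = \int[leb]_(x in `]-oo, a]) (G x)%:E +
    \int[leb]_(x in `[a, +oo[) (G x)%:E)%E.
Proof.
move=> mG G0.
rewrite -integral_itv_obnd_cbnd; last by apply/measurable_EFinP; exact: measurable_funTS.
rewrite -ge0_integral_setU//=.
- congr (integral _ _ _); rewrite -itv_bndbnd_setU ?set_itvNyy//.
- by apply/measurable_EFinP; exact: measurable_funTS.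
- by move=> x _; rewrite lee_fin.
- by rewrite disj_set2E; apply/eqP; rewrite -subset0 => x [] /=; rewrite !in_itv/= andbT => xa /(le_lt_trans xa); rewrite ltxx.
Qed.

(** The Cauchy density of scale e / (2 pi), which is the Fourier transform of exp(-e|t|) for the
    normalization exp(2 pi i t x). *)
Definition pker e t : R := 2 * e / (e ^+ 2 + (2 * pi * t) ^+ 2).

Lemma pker_den e t : 0 < e -> 0 < e ^+ 2 + (2 * pi * t) ^+ 2.
Proof. by move=> e0; rewrite ltr_pwDl ?exprn_gt0 ?sqr_ge0. Qed.

Lemma pker_ge0 e t : 0 < e -> 0 <= pker e t.
Proof.
by move=> e0; rewrite /pker divr_ge0 ?mulr_ge0 ?(ltW (pker_den _ _))// ltW.
Qed.

Lemma pker_even e t : pker e (- t) = pker e t.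
Proof. by rewrite /pker mulrN sqrrN. Qed.

Lemma continuous_pker e x : 0 < e -> continuous (fun t => pker e (t - x)).
Proof.
move=> e0 t; apply: cvgM; first exact: cvg_cst.
apply: cvgV; first by rewrite gt_eqF// pker_den.
apply: cvgD; first exact: cvg_cst.
rewrite /=; under eq_fun do rewrite expr2; rewrite expr2.
by apply: cvgM; (apply: cvgM; [exact: cvg_cst|apply: cvgB => //; exact: cvg_cst]).
Qed.

(** The primitive is atan / pi after rescaling. The term [0 * 0] is the second summand that
    [is_derive_lin] expects. *)
Let is_derive_pker e x t : 0 < e ->
  is_derive t 1 (fun s => pi^-1 * atan (2 * pi / e * s + - (2 * pi / e * x)) + 0 * 0)
    (pker e (t - x)).
Proof.
move=> e0.
have d1 := is_derive_comp1 (is_derive1_atan _)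
  (is_derive_affine (2 * pi / e) (- (2 * pi / e * x)) t).
apply: (is_derive_eq (is_derive_lin pi^-1 0 d1 (is_derive_cst (0:R) t 1))).
rewrite mul0r addr0 /pker; have := pker_den (t - x) e0.
have := pi_gt0 R; move: (@pi R) => p p0 h.
have -> : 1 + (2 * p / e * t + - (2 * p / e * x)) ^+ 2 =
  (e ^+ 2 + (2 * p * (t - x)) ^+ 2) / e ^+ 2.
  by field; rewrite gt_eqF.
by field; rewrite !gt_eqF.
Qed.

Lemma integral_pker_tail e d x : 0 < e ->
  (\int[leb]_(t in `[(x + d)%R, +oo[) (pker e (t - x))%:E =
   (2^-1 - pi^-1 * atan (2 * pi * d / e))%:E)%E.
Proof.
move=> e0; rewrite (integral_FTC2y (l := 2^-1) (is_derive_pker x ^~ e0)).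
- rewrite mulr0 addr0; congr (_ - _ * atan _)%:E.
  by field; rewrite gt_eqF.
- exact: continuous_pker.
- by move=> t _; exact: pker_ge0.
- have p0 : (pi : R) != 0 by rewrite gt_eqF// pi_gt0.
  rewrite (_ : 2^-1 = pi^-1 * (pi / 2) + 0 * 0); last by rewrite mulr0 addr0 mulKf.
  apply: cvgD; last exact: cvg_cst.
  apply: cvgM; first exact: cvg_cst.
  apply: (cvg_comp _ _ _ (@cvgy_atan R)); apply/cvgryPge => A.
  have c0 : 0 < 2 * pi / e by rewrite divr_gt0// mulr_gt0// pi_gt0.
  exists ((A + 2 * pi / e * x) / (2 * pi / e)); split; first exact: num_real.
  by move=> t; rewrite ltr_pdivrMr// => /ltW; rewrite lerBrDr [2 * pi / e * t]mulrC.
Qed.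

Lemma integral_pker_tailN e d x : 0 < e ->
  (\int[leb]_(t in `]-oo, (x - d)%R]) (pker e (t - x))%:E =
   (2^-1 - pi^-1 * atan (2 * pi * d / e))%:E)%E.
Proof.
move=> e0; rewrite integral_reflect; last 2 first.
- exact: continuous_pker.
- by move=> t; exact: pker_ge0.
rewrite opprB [(d - x)%R]addrC -(integral_pker_tail d (- x) e0).
apply: eq_integral => t _.
by rewrite -[X in pker e X]opprK pker_even opprD opprK.
Qed.

Lemma integral_pker e x : 0 < e -> (\int[leb]_t (pker e (t - x))%:E = 1)%E.
Proof.
move=> e0; rewrite (integral_split_at x).
- have := integral_pker_tail 0 x e0; have := integral_pker_tailN 0 x e0.
  rewrite addr0 subr0 mulr0 mul0r atan0 mulr0 subr0 => -> ->.
  by rewrite -EFinD (_ : 2^-1 + 2^-1 = 1 :> R)%R//; lra.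
- by apply: continuous_measurable_fun; exact: continuous_pker.
- by move=> t; exact: pker_ge0.
Qed.

Lemma rintegrable_cauchy : rintegrable leb (fun t => (1 + t ^+ 2)^-1).
Proof.
have p0 := pi_gt0 R.
have e0 : 0 < 2 * pi :> R by rewrite mulr_gt0.
(* At e = 2 pi the kernel is 1 / (pi (1 + t^2)). *)
have -> : (fun t : R => (1 + t ^+ 2)^-1) = (fun t => pi * pker (2 * pi) (t - 0)).
  apply/funext => t; rewrite subr0 /pker; move: (@pi R) p0 => p p0.
  have h : 1 + t ^+ 2 != 0 by rewrite gt_eqF// ltr_pwDl ?sqr_ge0.
  have h2 : (2 * p) ^+ 2 + (2 * p * t) ^+ 2 != 0.
    by rewrite gt_eqF// ltr_pwDl ?sqr_ge0// exprn_gt0// mulr_gt0.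
  by field; rewrite h h2.
apply: rintegrableZ; apply/integrableP; split.
  apply/measurable_EFinP; apply: continuous_measurable_fun.
  exact: continuous_pker.
under eq_integral do rewrite gee0_abs ?lee_fin ?pker_ge0//.
by rewrite integral_pker// ltry.
Qed.

Lemma cvg_expRMr e (g : R -> R) (C : R) : 0 < e -> (forall t, `|g t| <= C) ->
  expR (- (e * t)) * g t @[t --> +oo] --> (0:R).
Proof.
move=> e0 gC.
have h : expR (- (e * t)) * C @[t --> +oo] --> (0:R).
  rewrite -[X in _ --> X](mul0r C); apply: cvgM; last exact: cvg_cst.
  have ey : e * t @[t --> +oo] --> +oo.
    by apply: gt0_cvgMry => //; exact: cvg_id.
  exact: (cvg_comp _ _ ey (@cvgr_expR R)).
have h' : - (expR (- (e * t)) * C) @[t --> +oo] --> (0:R).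
  by rewrite -oppr0; exact: cvgN.
apply: (squeeze_cvgr _ h' h); apply: nearW => t.
by rewrite -ler_norml normrM ger0_norm ?expR_ge0// ler_wpM2l// expR_ge0.
Qed.

Section exponential_window.
Variables (e a : R).
Hypothesis e0 : 0 < e.

Let den0 : e ^+ 2 + a ^+ 2 != 0.
Proof. by rewrite gt_eqF// ltr_pwDl ?exprn_gt0 ?sqr_ge0. Qed.

(** A primitive of the integrand on the half-line t >= 0, where |t| = t. The [+ 0] in the exponent
    is the constant term of [is_derive_affine]. *)
Let is_derive_expc b t : is_derive t 1
  (fun s => expR (- e * s + 0) * (- e^-1 +
     (- e / (e ^+ 2 + a ^+ 2) * cos (a * s + b) + a / (e ^+ 2 + a ^+ 2) * sin (a * s + b))))
  (expR (- e * t + 0) * (1 + cos (a * t + b))).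
Proof.
have dE := is_derive_comp1 (is_derive_expR _) (is_derive_affine (- e) 0 t).
have dc := is_derive_comp1 (is_derive_cos _) (is_derive_affine a b t).
have ds := is_derive_comp1 (is_derive_sin _) (is_derive_affine a b t).
have d1 := is_derive_lin (- e / (e ^+ 2 + a ^+ 2)) (a / (e ^+ 2 + a ^+ 2)) dc ds.
have d2 := is_deriveD (is_derive_cst (- e^-1) t 1) d1.
apply: (is_derive_eq (is_derive_mul dE d2)).
rewrite !fctE /=; move: (expR _) (cos _) (sin _) => E c s.
have e1 : e != 0 by rewrite gt_eqF.
by field; rewrite den0 e1.
Qed.

Let continuous_h b : continuous (fun t => expR (- (e * `|t|)) * (1 + cos (a * t + b))).
Proof.
move=> t; apply: cvgM.
  apply: continuous_comp; last exact: continuous_expR.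
  by apply: cvgN; apply: cvgM; [exact: cvg_cst|exact: norm_continuous].
apply: cvgD; first exact: cvg_cst.
apply: continuous_comp; last exact: continuous_cos.
by apply: cvgD; [apply: cvgM; [exact: cvg_cst|exact: cvg_id]|exact: cvg_cst].
Qed.

Let h_ge0 b t : 0 <= expR (- (e * `|t|)) * (1 + cos (a * t + b)).
Proof. by rewrite mulr_ge0 ?expR_ge0// -lerBlDl sub0r cos_geN1. Qed.

Let half b : (\int[leb]_(t in `[0%R, +oo[) (expR (- (e * `|t|)) * (1 + cos (a * t + b)))%:E =
  (e^-1 + (e * cos b - a * sin b) / (e ^+ 2 + a ^+ 2))%:E)%E.
Proof.
transitivity (\int[leb]_(t in `[0%R, +oo[) (expR (- e * t + 0) * (1 + cos (a * t + b)))%:E)%E.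
  apply: eq_integral => t; rewrite inE/= in_itv/= andbT => t0.
  by rewrite addr0 mulNr ger0_norm.
rewrite (integral_FTC2y (l := 0) (is_derive_expc b)).
- rewrite !mulr0 !addr0 !add0r expR0 mul1r; congr EFin.
  by have e1 : e != 0; [rewrite gt_eqF|field; rewrite den0 e1].
- move=> t; apply: cvgM.
    apply: continuous_comp; last exact: continuous_expR.
    by apply: cvgD; [apply: cvgM; [exact: cvg_cst|exact: cvg_id]|exact: cvg_cst].
  apply: cvgD; first exact: cvg_cst.
  apply: continuous_comp; last exact: continuous_cos.
  by apply: cvgD; [apply: cvgM; [exact: cvg_cst|exact: cvg_id]|exact: cvg_cst].
- by move=> t _; rewrite mulr_ge0 ?expR_ge0// -lerBlDl sub0r cos_geN1.
- under eq_fun do rewrite addr0 mulNr.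
  apply: (cvg_expRMr (C := `|e^-1| + (`|e / (e ^+ 2 + a ^+ 2)| + `|a / (e ^+ 2 + a ^+ 2)|)) e0) => t.
  rewrite (le_trans (ler_normD _ _))// normrN lerD2l (le_trans (ler_normD _ _))//.
  rewrite !mulNr normrN !normrM lerD// ler_piMr ?mulr_ge0// ler_norml.
    by rewrite cos_geN1 cos_le1.
  by rewrite sin_geN1 sin_le1.
Qed.

(** Adding 1 to the cosine makes the integrand nonnegative, so the improper fundamental theorem
    applies without prior integrability. The cosine integral alone is recovered by subtraction in
    [Rintegral_window_cos]. *)
Lemma integral_window1Dcos b :
  (\int[leb]_t (expR (- (e * `|t|)) * (1 + cos (a * t + b)))%:E =
  (2 / e + 2 * e * cos b / (e ^+ 2 + a ^+ 2))%:E)%E.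
Proof.
rewrite (integral_split_at 0); last 2 first.
- by apply: continuous_measurable_fun; exact: continuous_h.
- exact: h_ge0.
rewrite half integral_reflect// oppr0.
(* Reflecting the left half-line replaces b by -b, so the sine terms of the two halves cancel. *)
transitivity ((e^-1 + (e * cos (- b) - a * sin (- b)) / (e ^+ 2 + a ^+ 2))%:E +
   (e^-1 + (e * cos b - a * sin b) / (e ^+ 2 + a ^+ 2))%:E)%E.
  congr (_ + _)%E; rewrite -half; apply: eq_integral => t _.
  by rewrite normrN mulrN -[- (a * t) + b]opprK cosN opprD opprK.
rewrite -EFinD cosN sinN; congr EFin.
have e1 : e != 0 by rewrite gt_eqF.
by field; rewrite den0 e1.
Qed.

End exponential_window.

(** The case a = b = 0 of the previous integral, where 1 + cos is the constant 2. *)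
Lemma integral_window e : 0 < e -> (\int[leb]_t (expR (- (e * `|t|)))%:E = (2 / e)%:E)%E.
Proof.
move=> e0; have := integral_window1Dcos 0 e0 0.
under eq_integral do rewrite mul0r addr0 cos0 mulrDr mulr1 -mulr2n -mulr_natr.
have mE : measurable_fun setT (fun t => expR (- (e * `|t|))).
  apply: measurableT_comp => //; apply: measurableT_comp => //.
  exact: measurable_funM.
under eq_integral do rewrite EFinM.
rewrite ge0_integralZr//; last 1 first.
- by apply/measurable_EFinP; exact: mE.
have -> : 2 / e + 2 * e * cos 0 / (e ^+ 2 + 0 ^+ 2) = 2 / e * 2.
  by rewrite cos0; field; rewrite gt_eqF.
rewrite EFinM; move/(congr1 (fun z : \bar R => z * (2^-1)%:E)%E).
by rewrite -!muleA -!EFinM mulfV// !mule1 mulr1.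
Qed.

Lemma rintegrable_window e : 0 < e -> rintegrable leb (fun t => expR (- (e * `|t|))).
Proof.
move=> e0; apply/integrableP; split.
  apply/measurable_EFinP; apply: measurableT_comp => //.
  by apply: measurableT_comp => //; exact: measurable_funM.
rewrite (_ : integral _ _ _ = (2 / e)%:E) ?ltry// -(integral_window e0).
by apply: eq_integral => t _ /=; rewrite ger0_norm// expR_ge0.
Qed.

Lemma measurable_cos_affine a b : measurable_fun setT (fun t => cos (a * t + b)).
Proof.
apply: continuous_measurable_fun => t.
apply: continuous_comp; last exact: continuous_cos.
by apply: cvgD; [apply: cvgM; [exact: cvg_cst|exact: cvg_id]|exact: cvg_cst].
Qed.

Lemma normr_cos_le1 t : `|cos t| <= 1.
Proof. by rewrite ler_norml cos_geN1 cos_le1. Qed.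

Lemma rintegrable_window_cos e a b : 0 < e ->
  rintegrable leb (fun t => expR (- (e * `|t|)) * cos (a * t + b)).
Proof.
move=> e0; have := rintegrable_window e0; apply: le_rintegrable.
  apply: measurable_funM; last exact: measurable_cos_affine.
  exact: rintegrable_measurable (rintegrable_window e0).
by move=> t; rewrite normrM ger0_norm ?expR_ge0// ler_piMr ?expR_ge0// normr_cos_le1.
Qed.

Lemma Rintegral_window_cos e a b : 0 < e ->
  \int[leb]_t (expR (- (e * `|t|)) * cos (a * t + b)) =
  2 * e / (e ^+ 2 + a ^+ 2) * cos b.
Proof.
move=> e0; have := integral_window1Dcos a e0 b.
have i1 := rintegrable_window e0; have i2 := rintegrable_window_cos a b e0.
move/(congr1 fine); rewrite -/(Rintegral _ _ _).
under eq_Rintegral do rewrite mulrDr mulr1.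
rewrite RintegralD// /Rintegral integral_window//= => /addrI ->.
by rewrite mulrAC.
Qed.

End one_dimensional.

(** * Products of one-variable functions on tuples *)

Section product_functions.
Variable R : realType.
Local Notation leb := (@lebesgue_measure R).

Lemma measurable_prod_tuple n (g : 'I_n -> R -> R) :
  (forall i, measurable_fun setT (g i)) ->
  measurable_fun setT (fun t : n.-tuple R => \prod_i g i (tnth t i)).
Proof.
move=> mg; apply: measurable_prod => i _.
by apply: measurableT_comp => //; exact: measurable_tnth.
Qed.

Lemma rintegrable_prod_tuple n (f : 'I_n -> R -> R) :
  (forall i x, 0 <= f i x) -> (forall i, rintegrable leb (f i)) ->
  rintegrable (lebesgue_tuple R n) (fun t => \prod_i f i (tnth t i)).
Proof.
move=> f0 fi; apply/integrableP; split.
  apply/measurable_EFinP; apply: (measurable_prod_tuple (g := f)) => i.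
  exact: rintegrable_measurable (fi i).
under eq_integral => t _ do rewrite gee0_abs ?lee_fin ?prodr_ge0//.
rewrite ge0_integral_prod_tuple//; last first.
  by move=> i; exact: rintegrable_measurable (fi i).
under eq_bigr do rewrite -EFin_Rintegral//.
by rewrite prodEFin ltry.
Qed.

Lemma measurable_sum_tuple n (v : 'I_n -> R) :
  measurable_fun setT (fun t : n.-tuple R => \sum_i tnth t i * v i).
Proof.
apply: measurable_sum => i; apply: measurable_funM => //.
exact: measurable_tnth.
Qed.

Lemma measurable_cosT : measurable_fun setT (@cos R).
Proof. by apply: continuous_measurable_fun; exact: continuous_cos. Qed.

Lemma rintegrable_window_cos_tuple n e (v : 'I_n -> R) b : 0 < e ->
  rintegrable (lebesgue_tuple R n)
    (fun t => (\prod_i expR (- (e * `|tnth t i|))) * cos (\sum_i tnth t i * v i + b)).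
Proof.
move=> e0.
have h := rintegrable_prod_tuple (fun i x => expR_ge0 (- (e * `|x|)))
  (fun i : 'I_n => rintegrable_window e0).
apply: (le_rintegrable _ _ h).
  apply: measurable_funM; first exact: rintegrable_measurable h.
  apply: (measurableT_comp measurable_cosT).
  by apply: measurable_funD; [exact: (measurable_sum_tuple v)|exact: measurable_cst].
move=> t; have p0 : 0 <= \prod_i expR (- (e * `|tnth t i|)).
  by apply: prodr_ge0 => i _; exact: expR_ge0.
by rewrite normrM ger0_norm// ler_piMr// normr_cos_le1.
Qed.

(** The shift [b] carries the induction: when the first coordinate is integrated out, the angle of
    the others is part of its shift, and a cosine of the same shape remains. *)
Lemma Rintegral_window_cos_tuple n e (v : 'I_n -> R) b : 0 < e ->
  \int[lebesgue_tuple R n]_t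
    ((\prod_i expR (- (e * `|tnth t i|))) * cos (\sum_i tnth t i * v i + b)) =
  (\prod_i (2 * e / (e ^+ 2 + v i ^+ 2))) * cos b.
Proof.
move=> e0; elim: n v b => [|n IH] v b.
  under eq_Rintegral do rewrite !big_ord0.
  rewrite big_ord0 !mul1r add0r Rintegral_cst//.
  rewrite -[RHS]mulr1; congr (_ * _).
  have T1 : lebesgue_tuple R 0 setT = 1%E by exact: diracT.
  exact: (congr1 fine T1).
have h := rintegrable_window_cos_tuple v b e0.
rewrite Rintegral_tcons// -Rintegral_fubini2//; last first.
  by have := h; rewrite (rintegrable_tcons (rintegrable_measurable h)).
pose v' i := v (lift ord0 i).
transitivity (\int[lebesgue_tuple R n]_t
  (2 * e / (e ^+ 2 + v ord0 ^+ 2) * ((\prod_i expR (- (e * `|tnth t i|))) *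
    cos (\sum_i tnth t i * v' i + b)))).
  apply: eq_Rintegral => t _.
  under eq_Rintegral => a _.
    rewrite big_ord_recl tnth_tcons0 big_ord_recl tnth_tcons0 [a * _]mulrC -addrA.
    under eq_bigr do rewrite tnthS.
    under [X in cos (_ + (X + _))]eq_bigr do rewrite tnthS.
    rewrite [_ * \prod_(i < n) _]mulrC -mulrA.
    over.
  rewrite /= RintegralZl//; last exact: rintegrable_window_cos.
  by rewrite Rintegral_window_cos// mulrCA.
rewrite RintegralZl//; last exact: rintegrable_window_cos_tuple.
by rewrite IH big_ord_recl mulrA.
Qed.

End product_functions.

(** * Boxes, windows and Poisson kernels on R^n *)

Section row_products.
Variables (R : realType) (n : nat).
Local Notation leb := (@lebesgue_measure R).
Local Notation E := (borel 'rV[R]_n).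
Local Notation mu := (@lambda_rV R n).

Lemma measurable_prod_row (f : 'I_n -> R -> R) :
  (forall i, measurable_fun setT (f i)) ->
  measurable_fun setT (fun x : E => \prod_i f i (x ord0 i)).
Proof.
move=> mf; apply: measurable_prod => i _.
by apply: measurableT_comp => //; exact: measurable_coord.
Qed.

Lemma ge0_integral_prod_row (f : 'I_n -> R -> R) :
  (forall i, measurable_fun setT (f i)) -> (forall i x, 0 <= f i x) ->
  (\int[mu]_x (\prod_i f i (x ord0 i))%:E = \prod_i \int[leb]_a (f i a)%:E)%E.
Proof.
move=> mf f0; rewrite ge0_integral_rV.
- rewrite -ge0_integral_prod_tuple//; apply: eq_integral => t _.
  by under eq_bigr do rewrite mxE.
- by apply/measurable_EFinP; exact: (measurable_prod_row (f := f)).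
- by move=> x; rewrite lee_fin prodr_ge0.
Qed.

Lemma rintegrable_prod_row (f : 'I_n -> R -> R) :
  (forall i x, 0 <= f i x) -> (forall i, rintegrable leb (f i)) ->
  rintegrable mu (fun x => \prod_i f i (x ord0 i)).
Proof.
move=> f0 fi; rewrite rintegrable_rV; last first.
  apply: (measurable_prod_row (f := f)) => i; exact: rintegrable_measurable (fi i).
rewrite (_ : _ \o _ = fun t => \prod_i f i (tnth t i)); first exact: rintegrable_prod_tuple.
by apply/funext => t /=; under eq_bigr do rewrite mxE.
Qed.

Lemma lambda_rV_box (A : 'I_n -> set R) : (forall i, measurable (A i)) ->
  (mu [set x : E | forall i, A i (x ord0 i)] = \prod_i leb (A i))%E.
Proof.
move=> mA.
have eB : [set x : E | forall i, A i (x ord0 i)] =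
    \bigcap_(i in [set: 'I_n]) (fun x : E => x ord0 i) @^-1` A i.
  by apply/seteqP; split => x /=; [move=> h i _; exact: h|move=> h i; exact: h].
have mB : measurable [set x : E | forall i, A i (x ord0 i)].
  rewrite eB; apply: fin_bigcap_measurable => // i _; rewrite -[X in measurable X]setTI.
  exact: measurable_coord.
rewrite -[X in mu X]setIT -integral_indic//.
transitivity (\int[mu]_x (\prod_i (\1_(A i) (x ord0 i) : R))%:E)%E.
  apply: eq_integral => x _; rewrite indicE; congr EFin.
  case: (boolP (x \in _)) => [/set_mem h|/negP h].
    by rewrite big1// => i _; rewrite indicE mem_set//; exact: h.
  have /existsNP[i Ai] : ~ forall i, A i (x ord0 i).
    by move=> h'; apply: h; rewrite inE.
  by rewrite (bigD1 i)//= indicE memNset// mul0r.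
rewrite (ge0_integral_prod_row (f := fun i => \1_(A i)))//.
apply: eq_bigr => i _; rewrite integral_indic//; last exact: mA.
exact: (congr1 leb (setIT (A i))).
Qed.

(** A box with one side reduced to a point and the others infinite; its measure vanishes because 0
    times infinity is 0 in the extended reals. *)
Lemma lambda_rV_hyperplane (i : 'I_n) (c : R) : mu [set x : E | x ord0 i = c] = 0%E.
Proof.
have -> : [set x : E | x ord0 i = c] =
    [set x | forall j, (if j == i then [set c] else setT) (x ord0 j)].
  apply/seteqP; split => x /= => [xc j|/(_ i)]; last by rewrite eqxx.
  by case: eqP => [->|].
rewrite (lambda_rV_box (A := fun j => if j == i then [set c] else setT)); last first.
  by move=> j; case: ifP.
by rewrite (bigD1 i)//= eqxx lebesgue_measure_set1 mul0e.
Qed.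

Definition window e (x : 'rV[R]_n) : R := \prod_i expR (- (e * `|x ord0 i|)).

Definition poisson e (x : 'rV[R]_n) : R := \prod_i pker e (x ord0 i).

Lemma window_ge0 e x : 0 <= window e x.
Proof. by apply: prodr_ge0 => i _; exact: expR_ge0. Qed.

Lemma rintegrable_window_row e : 0 < e -> rintegrable mu (window e).
Proof.
move=> e0; apply: (rintegrable_prod_row (f := fun _ t => expR (- (e * `|t|)))).
  by move=> ? ?; exact: expR_ge0.
by move=> _; exact: rintegrable_window.
Qed.

Lemma poisson_ge0 e x : 0 < e -> 0 <= poisson e x.
Proof. by move=> e0; apply: prodr_ge0 => i _; exact: pker_ge0. Qed.

Lemma poissonN e x : poisson e (- x) = poisson e x.
Proof. by apply: eq_bigr => i _; rewrite mxE pker_even. Qed.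

Lemma poissonB e x y :
  poisson e (y - x) = \prod_i pker e (y ord0 i - x ord0 i).
Proof. by apply: eq_bigr => i _; rewrite !mxE. Qed.

Lemma measurable_dot (u : 'rV[R]_n) : measurable_fun setT (fun x : E => dot x u).
Proof.
apply: measurable_sum => i; apply: measurable_funM => //.
exact: measurable_coord.
Qed.

Lemma measurable_phase (u : 'rV[R]_n) b :
  measurable_fun setT (fun x : E => cos (2 * pi * dot x u + b)).
Proof.
apply: (measurableT_comp (@measurable_cosT R)); apply: measurable_funD => //.
by apply: measurable_funM => //; exact: measurable_dot.
Qed.

Lemma Rintegral_window_cos_row e (u : 'rV[R]_n) b : 0 < e ->
  \int[mu]_x (window e x * cos (2 * pi * dot x u + b)) = poisson e u * cos b.
Proof.
move=> e0; pose v i := 2 * pi * u ord0 i.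
have E1 t : window e (@row_of_tuple R n t) * cos (2 * pi * dot (@row_of_tuple R n t) u + b) =
   (\prod_i expR (- (e * `|tnth t i|))) * cos (\sum_i tnth t i * v i + b).
  congr (_ * cos (_ + _)); first by apply: eq_bigr => i _; rewrite mxE.
  by rewrite /dot mulr_sumr; apply: eq_bigr => i _; rewrite mxE mulrCA.
rewrite Rintegral_rV.
- under eq_Rintegral do rewrite E1.
  by rewrite Rintegral_window_cos_tuple.
- apply: measurable_funM; last exact: measurable_phase.
  exact: rintegrable_measurable (rintegrable_window_row e0).
- rewrite (_ : _ \o _ = fun t => (\prod_i expR (- (e * `|tnth t i|))) *
    cos (\sum_i tnth t i * v i + b)); last exact/funext.
  exact: rintegrable_window_cos_tuple.
Qed.

Lemma measurable_poisson e x : 0 < e ->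
  measurable_fun setT (fun y : E => poisson e (y - x)).
Proof.
move=> e0; under eq_fun do rewrite poissonB.
apply: (measurable_prod_row (f := fun i t => pker e (t - x ord0 i))) => i.
by apply: continuous_measurable_fun; exact: continuous_pker.
Qed.

Lemma integral_poisson e x : 0 < e -> (\int[mu]_y (poisson e (y - x))%:E = 1)%E.
Proof.
move=> e0; under eq_integral do rewrite poissonB.
rewrite (ge0_integral_prod_row (f := fun i t => pker e (t - x ord0 i))).
- by rewrite big1// => i _; rewrite integral_pker.
- by move=> i; apply: continuous_measurable_fun; exact: continuous_pker.
- by move=> i t; exact: pker_ge0.
Qed.

Lemma rintegrable_poisson e x : 0 < e -> rintegrable mu (fun y => poisson e (y - x)).
Proof.
move=> e0; apply/integrableP; split.
  by apply/measurable_EFinP; exact: measurable_poisson.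
under eq_integral do rewrite gee0_abs ?lee_fin ?poisson_ge0//.
by rewrite integral_poisson// ltry.
Qed.

(** The mass of [pker e] at distance at least [d] from its centre, twice the one-sided tail. *)
Definition tail e d : R := 1 - 2 / pi * atan (2 * pi * d / e).

Lemma integral_pker_far e d (a : R) : 0 < e -> 0 < d ->
  (\int[leb]_t (pker e (t - a) * \1_[set t | (d <= `|t - a|)%R] t)%:E = (tail e d)%:E)%E.
Proof.
move=> e0 d0.
have -> : [set t | d <= `|t - a|] = `]-oo, (a - d)] `|` `[(a + d), +oo[.
  apply/seteqP; split => t /=; rewrite !in_itv/= andbT ler_normr.
    by move=> /orP[h|h]; [right|left]; lra.
  by move=> [h|h]; apply/orP; [right|left]; lra.
transitivity (\int[leb]_(t in `]-oo, (a - d)%R] `|` `[(a + d)%R, +oo[) (pker e (t - a))%:E)%E.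
  rewrite [RHS]integral_mkcond; apply: eq_integral => t _.
  by rewrite patchE indicE; case: ifPn; rewrite ?mulr1 ?mulr0.
rewrite ge0_integral_setU//=.
- rewrite integral_pker_tail// integral_pker_tailN// -EFinD; congr EFin.
  by rewrite /tail; move: (atan _) (pi^-1) => X p; field.
- by apply/measurable_EFinP; apply: measurable_funTS;
    apply: continuous_measurable_fun; exact: continuous_pker.
- by move=> t _; rewrite lee_fin pker_ge0.
- rewrite disj_set2E; apply/eqP; rewrite -subset0 => t [] /=; rewrite !in_itv/= andbT.
  by move=> h1 h2; have := le_trans h2 h1; lra.
Qed.

(** Only coordinate [i] is constrained, so the other factors have integral 1 and the one-dimensional
    tail is left. *)
Lemma integral_poisson_far e d x (i : 'I_n) : 0 < e -> 0 < d ->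
  (\int[mu]_y (poisson e (y - x) * \1_[set y : E | (d <= `|y ord0 i - x ord0 i|)%R] y)%:E =
   (tail e d)%:E)%E.
Proof.
move=> e0 d0.
pose g j t := pker e (t - x ord0 j) *
  (if j == i then \1_[set t | d <= `|t - x ord0 i|] t else 1).
have mset : measurable ([set t | d <= `|t - x ord0 i|] : set R).
  rewrite (_ : [set t | _] = (fun t : R => `|t - x ord0 i|) @^-1` `[d, +oo[).
    rewrite -[X in measurable X]setTI; apply: measurableT_comp => //.
    exact: measurable_funB.
  by apply/seteqP; split => t /=; rewrite in_itv/= andbT.
have mg j : measurable_fun setT (g j).
  apply: measurable_funM.
    by apply: continuous_measurable_fun; exact: continuous_pker.
  by case: eqP => // _; exact: measurable_indic.
have g0 j t : 0 <= g j t.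
  by rewrite mulr_ge0 ?pker_ge0//; case: ifP => // _; rewrite indicE.
transitivity (\int[mu]_y (\prod_j g j (y ord0 j))%:E)%E.
  apply: eq_integral => y _; rewrite big_split/= poissonB; congr (_ * _)%:E.
  by rewrite (bigD1 i)//= eqxx big1 ?mulr1// => j /negbTE ->.
rewrite ge0_integral_prod_row// (bigD1 i)//= big1 ?mule1.
  rewrite /g eqxx; exact: integral_pker_far.
move=> j /negbTE ji; rewrite /g ji; under eq_integral do rewrite mulr1.
exact: integral_pker.
Qed.

Lemma cvg_tail d : 0 < d -> tail k.+1%:R^-1 d @[k --> \oo] --> (0 : R).
Proof.
move=> d0; rewrite /tail.
have p0 : (pi : R) != 0 by rewrite gt_eqF// pi_gt0.
rewrite (_ : 0 = 1 - 2 / pi * (pi / 2)); last by rewrite mulrA mulfVK// mulfV ?subrr.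
apply: cvgB; first exact: cvg_cst.
apply: cvgM; first exact: cvg_cst.
apply: (cvg_comp _ _ _ (@cvgy_atan R)).
have c0 : 0 < 2 * pi * d by rewrite !mulr_gt0// pi_gt0.
apply/cvgryPge => A; near=> k; rewrite invrK mulrC -ler_pdivrMr//.
by rewrite (@le_trans _ _ k%:R) ?ler_nat//; near: k; exact: nbhs_infty_ger.
Unshelve. all: by end_near. Qed.

(** The integrable majorant for rapidly decreasing functions, taken as a product so that its
    integral factors. *)
Definition decay (x : 'rV[R]_n) : R := \prod_i (1 + x ord0 i ^+ 2)^-1.

Lemma decay_gt0 x : 0 < decay x.
Proof. by apply: prodr_gt0 => i _; rewrite invr_gt0 ltr_pwDl ?sqr_ge0. Qed.

Lemma rintegrable_decay : rintegrable mu decay.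
Proof.
apply: (rintegrable_prod_row (f := fun _ t => (1 + t ^+ 2)^-1)).
  by move=> _ t; rewrite invr_ge0 addr_ge0 ?sqr_ge0.
by move=> _; exact: rintegrable_cauchy.
Qed.

End row_products.

(** * Complex integrals *)

Section complex_integrals.
Context d (T : measurableType d) (R : realType).
Variable mu : {measure set T -> \bar R}.
Implicit Types f g : T -> R[i].

Lemma normc_ge0 (z : R[i]) : 0 <= normc z.
Proof. by case: z => a b; exact: sqrtr_ge0. Qed.

Lemma normc_sqrtE (z : R[i]) : normc z = Num.sqrt (Re z ^+ 2 + Im z ^+ 2).
Proof. by case: z. Qed.

Lemma normc_sqrE (z : R[i]) : normc z ^+ 2 = Re z ^+ 2 + Im z ^+ 2.
Proof. by rewrite normc_sqrtE sqr_sqrtr// addr_ge0 ?sqr_ge0. Qed.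

Lemma Re_le_normc (z : R[i]) : `|Re z| <= normc z.
Proof. by rewrite normc_sqrtE -sqrtr_sqr ler_wsqrtr// lerDl sqr_ge0. Qed.

Lemma Im_le_normc (z : R[i]) : `|Im z| <= normc z.
Proof. by rewrite normc_sqrtE -sqrtr_sqr ler_wsqrtr// lerDr sqr_ge0. Qed.

Lemma normc_le_ReIm (z : R[i]) : normc z <= `|Re z| + `|Im z|.
Proof.
rewrite -(@ler_pXn2r _ 2)// ?nnegrE ?normc_ge0 ?addr_ge0//.
by rewrite normc_sqrE sqrrD !real_normK ?num_real// addrAC lerDl mulrn_wge0// mulr_ge0.
Qed.

Lemma normc_real (a : R) : normc a%:C = `|a|.
Proof. by rewrite /normc/= expr0n/= addr0 sqrtr_sqr. Qed.

Lemma normc_cis (t : R) : normc (cis t) = 1.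
Proof. by rewrite /normc/= cos2Dsin2 sqrtr1. Qed.

Lemma ReM (z w : R[i]) : Re (z * w) = Re z * Re w - Im z * Im w.
Proof. by case: z w => [? ?] [? ?]. Qed.

Lemma ImM (z w : R[i]) : Im (z * w) = Re z * Im w + Im z * Re w.
Proof. by case: z w => [? ?] [? ?]. Qed.

Lemma ReD (z w : R[i]) : Re (z + w) = Re z + Re w.
Proof. by case: z w => [? ?] [? ?]. Qed.

Lemma ImD (z w : R[i]) : Im (z + w) = Im z + Im w.
Proof. by case: z w => [? ?] [? ?]. Qed.

Lemma ReN (z : R[i]) : Re (- z) = - Re z. Proof. by case: z. Qed.
Lemma ImN (z : R[i]) : Im (- z) = - Im z. Proof. by case: z. Qed.

Lemma cmeasurableM f g : cmeasurable f -> cmeasurable g ->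
  cmeasurable (fun x => f x * g x).
Proof.
move=> [f1 f2] [g1 g2]; split.
  under eq_fun do rewrite ReM.
  by apply: measurable_funB; apply: measurable_funM.
under eq_fun do rewrite ImM.
by apply: measurable_funD; apply: measurable_funM.
Qed.

Lemma cmeasurableB f g : cmeasurable f -> cmeasurable g ->
  cmeasurable (fun x => f x - g x).
Proof.
move=> [f1 f2] [g1 g2]; split.
  by under eq_fun do rewrite ReD ReN; apply: measurable_funB.
by under eq_fun do rewrite ImD ImN; apply: measurable_funB.
Qed.

Lemma cmeasurable_cst (c : R[i]) : cmeasurable (fun _ : T => c).
Proof. by split; exact: measurable_cst. Qed.

Lemma cmeasurable_real (u : T -> R) : measurable_fun setT u ->
  cmeasurable (fun x => (u x)%:C).
Proof. by move=> mu_; split=> //=; exact: measurable_cst. Qed.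

Lemma measurable_normc f : cmeasurable f -> measurable_fun setT (fun x => normc (f x)).
Proof.
move=> [f1 f2]; under eq_fun do rewrite normc_sqrtE.
apply: (@measurableT_comp _ _ _ _ _ _ (@Num.sqrt R)) => //.
  by apply: continuous_measurable_fun; exact: sqrt_continuous.
by apply: measurable_funD; apply: measurable_funX.
Qed.

Definition cintegrable f :=
  rintegrable mu (fun x => Re (f x)) /\ rintegrable mu (fun x => Im (f x)).

Lemma cintegrable_measurable f : cintegrable f -> cmeasurable f.
Proof.
move=> [f1 f2]; split; first exact: (rintegrable_measurable f1).
exact: (rintegrable_measurable f2).
Qed.

Lemma le_cintegrable f (g : T -> R) : cmeasurable f ->
  (forall x, normc (f x) <= g x) -> rintegrable mu g -> cintegrable f.
Proof.
move=> [f1 f2] fg gi; split; apply: (le_rintegrable _ _ gi) => // x.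
- exact: le_trans (Re_le_normc _) (fg x).
- exact: le_trans (Im_le_normc _) (fg x).
Qed.

Lemma cintegrable_normc f : cintegrable f -> rintegrable mu (fun x => normc (f x)).
Proof.
move=> fi; have [f1 f2] := fi.
apply: (le_rintegrable _ _ (rintegrableD (rintegrable_norm f1) (rintegrable_norm f2))).
  by apply: measurable_normc; exact: cintegrable_measurable.
by move=> x; rewrite ger0_norm ?normc_ge0// normc_le_ReIm.
Qed.

Lemma cintegralZ (c : R[i]) f : cintegrable f ->
  cintegral mu (fun x => c * f x) = c * cintegral mu f.
Proof.
move=> [f1 f2]; rewrite /cintegral.
have e1 : \int[mu]_x Re (c * f x) =
    Re c * (\int[mu]_x Re (f x)) - Im c * (\int[mu]_x Im (f x)).
  under eq_Rintegral do rewrite ReM.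
  by rewrite RintegralB//; [rewrite !RintegralZl|exact: rintegrableZ..].
have e2 : \int[mu]_x Im (c * f x) =
    Re c * (\int[mu]_x Im (f x)) + Im c * (\int[mu]_x Re (f x)).
  under eq_Rintegral do rewrite ImM.
  by rewrite RintegralD//; [rewrite !RintegralZl|exact: rintegrableZ..].
by rewrite e1 e2; case: c {e1 e2}.
Qed.

Lemma cintegralD f g : cintegrable f -> cintegrable g ->
  cintegral mu (fun x => f x + g x) = cintegral mu f + cintegral mu g.
Proof.
move=> [f1 f2] [g1 g2]; rewrite /cintegral.
under eq_Rintegral do rewrite ReD.
under [X in _ +i* X]eq_Rintegral do rewrite ImD.
by rewrite !RintegralD.
Qed.

Lemma cintegralB f g : cintegrable f -> cintegrable g ->
  cintegral mu (fun x => f x - g x) = cintegral mu f - cintegral mu g.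
Proof.
move=> [f1 f2] [g1 g2]; rewrite /cintegral.
under eq_Rintegral do rewrite ReD ReN.
under [X in _ +i* X]eq_Rintegral do rewrite ImD ImN.
by rewrite !RintegralB.
Qed.

Lemma eq_cintegral f g : (forall x, f x = g x) -> cintegral mu f = cintegral mu g.
Proof. by move=> fg; congr cintegral; apply/funext. Qed.

(** The factor 2 comes from bounding the real and imaginary parts separately. *)
Lemma normc_cintegral_le f (g : T -> R) : cmeasurable f ->
  (forall x, normc (f x) <= g x) -> rintegrable mu g ->
  normc (cintegral mu f) <= 2 * \int[mu]_x g x.
Proof.
move=> [f1 f2] fg gi; apply: le_trans (normc_le_ReIm _) _.
rewrite mulr_natl mulr2n lerD//=; apply: le_norm_Rintegral => // x.
- exact: le_trans (Re_le_normc _) (fg x).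
- exact: le_trans (Im_le_normc _) (fg x).
Qed.

Lemma cintegral_cvg (f_ : nat -> T -> R[i]) f (g : T -> R) :
  (forall k, cmeasurable (f_ k)) -> cmeasurable f ->
  {ae mu, forall x, normc (f_ k x - f x) @[k --> \oo] --> 0} ->
  rintegrable mu g -> (forall k x, normc (f_ k x) <= g x) ->
  normc (cintegral mu (f_ k) - cintegral mu f) @[k --> \oo] --> 0.
Proof.
move=> mf_ mf ff gi fg.
have cvg1 (P : R[i] -> R) : (forall z, `|P z| <= normc z) ->
    (forall z w, P (z - w) = P z - P w) ->
    (forall h : T -> R[i], cmeasurable h -> measurable_fun setT (fun x => P (h x))) ->
    `|\int[mu]_x P (f_ k x) - \int[mu]_x P (f x)| @[k --> \oo] --> 0.
  move=> Pn PB mP.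
  have : \int[mu]_x P (f_ k x) @[k --> \oo] --> \int[mu]_x P (f x).
    have Pf : {ae mu, forall x, P (f_ k x) @[k --> \oo] --> P (f x)}.
      apply: filterS ff => x fx; apply/subr_cvg0/norm_cvg0P.
      apply: (squeeze_cvgr _ (cvg_cst 0) fx).
      by apply: nearW => k; rewrite normr_ge0 -PB Pn.
    have Pg k x : `|P (f_ k x)| <= g x by exact: le_trans (Pn _) (fg k x).
    have mPf k := mP _ (mf_ k).

    exact: (Rintegral_cvg mPf (mP _ mf) Pf gi Pg).
  by move=> /subr_cvg0 ?; exact/norm_cvg0P.
have cR := cvg1 _ Re_le_normc (fun z w => etrans (ReD _ _) (congr1 _ (ReN _)))
  (fun h mh => mh.1).
have cI := cvg1 _ Im_le_normc (fun z w => etrans (ImD _ _) (congr1 _ (ImN _)))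
  (fun h mh => mh.2).
have h : `|\int[mu]_x Re (f_ k x) - \int[mu]_x Re (f x)| +
    `|\int[mu]_x Im (f_ k x) - \int[mu]_x Im (f x)| @[k --> \oo] --> (0 : R).
  by rewrite -[X in _ --> X]addr0; exact: cvgD.
apply: (squeeze_cvgr _ (cvg_cst 0) h).
apply: nearW => k; apply/andP; split; first exact: normc_ge0.
by rewrite (le_trans (normc_le_ReIm _))// ReD ReN ImD ImN.
Qed.

End complex_integrals.

(** * Fubini for complex integrals *)

Section complex_fubini.
Context d1 d2 (T1 : measurableType d1) (T2 : measurableType d2) (R : realType).
Variables (m1 : {sigma_finite_measure set T1 -> \bar R}).
Variables (m2 : {sigma_finite_measure set T2 -> \bar R}).
Implicit Types (f : T1 -> R[i]) (g : T2 -> R[i]) (F : T1 * T2 -> R[i]).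

Lemma cintegral_fubini F : cintegrable (m1 \x m2)%E F ->
  cintegral m1 (fun x => cintegral m2 (fun y => F (x, y))) =
  cintegral m2 (fun y => cintegral m1 (fun x => F (x, y))).
Proof.
move=> [F1 F2]; congr (_ +i* _) => /=.
  rewrite (Rintegral_fubini1 (f := fun z => Re (F z)))//.
  by rewrite (Rintegral_fubini2 (f := fun z => Re (F z))).
rewrite (Rintegral_fubini1 (f := fun z => Im (F z)))//.
by rewrite (Rintegral_fubini2 (f := fun z => Im (F z))).
Qed.

Lemma cintegrable_fubini1 F : cintegrable (m1 \x m2)%E F ->
  cintegrable m1 (fun x => cintegral m2 (fun y => F (x, y))).
Proof.
move=> [F1 F2]; split=> /=.
  exact: (rintegrable_fubini1 (f := fun z => Re (F z))).
exact: (rintegrable_fubini1 (f := fun z => Im (F z))).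
Qed.

Lemma cintegrable_fubini2 F : cintegrable (m1 \x m2)%E F ->
  cintegrable m2 (fun y => cintegral m1 (fun x => F (x, y))).
Proof.
move=> [F1 F2]; split=> /=.
  exact: (rintegrable_fubini2 (f := fun z => Re (F z))).
exact: (rintegrable_fubini2 (f := fun z => Im (F z))).
Qed.

Lemma cmeasurable_comp d3 (T3 : measurableType d3) (phi : T3 -> T1) f :
  measurable_fun setT phi -> cmeasurable f -> cmeasurable (fun x => f (phi x)).
Proof.
by move=> mphi [f1 f2]; split;
  [exact: (measurableT_comp f1)|exact: (measurableT_comp f2)].
Qed.

Lemma cintegrable_kernel f g (K : T1 * T2 -> R[i]) :
  cintegrable m1 f -> cintegrable m2 g -> cmeasurable K ->
  (forall z, normc (K z) = 1) ->
  cintegrable (m1 \x m2)%E (fun z => f z.1 * g z.2 * K z).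
Proof.
move=> fi gi mK K1; have nf := cintegrable_normc fi; have ng := cintegrable_normc gi.
have mf := cintegrable_measurable fi; have mg := cintegrable_measurable gi.
apply: (le_cintegrable _ _ (rintegrable_prod nf ng)) => [|z].
  apply: cmeasurableM => //; apply: cmeasurableM.
    exact: (cmeasurable_comp measurable_fst mf).
  have [g1 g2] := mg; split.
    exact: (measurableT_comp g1 measurable_snd).
  exact: (measurableT_comp g2 measurable_snd).
by rewrite !normcM K1 mulr1.
Qed.

End complex_fubini.

Section sums.
Context d (T : measurableType d) (R : realType).
Variable mu : {measure set T -> \bar R}.

Lemma rintegrable_cst0 : rintegrable mu (fun _ => 0).
Proof. exact: integrable0. Qed.

Lemma rintegrable_sum (I : Type) (r : seq I) (f : I -> T -> R) :
  (forall i, rintegrable mu (f i)) -> rintegrable mu (fun x => \sum_(i <- r) f i x).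
Proof.
move=> fi; elim: r => [|i r IH].
  by under eq_fun do rewrite big_nil; exact: rintegrable_cst0.
by under eq_fun do rewrite big_cons; exact: rintegrableD.
Qed.

Lemma Rintegral_sum (I : Type) (r : seq I) (f : I -> T -> R) :
  (forall i, rintegrable mu (f i)) ->
  \int[mu]_x (\sum_(i <- r) f i x) = \sum_(i <- r) \int[mu]_x f i x.
Proof.
move=> fi; elim: r => [|i r IH].
  under eq_Rintegral do rewrite big_nil.
  by rewrite big_nil Rintegral_cst// mul0r.
under eq_Rintegral do rewrite big_cons.
have si := rintegrable_sum r fi; have fii := fi i.
by rewrite RintegralD// big_cons IH.
Qed.

End sums.

(** * The Poisson kernel as an approximate identity *)

Section approximate_identity.
Variables (R : realType) (n : nat).
Local Notation E := (borel 'rV[R]_n).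
Local Notation mu := (@lambda_rV R n).

(** Continuity stated coordinatewise: a point outside the neighbourhood is then far in some single
    coordinate, which is what the tails measure. *)
Definition continuous_at_row (f : 'rV[R]_n -> R) (x : 'rV[R]_n) : Prop :=
  forall e : R, 0 < e -> exists2 d : R, 0 < d &
    forall y : 'rV[R]_n, (forall i, `|y ord0 i - x ord0 i| < d) -> `|f y - f x| <= e.

Lemma continuous_continuous_at_row (f : 'rV[R]_n -> R) x :
  {for x, continuous f} -> continuous_at_row f x.
Proof.
move=> /cvgrPdist_le cf e e0.
have /nbhs_ballP[d /= d0 dP] := cf e e0; exists d => // y yx.
rewrite distrC; apply: dP; split => // i j.
by rewrite (ord1 i) /ball/= distrC.
Qed.

Lemma poisson_far_integrable e d x (i : 'I_n) : 0 < e ->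
  rintegrable mu (fun y => poisson e (y - x) *
    \1_[set y : E | (d <= `|y ord0 i - x ord0 i|)%R] y).
Proof.
move=> e0; apply: (le_rintegrable _ _ (rintegrable_poisson x e0)).
  apply: measurable_funM; first exact: measurable_poisson.
  apply: measurable_indic.
  rewrite (_ : [set y : E | _] = (fun y : E => `|y ord0 i - x ord0 i|) @^-1` `[d, +oo[).
    rewrite -[X in measurable X]setTI; apply: measurableT_comp => //.
    by apply: measurable_funB => //; exact: measurable_coord.
  by apply/seteqP; split => t /=; rewrite in_itv/= andbT.
move=> y; rewrite normrM ger0_norm ?poisson_ge0// ler_piMr ?poisson_ge0//.
by rewrite indicE; case: (_ \in _); rewrite ?normr1 ?normr0.
Qed.

(* The Poisson kernel is a product of Cauchy kernels, so its mass escapes a box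
   around [x] only through the tails of the coordinates. *)
Lemma poisson_cvg (f : E -> R) (M : R) x : measurable_fun setT f ->
  (forall y, `|f y| <= M) -> continuous_at_row f x ->
  \int[mu]_y (f y * poisson k.+1%:R^-1 (y - x)) @[k --> \oo] --> f x.
Proof.
move=> mf fM cf; apply/cvgrPdist_le => eps eps0.
have M0 : 0 <= M := le_trans (normr_ge0 _) (fM 0).
have h0 : 0 < eps / 2 by rewrite divr_gt0.
have [d d0 dP] := cf _ h0.
(* The n tails enter with total weight 2 M n and must cost at most eps / 2; the [+ 1] keeps the
   denominator positive. *)
have c0 : 0 < eps / 2 / (2 * M * n%:R + 1).
  by rewrite divr_gt0// ltr_wpDl// !mulr_ge0.
near=> k.
have tl : tail k.+1%:R^-1 d <= eps / 2 / (2 * M * n%:R + 1).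
  by apply: le_trans (ler_norm _) _; near: k; move/cvgr0Pnorm_le : (cvg_tail d0); exact.
have e0 : 0 < k.+1%:R^-1 :> R by rewrite invr_gt0.
set e := k.+1%:R^-1 in tl e0 *.
have Pi := rintegrable_poisson x e0.
have far_i i := poisson_far_integrable d x i e0.
pose far i (y : E) := poisson e (y - x) * \1_[set y : E | d <= `|y ord0 i - x ord0 i|] y.
have fPi : rintegrable mu (fun y => f y * poisson e (y - x)).
  apply: (le_rintegrable _ _ (rintegrableZ M Pi)).
    by apply: measurable_funM => //; exact: measurable_poisson.
  by move=> y; rewrite normrM [`|poisson _ _|]ger0_norm ?poisson_ge0// ler_wpM2r ?poisson_ge0.
have IP : \int[mu]_y poisson e (y - x) = 1 by rewrite /Rintegral integral_poisson.
have -> : f x - \int[mu]_y (f y * poisson e (y - x)) =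
    \int[mu]_y (f x * poisson e (y - x) - f y * poisson e (y - x)).
  by rewrite RintegralB//; [rewrite RintegralZl// IP mulr1|exact: rintegrableZ].
(* A majorant of the integrand: near [x] the values of [f] differ by at most eps / 2, and elsewhere
   some coordinate is far and the difference is at most 2 M. *)
pose G (y : E) := eps / 2 * poisson e (y - x) + 2 * M * \sum_(i <- index_enum 'I_n) far i y.
have Gi : rintegrable mu G.
  by apply: rintegrableD; apply: rintegrableZ => //; exact: rintegrable_sum.
have mP := measurable_poisson x e0.
have IG : \int[mu]_y G y <= eps.
  have Ifar i : \int[mu]_y far i y = tail e d.
    by rewrite /Rintegral integral_poisson_far.
  have si := rintegrable_sum (index_enum 'I_n) far_i.
  have i1 := rintegrableZ (eps / 2) Pi.
  have i2 := rintegrableZ (2 * M) si.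
  rewrite /G RintegralD// !RintegralZl// IP mulr1 Rintegral_sum//.
  under eq_bigr do rewrite Ifar.
  rewrite big_const_ord iter_addr_0 -[tail e d *+ n]mulr_natr.
  have h1 : 2 * M * n%:R * tail e d <= 2 * M * n%:R * (eps / 2 / (2 * M * n%:R + 1)).
    by rewrite ler_wpM2l// !mulr_ge0.
  have h2 : (2 * M * n%:R + 1) * (eps / 2 / (2 * M * n%:R + 1)) = eps / 2.
    by rewrite mulrC divfK// gt_eqF// ltr_wpDl// !mulr_ge0.
  lra.
apply: le_trans IG; apply: (le_norm_Rintegral _ _ Gi).
  by apply: measurable_funB; apply: measurable_funM.
move=> y; rewrite -mulrBl normrM [`|poisson _ _|]ger0_norm ?poisson_ge0//.
have far0 i : 0 <= far i y by rewrite mulr_ge0 ?poisson_ge0// indicE.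
have s0 : 0 <= 2 * M * \sum_(i <- index_enum 'I_n) far i y.
  by rewrite !mulr_ge0// sumr_ge0.
have [near_|] := pselect (forall i, `|y ord0 i - x ord0 i| < d).
  have p1 : `|f x - f y| * poisson e (y - x) <= eps / 2 * poisson e (y - x).
    by rewrite ler_wpM2r ?poisson_ge0// distrC dP.
  by rewrite (le_trans p1)// lerDl.
move=> /existsNP [j] /negP; rewrite -leNgt => dj.
have p1 : `|f x - f y| * poisson e (y - x) <= 2 * M * far j y.
  rewrite /far indicE mem_set// mulr1 ler_wpM2r ?poisson_ge0//.
  by rewrite (le_trans (ler_normB _ _))// mulr_natl mulr2n lerD.
have p2 : 2 * M * far j y <= 2 * M * \sum_(i <- index_enum 'I_n) far i y.
  by rewrite ler_wpM2l ?mulr_ge0// (bigD1 j)//= lerDl sumr_ge0.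
by rewrite (le_trans p1)// (le_trans p2)// lerDr mulr_ge0 ?poisson_ge0 ?(ltW h0).
Unshelve. all: by end_near. Qed.

End approximate_identity.

(** * Fourier transform and inversion *)

Section fourier_transform.
Variables (R : realType) (n : nat).
Local Notation E := (borel 'rV[R]_n).
Local Notation mu := (@lambda_rV R n).
Implicit Types (f g h : E -> R[i]) (x y z xi : 'rV[R]_n).

Lemma dotC x y : dot x y = dot y x.
Proof. by apply: eq_bigr => i _; rewrite mulrC. Qed.

Lemma dotBr x y z : dot x (y - z) = dot x y - dot x z.
Proof.
by rewrite /dot -sumrB; apply: eq_bigr => i _; rewrite !mxE mulrBr.
Qed.

Lemma cisD (a b : R) : cis (a + b) = cis a * cis b.
Proof. by rewrite /cis cosD sinD; congr (_ +i* _); rewrite addrC mulrC [X in _ + X]mulrC. Qed.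

Lemma Re_cis (a : R) : Re (cis a) = cos a. Proof. by []. Qed.

(** With the sine written as a shifted cosine, one real integral serves both parts of a complex
    one. *)
Lemma Im_cis (a : R) : Im (cis a) = cos (a + - (pi / 2)).
Proof. by rewrite cosD cosN sinN cos_pihalf sin_pihalf mulr0 mulrN mulr1 add0r opprK. Qed.

Lemma cmeasurable_cis d (T : measurableType d) (u : T -> R) :
  measurable_fun setT u -> cmeasurable (fun t => cis (u t)).
Proof.
move=> mu_; split => /=.
  exact: (measurableT_comp (@measurable_cosT R)).
have ms : measurable_fun setT (@sin R).
  by apply: continuous_measurable_fun; exact: continuous_sin.
exact: (measurableT_comp ms).
Qed.

Lemma measurable_dot2 : measurable_fun setT (fun z : E * E => dot z.1 z.2).
Proof.
apply: measurable_sum => i; apply: measurable_funM.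
  exact: (measurableT_comp (@measurable_coord R n i) measurable_fst).
exact: (measurableT_comp (@measurable_coord R n i) measurable_snd).
Qed.

Definition phase (s : R) x xi : R[i] := cis (s * (2 * pi * dot x xi)).

Lemma phaseC s x xi : phase s x xi = phase s xi x.
Proof. by rewrite /phase dotC. Qed.

Lemma normc_phase s x xi : normc (phase s x xi) = 1.
Proof. exact: normc_cis. Qed.

Lemma cmeasurable_phase2 s : cmeasurable (fun z : E * E => phase s z.1 z.2).
Proof.
apply: cmeasurable_cis; apply: measurable_funM => //.
by apply: measurable_funM => //; exact: measurable_dot2.
Qed.

Lemma cmeasurable_phase s xi : cmeasurable (fun x : E => phase s x xi).
Proof.
apply: cmeasurable_cis; apply: measurable_funM => //.
by apply: measurable_funM => //; exact: measurable_dot.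
Qed.

Lemma cintegrable_phase f s xi : cintegrable mu f ->
  cintegrable mu (fun x => f x * phase s x xi).
Proof.
move=> fi; apply: (le_cintegrable _ _ (cintegrable_normc fi)).
  by apply: cmeasurableM; [exact: (cintegrable_measurable fi)|exact: cmeasurable_phase].
by move=> x; rewrite normcM normc_phase mulr1.
Qed.

(** [FT (-1)] is the transform [fourier] and [FT 1] the inverse transform. *)
Definition FT (s : R) f xi : R[i] := cintegral mu (fun x => f x * phase s x xi).

Lemma normc_FT_le f s xi : cintegrable mu f ->
  normc (FT s f xi) <= 2 * \int[mu]_x normc (f x).
Proof.
move=> fi; apply: (normc_cintegral_le _ _ (cintegrable_normc fi)).
  exact: (cintegrable_measurable (cintegrable_phase s xi fi)).
by move=> x; rewrite normcM normc_phase mulr1.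
Qed.

Lemma cintegrable_real (u : E -> R) : rintegrable mu u ->
  cintegrable mu (fun x => (u x)%:C).
Proof. by move=> ui; split => //=; exact: rintegrable_cst0. Qed.

Lemma window_gt0 e x : 0 < window e x.
Proof. by apply: prodr_gt0 => i _; exact: expR_gt0. Qed.

Lemma windowE e x : window e x = expR (- (e * \sum_i `|x ord0 i|)).
Proof. by rewrite mulr_sumr -sumrN expR_sum. Qed.

(** The integrand need not be integrable in both variables jointly. Multiplied by the window in [xi]
    it is, so Fubini makes the product measurable, and the positive window is divided out. *)
Lemma cmeasurable_FT f s : cintegrable mu f -> cmeasurable (FT s f : E -> _).
Proof.
move=> fi; have wi := cintegrable_real (rintegrable_window_row n (@ltr01 R)).
have Fi := cintegrable_fubini2 (cintegrable_kernel fi wi (cmeasurable_phase2 s)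
  (fun z : E * E => normc_phase s z.1 z.2)).
have mF := cintegrable_measurable Fi.
have mw : cmeasurable (fun x : E => ((window 1 x)^-1)%:C).
  apply: cmeasurable_real; under eq_fun do rewrite windowE -expRN opprK mul1r.
  apply: measurableT_comp => //; apply: measurable_sum => i.
  by apply: measurableT_comp => //; exact: measurable_coord.
have -> : FT s f = fun xi => ((window 1 xi)^-1)%:C *
    cintegral mu (fun x => f x * (window 1 xi)%:C * phase s x xi).
  apply/funext => xi; rewrite /FT.
  under [in RHS]eq_cintegral do rewrite mulrAC mulrC.
  rewrite cintegralZ; last exact: cintegrable_phase.
  by rewrite mulrA -rmorphM mulVf ?mul1r// gt_eqF// window_gt0.
exact: cmeasurableM.
Qed.

(** The multiplication formula, by Fubini and the symmetry of the phase. *)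
Lemma cintegral_mul_FT f g s : cintegrable mu f -> cintegrable mu g ->
  cintegral mu (fun x => f x * FT s g x) = cintegral mu (fun y => g y * FT s f y).
Proof.
move=> fi gi.
have Fi := cintegrable_kernel fi gi (cmeasurable_phase2 s)
  (fun z : E * E => normc_phase s z.1 z.2).
transitivity (cintegral mu (fun x => cintegral mu (fun y => f x * g y * phase s x y))).
  apply: eq_cintegral => x; rewrite -cintegralZ; last exact: cintegrable_phase.
  by apply: eq_cintegral => y; rewrite mulrA phaseC.
rewrite (cintegral_fubini Fi)/=.
apply: eq_cintegral => y; rewrite -cintegralZ; last exact: cintegrable_phase.
by apply: eq_cintegral => x; rewrite mulrA [g y * f x]mulrC.
Qed.

Lemma cintegral_window_phase e u : 0 < e ->
  cintegral mu (fun x => (window e x)%:C * phase 1 x u) = (poisson e u)%:C.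
Proof.
move=> e0; rewrite /cintegral; congr (_ +i* _).
  under eq_Rintegral do rewrite ReM mul0r subr0 /phase Re_cis mul1r -[_ * dot _ _]addr0.
  by rewrite Rintegral_window_cos_row// cos0 mulr1.
under eq_Rintegral do rewrite ImM mul0r addr0 /phase Im_cis mul1r.
by rewrite Rintegral_window_cos_row// cosN cos_pihalf mulr0.
Qed.

Lemma cintegrable_window_FT f s e : 0 < e -> cintegrable mu f ->
  cintegrable mu (fun x => (window e x)%:C * FT s f x).
Proof.
move=> e0 fi.
apply: (le_cintegrable _ _ (rintegrableZ (2 * \int[mu]_x normc (f x))
  (rintegrable_window_row n e0))).
  apply: cmeasurableM; last exact: cmeasurable_FT.
  exact: (cintegrable_measurable (cintegrable_real (rintegrable_window_row n e0))).
move=> x; rewrite normcM normc_real ger0_norm ?window_ge0// mulrC.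
by rewrite ler_wpM2r ?window_ge0// normc_FT_le.
Qed.

(** The two phases combine into that of z - y, so the frequency integral is the transform of the
    window, namely the Poisson kernel. *)
Lemma FT_window_FT f e y : 0 < e -> cintegrable mu f ->
  FT (-1) (fun x => (window e x)%:C * FT 1 f x) y =
  cintegral mu (fun z => f z * (poisson e (z - y))%:C).
Proof.
move=> e0 fi; have wi := cintegrable_real (rintegrable_window_row n e0).
pose K (p : E * E) := phase 1 p.1 (p.2 - y).
have KE x z : K (x, z) = phase 1 z x * phase (-1) x y.
  by rewrite phaseC /K /phase dotBr -cisD !mulN1r !mul1r -mulrBr.
have mK : cmeasurable K.
  rewrite (_ : K = fun p => phase 1 p.1 p.2 * phase (-1) p.1 y); last first.
    by apply/funext => -[x z]; rewrite KE phaseC.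
  apply: cmeasurableM; first exact: cmeasurable_phase2.
  by have [m1 m2] := cmeasurable_phase (-1) y; split;
    [exact: (measurableT_comp m1 measurable_fst)|
     exact: (measurableT_comp m2 measurable_fst)].
have Fi := cintegrable_kernel wi fi mK (fun p : E * E => normc_phase 1 p.1 (p.2 - y)).
transitivity (cintegral mu (fun x => cintegral mu (fun z =>
    (window e x)%:C * f z * K (x, z)))).
  apply: eq_cintegral => x.
  rewrite mulrAC -cintegralZ; last exact: cintegrable_phase.
  by apply: eq_cintegral => z; rewrite KE; ring.
rewrite (cintegral_fubini Fi)/=; apply: eq_cintegral => z.
rewrite -(cintegral_window_phase _ e0) -cintegralZ; last exact: cintegrable_phase.
by apply: eq_cintegral => x; rewrite /K/=; ring.
Qed.

Lemma cvg_harmonic_window x : window k.+1%:R^-1 x @[k --> \oo] --> (1 : R).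
Proof.
under eq_fun do rewrite windowE.
have h : - (k.+1%:R^-1 * \sum_i `|x ord0 i|) @[k --> \oo] --> (0 : R).
  rewrite -[X in _ --> X]oppr0 -[X in _ --> - X](mul0r (\sum_i `|x ord0 i|)).
  by apply: cvgN; apply: cvgM; [exact: (@cvg_harmonic R)|exact: cvg_cst].
by have h2 := continuous_cvg _ (@continuous_expR R 0) h; rewrite expR0 in h2; exact: h2.
Qed.

(** One sequence has two limits: as the window widens to 1, dominated convergence on the frequency
    side gives the double transform, while in space the Poisson average tends to [h] at a point of
    continuity. *)
Lemma FT_inversion h (M : R) y : cintegrable mu h -> cintegrable mu (FT 1 h) ->
  (forall x, normc (h x) <= M) ->
  continuous_at_row (fun x => Re (h x)) y -> continuous_at_row (fun x => Im (h x)) y ->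
  FT (-1) (FT 1 h) y = h y.
Proof.
move=> hi Fi hM c1 c2.
pose e_ k : R := k.+1%:R^-1.
have e_0 k : 0 < e_ k by rewrite invr_gt0.
have cvg1 : normc (FT (-1) (fun x => (window (e_ k) x)%:C * FT 1 h x) y -
    FT (-1) (FT 1 h) y) @[k --> \oo] --> 0.
  apply: (cintegral_cvg _ _ _ (cintegrable_normc Fi)).
  - move=> k; exact: (cintegrable_measurable (cintegrable_phase _ _ (cintegrable_window_FT _ (e_0 k) hi))).
  - exact: (cintegrable_measurable (cintegrable_phase _ _ Fi)).
  - apply: aeW => x.
    have hw : `|window (e_ k) x - 1| @[k --> \oo] --> (0 : R).
      by apply/norm_cvg0P/subr_cvg0; exact: cvg_harmonic_window.
    have E2 k : normc ((window (e_ k) x)%:C * FT 1 h x * phase (-1) x y -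
        FT 1 h x * phase (-1) x y) = `|window (e_ k) x - 1| * normc (FT 1 h x).
      rewrite -mulrBl normcM normc_phase mulr1 -[X in _ - X]mul1r -mulrBl normcM.
      by rewrite -[1 : R[i]]/(1%:C) -rmorphB normc_real.
    have hc : `|window (e_ k) x - 1| * normc (FT 1 h x) @[k --> \oo] -->
        0 * normc (FT 1 h x).
      by apply: cvgM => //; exact: cvg_cst.
    by rewrite mul0r in hc; under eq_fun do rewrite E2.
  - move=> k x; rewrite !normcM normc_phase mulr1 normc_real ler_piMl ?normc_ge0//.
    rewrite ger0_norm ?window_ge0// windowE -expR0 ler_expR oppr_le0.
    by rewrite mulr_ge0 ?(ltW (e_0 k))// sumr_ge0.
have [m1 m2] := cintegrable_measurable hi.
have cvgR := poisson_cvg m1 (fun x => le_trans (Re_le_normc _) (hM x)) c1.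
have cvgI := poisson_cvg m2 (fun x => le_trans (Im_le_normc _) (hM x)) c2.
have E1 k : FT (-1) (fun x => (window (e_ k) x)%:C * FT 1 h x) y =
    \int[mu]_z (Re (h z) * poisson (e_ k) (z - y)) +i*
    \int[mu]_z (Im (h z) * poisson (e_ k) (z - y)).
  rewrite FT_window_FT// /cintegral.
  under eq_Rintegral do rewrite ReM mulr0 subr0.
  by under [X in _ +i* X]eq_Rintegral do rewrite ImM mulr0 add0r.
have part (P : R[i] -> R) : (forall z : R[i], `|P z| <= normc z) ->
    (forall z w : R[i], P (z - w) = P z - P w) ->
    P (FT (-1) (fun x => (window (e_ k) x)%:C * FT 1 h x) y) @[k --> \oo] --> P (h y) ->
    P (FT (-1) (FT 1 h) y) = P (h y).
  move=> Pn PB cP.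
  have cP' : P (FT (-1) (fun x => (window (e_ k) x)%:C * FT 1 h x) y) @[k --> \oo] -->
      P (FT (-1) (FT 1 h) y).
    apply/subr_cvg0/norm_cvg0P; apply: (squeeze_cvgr _ (cvg_cst 0) cvg1).
    by apply: nearW => k; rewrite normr_ge0 -PB Pn.
  exact: (cvg_unique _ cP' cP).
apply/eqP; rewrite eq_complex; apply/andP; split; apply/eqP.
- apply: part; [exact: Re_le_normc|by move=> z w; rewrite ReD ReN|].
  by under eq_fun do rewrite E1.
- apply: part; [exact: Im_le_normc|by move=> z w; rewrite ImD ImN|].
  by under eq_fun do rewrite E1.
Qed.

End fourier_transform.

(** * Directional derivatives through one-variable ones *)

Section line_derivatives.
Variables (R : realType) (V : normedModType R).
Implicit Types (f : V -> R) (x v : V) (t d : R).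

Lemma is_derive_line f x v t d : is_derive (t *: v + x) v f d ->
  is_derive t 1 (fun s : R => f (s *: v + x)) d.
Proof.
move=> [df fd].
have e : (fun h : R => h^-1 *: (((fun s : R => f (s *: v + x)) \o shift t) (h *: 1) -
      f (t *: v + x))) =
    (fun h : R => h^-1 *: ((f \o shift (t *: v + x)) (h *: v) - f (t *: v + x))).
  apply/funext => h /=; congr (_ *: (f _ - _)).
  by rewrite [h *: 1]mulr1 scalerDl addrA.
by split; rewrite /derivable /derive e.
Qed.

Lemma is_derive_line0 f x v d : is_derive (0 : R) (1 : R) (fun s : R => f (s *: v + x)) d ->
  is_derive x v f d.
Proof.
move=> [df fd].
have e : (fun h : R => h^-1 *: (((fun s : R => f (s *: v + x)) \o shift 0) (h *: 1) -
      f (0 *: v + x))) =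
    (fun h : R => h^-1 *: ((f \o shift x) (h *: v) - f x)).
  apply/funext => h /=; congr (_ *: (f _ - f _)); last by rewrite scale0r add0r.
  by rewrite [h *: 1]mulr1 addr0.
by split; [move: df|move: fd]; rewrite /derivable /derive e.
Qed.

(** With [cos_taylor], a remainder of order h^2 allows differentiation under the integral by an
    explicit estimate. *)
Lemma is_derive_quadratic f x v (L K : R) :
  (forall h : R, `|f (h *: v + x) - f x - h * L| <= K * h ^+ 2) -> is_derive x v f L.
Proof.
move=> fL.
have K0 : 0 <= K.
  by have := fL 1; rewrite expr1n mulr1; exact: le_trans.
have c : (fun h : R => h^-1 *: ((f \o shift x) (h *: v) - f x)) @ 0^' --> L.
  apply/cvgrPdist_le => e e0.
  have ek : 0 < e / (K + 1) by rewrite divr_gt0// ltr_wpDl.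
  near=> h.
  have h0 : h != 0 by near: h; exact: nbhs_dnbhs_neq.
  have he : `|h| <= e / (K + 1).
    near: h; apply: dnbhs0_le; exact: ek.
  rewrite /= -(ler_pM2l (_ : 0 < `|h|)) ?normr_gt0// -normrM mulrBr.
  rewrite [h * (_ *: _)]mulrA mulfV// mul1r distrC (le_trans (fL h))//.
  rewrite -real_normK ?num_real// mulrC -mulrA ler_wpM2l//.
  rewrite mulrC (le_trans (ler_wpM2l K0 he))// mulrA ler_pdivrMr ?ltr_wpDl//.
  by rewrite mulrC mulrDr mulr1 lerDl ltW.
by split; [apply/cvg_ex; exists L|exact: cvg_lim].
Unshelve. all: by end_near. Qed.

End line_derivatives.

(** * Mean value bounds for sine and cosine *)

Section mean_value_bounds.
Variable R : realType.
Implicit Types (f df : R -> R) (a b h : R).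

Lemma derive_bound f df a b K : (forall x : R, is_derive x 1 f (df x)) ->
  (forall x : R, `|x - a| <= `|b - a| -> `|df x| <= K) -> `|f b - f a| <= K * `|b - a|.
Proof.
move=> fd dfK; have cf : continuous f := derive_continuous fd.
have cfab u v : {within `[u, v], continuous f} by exact: continuous_subspaceT.
have [c ca ->] : exists2 c, `|c - a| <= `|b - a| & `|f b - f a| = `|df c| * `|b - a|.
  have [ab|/ltW ba] := leP a b.
    have [c cab ->] := MVT_segment ab (fun x _ => fd x) (cfab _ _).
    exists c; last by rewrite normrM.
    by move: cab; rewrite in_itv/= => /andP[ac cb]; rewrite !ger0_norm ?subr_ge0// lerD2r.
  have [c cab e] := MVT_segment ba (fun x _ => fd x) (cfab _ _).
  exists c; last by rewrite distrC e normrM [X in _ * X]distrC.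
  move: cab; rewrite in_itv/= => /andP[bc ca].
  by rewrite !ler0_norm ?subr_le0// lerN2 lerD2r.
by rewrite ler_wpM2r// dfK.
Qed.

Lemma cos_lipschitz a b : `|cos b - cos a| <= `|b - a|.
Proof.
rewrite -[leRHS]mul1r; apply: (derive_bound (fun x => is_derive_cos x)) => x _.
by rewrite normrN ler_norml sin_geN1 sin_le1.
Qed.

Lemma sin_lipschitz a b : `|sin b - sin a| <= `|b - a|.
Proof.
rewrite -[leRHS]mul1r; apply: (derive_bound (fun x => is_derive_sin x)) => x _.
exact: normr_cos_le1.
Qed.

(** The function cos(a + t) + t sin a has derivative sin a - sin(a + t), of size at most |h| for |t|
    <= |h|, so the mean value bound yields h^2. *)
Lemma cos_taylor a h : `|cos (a + h) - cos a + h * sin a| <= h ^+ 2.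
Proof.
pose g (t : R) := 1 * cos (1 * t + a) + sin a * (1 * t + 0).
have dg (t : R) : is_derive t 1 g (1 * (- sin (1 * t + a) * 1) + sin a * 1).
  apply: is_derive_lin; last exact: is_derive_affine.
  exact: (is_derive_comp1 (is_derive_cos _) (is_derive_affine 1 a t)).
have bnd (x : R) : `|x - 0| <= `|h - 0| ->
    `|1 * (- sin (1 * x + a) * 1) + sin a * 1| <= `|h|.
  rewrite !subr0 => xh; rewrite !mul1r !mulr1 addrC distrC.
  apply: le_trans (sin_lipschitz _ _) _.
  by rewrite addrK.
have := derive_bound dg bnd.
rewrite /g subr0 !mul1r !addr0 !add0r mulr0 addr0 [h + a]addrC -expr2 real_normK ?num_real//.
by rewrite addrAC [sin a * h]mulrC.
Qed.

End mean_value_bounds.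

(** * The integral of a derivative over the line *)

Section integral_of_derivative.
Variable R : realType.
Local Notation leb := (@lebesgue_measure R).

(** The fundamental theorem on growing symmetric intervals: the boundary terms vanish along the
    integers, and the truncated integrals converge because [f] is integrable. *)
Lemma Rintegral_derive (F f : R -> R) : (forall x : R, is_derive x 1 F (f x)) ->
  continuous f -> rintegrable leb f ->
  F k%:R @[k --> \oo] --> 0 -> F (- k%:R) @[k --> \oo] --> 0 ->
  \int[leb]_x f x = 0.
Proof.
move=> dF cf fi F1 F2.
have cF := derive_continuous dF.
have mf : measurable_fun setT f by exact: continuous_measurable_fun.
(* With [k.+1] the interval is nondegenerate already at k = 0, as the strict inequality [lt] below
   requires. *)
pose A (k : nat) : set R := [set` `[(- k.+1%:R), k.+1%:R]].
pose f_ k x := f x * \1_(A k) x.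
have c1 : \int[leb]_x f_ k x @[k --> \oo] --> \int[leb]_x f x.
  apply: (@Rintegral_cvg _ _ R leb f_ f (fun x => `|f x|)).
  - move=> k; apply: measurable_funM; first exact: mf.
    by apply: measurable_indic; exact: measurable_itv.
  - exact: mf.
  - apply: aeW => x; apply/cvgrPdist_le => e e0; near=> k.
    rewrite /f_ indicE mem_set ?mulr1 ?subrr ?normr0 ?(ltW e0)//.
    rewrite /A /= in_itv/= -ler_norml (@le_trans _ _ k%:R) ?ler_nat//.
    by near: k; exact: nbhs_infty_ger.
  - exact: rintegrable_norm.
  - move=> k x; rewrite normrM ler_piMr// indicE.
    by case: (_ \in _); rewrite ?normr1 ?normr0.
have e1 k : \int[leb]_x f_ k x = F k.+1%:R - F (- k.+1%:R).
  have lt : - k.+1%:R < k.+1%:R :> R.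
    by rewrite (@lt_trans _ _ 0) ?oppr_lt0 ?ltr0n.
  rewrite -[RHS]/(fine ((F k.+1%:R)%:E - (F (- k.+1%:R))%:E)%E).
  rewrite -(@continuous_FTC2 _ f F _ _ lt).
  - rewrite [in RHS]integral_mkcond; congr fine; apply: eq_integral => x _.
    by rewrite /f_ patchE indicE /A; case: ifPn; rewrite ?mulr1 ?mulr0.
  - exact: continuous_subspaceT.
  - split=> [x _||]; first by have [] := dF x.
      by apply: cvg_at_right_filter; exact: cF.
    by apply: cvg_at_left_filter; exact: cF.
  - by move=> x _; rewrite derive1E; have h := dF x; exact: derive_val.
have c2 : \int[leb]_x f_ k x @[k --> \oo] --> (0 : R).
  have h : F k.+1%:R - F (- k.+1%:R) @[k --> \oo] --> (0 - 0 : R).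
    apply: cvgB; first by move: F1; rewrite -cvg_shiftS.
    by move: F2; rewrite -(cvg_shiftS (fun k => F (- k%:R))).
  by rewrite subr0 in h; under eq_fun do rewrite e1.
exact: (cvg_unique _ c1 c2).
Unshelve. all: by end_near. Qed.

End integral_of_derivative.

(** * Schwartz functions *)

Section multipliers.
Variables (R : realType) (n : nat).
Local Notation "''e_' i" := (delta_mx 0 i : 'rV[R]_n).
Implicit Types (u v m : 'rV[R]_n -> R) (x : 'rV[R]_n) (l : seq 'I_n).

Definition bracket x : R := 1 + dot x x.

Lemma dot_ge0 x : 0 <= dot x x.
Proof. by apply: sumr_ge0 => i _; rewrite -expr2 sqr_ge0. Qed.

Lemma bracket_ge1 x : 1 <= bracket x.
Proof. by rewrite lerDl dot_ge0. Qed.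

Lemma bracket_gt0 x : 0 < bracket x.
Proof. exact: lt_le_trans (bracket_ge1 x). Qed.

Lemma sqr_coord_le x i : 1 + x ord0 i ^+ 2 <= bracket x.
Proof.
rewrite lerD2l /dot (bigD1 i)//= -expr2 lerDl.
by apply: sumr_ge0 => j _; rewrite -expr2 sqr_ge0.
Qed.

Lemma coord_le_bracket x i : `|x ord0 i| <= bracket x.
Proof.
apply: le_trans (sqr_coord_le x i).
rewrite -real_normK ?num_real//; set a := `|_|.
by have := sqr_ge0 (a - 2^-1); rewrite sqrrB; lra.
Qed.

Lemma prod_coord_le_bracket l x : `|\prod_(i <- l) x ord0 i| <= bracket x ^+ size l.
Proof.
elim: l => [|i l IH]; first by rewrite big_nil expr0 normr1.
by rewrite big_cons normrM exprS ler_pM// coord_le_bracket.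
Qed.

Lemma decay_le_bracket x : bracket x ^- n <= decay x.
Proof.
rewrite /decay prodfV -exprVn exprVn lef_pV2 ?posrE ?exprn_gt0 ?bracket_gt0//; last first.
  by apply: prodr_gt0 => i _; rewrite ltr_pwDl ?sqr_ge0.
rewrite -[X in _ ^+ X]card_ord -prodr_const; apply: ler_prod => i _.
by rewrite sqr_coord_le addr_ge0 ?sqr_ge0.
Qed.

Lemma bracket_line x i (t : R) :
  bracket (t *: 'e_i + x) = bracket x + 2 * t * x ord0 i + t ^+ 2.
Proof.
rewrite /bracket /dot (bigD1 i)//= [in RHS](bigD1 i)//= !mxE !eqxx mulr1.
rewrite (eq_bigr (fun j => x ord0 j * x ord0 j)); first by ring.
by move=> j ji; rewrite !mxE eqxx (negbTE ji) mulr0 add0r.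
Qed.

Lemma is_derive_coord x i j :
  is_derive x 'e_i (fun y : 'rV[R]_n => y ord0 j) ((j == i)%:R).
Proof.
apply: is_derive_line0.
rewrite (_ : (fun _ => _) = fun s : R => (j == i)%:R * s + x ord0 j).
  exact: is_derive_affine.
by apply/funext => s; rewrite !mxE eqxx mulrC.
Qed.

(** The exponent applies to 1 + |x|^2, so the symbol of P^s is [bracket_pow (s / 2)]. *)
Definition bracket_pow (r : R) x : R := bracket x `^ r.

(* A class of smooth functions of polynomial growth that is closed under partial
   derivatives by construction. *)
Inductive multiplier : ('rV[R]_n -> R) -> Prop :=
| mult_cst c : multiplier (fun=> c)
| mult_coord i : multiplier (fun x => x ord0 i)
| mult_pow r : multiplier (bracket_pow r)
| mult_add u v : multiplier u -> multiplier v -> multiplier (fun x => u x + v x)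
| mult_mul u v : multiplier u -> multiplier v -> multiplier (fun x => u x * v x).

Lemma eq_multiplier u v : multiplier v -> u =1 v -> multiplier u.
Proof. by move=> mv uv; rewrite (_ : u = v)//; exact/funext. Qed.

Definition has_partials u := continuous u /\ forall x i, derivable u x 'e_i.

Lemma is_derive_mulE u v x i (du dv : R) : is_derive x 'e_i u du -> is_derive x 'e_i v dv ->
  is_derive x 'e_i (fun y => u y * v y) (u x * dv + v x * du).
Proof. by move=> hu hv; exact: is_deriveM. Qed.

Lemma is_derive_addE u v x i (du dv : R) : is_derive x 'e_i u du -> is_derive x 'e_i v dv ->
  is_derive x 'e_i (fun y => u y + v y) (du + dv).
Proof. by move=> hu hv; exact: is_deriveD. Qed.

Lemma has_partials_mul u v : has_partials u -> has_partials v ->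
  has_partials (fun x => u x * v x).
Proof.
move=> [cu du] [cv dv]; split=> [x|x i]; first exact: (cvgM (cu x) (cv x)).
by have [] := is_derive_mulE (derivableP (du x i)) (derivableP (dv x i)).
Qed.

Lemma has_partials_add u v : has_partials u -> has_partials v ->
  has_partials (fun x => u x + v x).
Proof.
move=> [cu du] [cv dv]; split=> [x|x i]; first exact: (cvgD (cu x) (cv x)).
by have [] := is_derive_addE (derivableP (du x i)) (derivableP (dv x i)).
Qed.

Lemma derive_mulE u v i : has_partials u -> has_partials v ->
  (fun x => 'D_('e_i) (fun y => u y * v y) x) =
  (fun x => u x * 'D_('e_i) v x + v x * 'D_('e_i) u x).
Proof.
move=> [cu du] [cv dv]; apply/funext => x.
by have h := is_derive_mulE (derivableP (du x i)) (derivableP (dv x i)); exact: derive_val.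
Qed.

Lemma derive_addE u v i : has_partials u -> has_partials v ->
  (fun x => 'D_('e_i) (fun y => u y + v y) x) =
  (fun x => 'D_('e_i) u x + 'D_('e_i) v x).
Proof.
move=> [cu du] [cv dv]; apply/funext => x.
by have h := is_derive_addE (derivableP (du x i)) (derivableP (dv x i)); exact: derive_val.
Qed.

Lemma continuous_bracket : continuous bracket.
Proof.
move=> x.
have hi i : continuous (fun y : 'rV[R]_n => y ord0 i * y ord0 i).
  move=> y; have ci : continuous (fun y : 'rV[R]_n => y ord0 i) := @continuous_coord R n i.
  exact: (@cvgM _ _ _ (nbhs_filter y) _ _ _ _ (ci y) (ci y)).
have ca : continuous (fun z : R * R => z.1 + z.2) by exact: add_continuous.
have h := @continuous_big R 'I_n +%R 0 predT ca 'rV[R]_n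
  (index_enum 'I_n) _ (fun i _ => hi i).
have h1 : continuous (fun _ : 'rV[R]_n => 1 : R) by exact: cst_continuous.
exact: (@cvgD _ _ _ _ (nbhs_filter x) _ _ _ _ (h1 x) (h x)).
Qed.

Lemma bracket_powE r x : bracket_pow r x = expR (r * ln (bracket x)).
Proof. by rewrite /bracket_pow /powR gt_eqF// bracket_gt0. Qed.

Lemma is_derive_bracket_pow r x i : is_derive x 'e_i (bracket_pow r)
  (r * 2 * (x ord0 i * bracket_pow (r - 1) x)).
Proof.
apply: is_derive_line0.
have -> : (fun s : R => bracket_pow r (s *: 'e_i + x)) =
    (fun s : R => expR (r * ln (1 * s ^+ 2 + 1 * (2 * x ord0 i * s + bracket x)) + 0 * 0)).
  apply/funext => s; rewrite bracket_powE bracket_line mul0r addr0.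
  by congr (expR (_ * ln _)); ring.
have dq : is_derive (0 : R) (1 : R) (fun s : R => 1 * s ^+ 2 + 1 * (2 * x ord0 i * s + bracket x))
   (1 * 0 + 1 * (2 * x ord0 i)).
  apply: is_derive_lin; last exact: is_derive_affine.
  apply: (is_derive_eq (is_deriveX 2 (is_derive_id (0 : R) (1 : R)))).
  by rewrite /= expr1 mulr0 scale0r.
have q0 : 0 < 1 * (0 : R) ^+ 2 + 1 * (2 * x ord0 i * 0 + bracket x).
  by rewrite expr0n/= !mul1r mulr0 !add0r bracket_gt0.
have dl := @is_derive_comp1 R (@ln R)
  (fun s => 1 * s ^+ 2 + 1 * (2 * x ord0 i * s + bracket x)) 0 _ _
  (is_derive1_ln q0) dq.
have d1 := is_derive_lin r 0 dl (is_derive_cst (0 : R) (0 : R) (1 : R)).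
apply: (is_derive_eq (is_derive_comp1 (is_derive_expR _) d1)).
rewrite expr0n/= !mul1r !mulr0 !add0r !addr0.
rewrite !bracket_powE mulrBl mul1r expRD expRN lnK ?posrE ?bracket_gt0//.
ring.
Qed.

Lemma continuous_bracket_pow r : continuous (bracket_pow r).
Proof.
move=> x; have -> : bracket_pow r = fun x => expR (r * ln (bracket x)).
  by apply/funext => y; exact: bracket_powE.
have cl : {for x, continuous (fun y => ln (bracket y))}.
  apply: continuous_comp; first exact: continuous_bracket.
  by apply: continuous_ln; exact: bracket_gt0.
apply: (@continuous_comp _ _ _ (fun y => ln (bracket y)) (fun t : R => expR (r * t)) x cl).
apply: continuous_comp; last exact: continuous_expR.
by apply: cvgM; [exact: cvg_cst|exact: cvg_id].
Qed.

Lemma le_bracket_pow (C : R) N M x : (N <= M)%N ->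
  C * bracket x ^+ N <= `|C| * bracket x ^+ M.
Proof.
move=> NM; apply: (@le_trans _ _ (`|C| * bracket x ^+ N)).
  by rewrite ler_wpM2r ?ler_norm// exprn_ge0// ltW// bracket_gt0.
by rewrite ler_wpM2l// ler_weXn2l// bracket_ge1.
Qed.

Lemma multiplierP m : multiplier m ->
  [/\ has_partials m, (forall i, multiplier (fun x => 'D_('e_i) m x)) &
      exists C N, forall x, `|m x| <= C * bracket x ^+ N].
Proof.
elim=> {m} [c|i|r|u v mu_ [du pu [C [N Cu]]] mv [dv pv [D [M Dv]]]|
            u v mu_ [du pu [C [N Cu]]] mv [dv pv [D [M Dv]]]].
- split.
  + split; first exact: cst_continuous.
    by move=> x i; exact: derivable_cst.
  + by move=> i; apply: (eq_multiplier (mult_cst 0)) => x; exact: derive_cst.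
  + by exists `|c|, 0%N => x; rewrite expr0 mulr1.
- split.
  + split; first exact: coord_continuous.
    by move=> x j; have [] := is_derive_coord x j i.
  + move=> j; apply: (eq_multiplier (mult_cst (i == j)%:R)) => x.
    by have h := is_derive_coord x j i; exact: derive_val.
  + by exists 1, 1%N => x; rewrite mul1r expr1 coord_le_bracket.
- split.
  + split; last by move=> x j; have [] := is_derive_bracket_pow r x j.
    exact: continuous_bracket_pow.
  + move=> j; apply: (eq_multiplier (mult_mul (mult_cst (r * 2))
      (mult_mul (mult_coord j) (mult_pow (r - 1))))) => x.
    by have h := is_derive_bracket_pow r x j; exact: derive_val.
  (* The bracket is at least 1, so its real power [r] is at most its power with any natural exponent
     above |r|, whatever the sign of [r]. *)
  + exists 1, (Num.truncn `|r|).+1 => x.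
    rewrite mul1r ger0_norm ?powR_ge0// -powR_mulrn ?(ltW (bracket_gt0 x))//.
    by apply: ler_powR; rewrite ?bracket_ge1// (le_trans (ler_norm _))// ltW// truncnS_gt.
- split; first exact: has_partials_add.
    by move=> i; rewrite derive_addE//; apply: mult_add.
  exists (`|C| + `|D|), (N + M)%N => x; rewrite (le_trans (ler_normD _ _))// mulrDl.
  by rewrite lerD// ?(le_trans (Cu x)) ?(le_trans (Dv x))// le_bracket_pow ?leq_addr ?leq_addl.
- split; first exact: has_partials_mul.
    by move=> i; rewrite derive_mulE//; apply: mult_add; apply: mult_mul.
  exists (C * D), (N + M)%N => x; rewrite normrM exprD mulrACA.
  by apply: ler_pM.
Qed.

End multipliers.

(** * Sorted words and multi-indices *)

Section words.
Variable n : nat.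
Implicit Types (l : seq 'I_n) (a b : multiindex n).

Definition leo : rel 'I_n := fun i j => (i <= j)%N.

(* The seminorms of [schwartz] control [partials l] only for the words
   [l = word a], which list the coordinates in increasing order.  Sorted words are
   kept throughout, so that no symmetry of mixed partial derivatives is needed. *)
Definition ordered l := sorted leo l.

Lemma leo_trans : transitive leo.
Proof. by move=> j i k; exact: leq_trans. Qed.

Lemma ordered_tl i l : ordered (i :: l) -> ordered l.
Proof. by rewrite /ordered /=; exact: path_sorted. Qed.

Lemma ordered_subseq l l' : subseq l' l -> ordered l -> ordered l'.
Proof. exact: (subseq_sorted leo_trans). Qed.

Lemma mem_word_seq a (s : seq 'I_n) i :
  i \in flatten [seq nseq (a j) j | j <- s] -> i \in s.
Proof.
move=> /flattenP[_ /mapP[j js ->]]; rewrite mem_nseq => /andP[_ /eqP ->].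
exact: js.
Qed.

Lemma ordered_word a : ordered (word a).
Proof.
rewrite /ordered /word; have : pairwise leo (enum 'I_n).
  rewrite -(sorted_pairwise leo_trans) /leo.
  have := iota_sorted 0 n; rewrite -val_enum_ord.
  by rewrite sorted_map.
rewrite (sorted_pairwise leo_trans).
elim: (enum 'I_n) => [//|i s IH] /= /andP[/allP ai ps].
rewrite pairwise_cat IH// andbT; apply/andP; split.
  apply/allrelP => x y; rewrite mem_nseq => /andP[_ /eqP ->] /mem_word_seq; exact: ai.
elim: (a i) => [//|k IHk] /=; rewrite IHk andbT.
by apply/allP => x; rewrite mem_nseq => /andP[_ /eqP ->]; rewrite /leo.
Qed.

Definition counts l : multiindex n := [ffun i => count_mem i l].

Lemma count_word a i : count_mem i (word a) = a i.
Proof.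
rewrite /word count_flatten -map_comp sumnE big_map big_enum/=.
rewrite (bigD1 i)//= count_nseq/= eqxx mul1n big1 ?addn0// => j ji.
by rewrite count_nseq/= (negbTE ji) mul0n.
Qed.

Lemma perm_word l : perm_eq (word (counts l)) l.
Proof. by apply/allP => i _; apply/eqP; rewrite count_word ffunE. Qed.

Lemma word_counts l : ordered l -> word (counts l) = l.
Proof.
move=> ol; apply: (sorted_eq leo_trans) => //; last exact: perm_word.
- by move=> i j; rewrite /leo -eqn_leq => /eqP/val_inj.
- exact: ordered_word.
Qed.

End words.

(** * Schwartz functions in real components *)

Section real_schwartz.
Variables (R : realType) (n : nat).
Local Notation "''e_' i" := (delta_mx 0 i : 'rV[R]_n).
Implicit Types (u v m : 'rV[R]_n -> R) (x : 'rV[R]_n) (l : seq 'I_n).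

Definition rapid_bound u := forall N, exists C, forall x, bracket x ^+ N * `|u x| <= C.

(** The Schwartz condition for one real component, with powers of the bracket as weights and bounds
    on sorted derivatives only; the next lemmas show that it matches [schwartz]. *)
Definition rschwartz u := smooth u /\ forall l, ordered l -> rapid_bound (partials l u).

Lemma smooth_has_partials u l : smooth u -> has_partials (partials l u).
Proof. by move=> su; have [] := su l. Qed.

Lemma rapid_bound_mul m u : multiplier m -> rapid_bound u ->
  rapid_bound (fun x => m x * u x).
Proof.
move=> /multiplierP[_ _ [C [M Cm]]] bu N; have [D Du] := bu (N + M)%N.
exists (`|C| * `|D|) => x.
have b0 k : 0 <= bracket x ^+ k by rewrite exprn_ge0// ltW// bracket_gt0.
rewrite normrM mulrCA; apply: (@le_trans _ _ (`|C| * bracket x ^+ M * (bracket x ^+ N * `|u x|))).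
  by rewrite ler_wpM2r ?mulr_ge0// (le_trans (Cm x))// le_bracket_pow.
by rewrite -mulrA ler_wpM2l// mulrA -exprD addnC (le_trans (Du x))// ler_norm.
Qed.

Lemma rapid_boundD u v : rapid_bound u -> rapid_bound v -> rapid_bound (fun x => u x + v x).
Proof.
move=> bu bv N; have [C Cu] := bu N; have [D Dv] := bv N; exists (C + D) => x.
have b0 : 0 <= bracket x ^+ N by rewrite exprn_ge0// ltW// bracket_gt0.
by rewrite (le_trans (ler_wpM2l b0 (ler_normD _ _)))// mulrDr lerD.
Qed.

(* By Leibniz, [partials l (m * u)] lies in [span u l]; the subwords of a sorted
   word are sorted, so [span] only involves derivatives that are under control. *)
Inductive span u l : ('rV[R]_n -> R) -> Prop :=
| span_mul m l' : multiplier m -> subseq l' l -> span u l (fun x => m x * partials l' u x)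
| span_add f g : span u l f -> span u l g -> span u l (fun x => f x + g x).

Lemma span_has_partials u l f : smooth u -> span u l f -> has_partials f.
Proof.
move=> su; elim=> {f} [m l' mm sl|f g _ pf _ pg]; last exact: has_partials_add.
have [pm _ _] := multiplierP mm.
exact: has_partials_mul pm (smooth_has_partials l' su).
Qed.

Lemma span_derive u l f i : smooth u -> span u l f ->
  span u (i :: l) (fun x => 'D_('e_i) f x).
Proof.
move=> su; elim=> {f} [m l' mm sl|f g hf sf hg sg].
  have [pm dm _] := multiplierP mm; have pu := smooth_has_partials l' su.
  rewrite derive_mulE//.
  rewrite (_ : (fun x => _ + _) = fun x => m x * partials (i :: l') u x +
     'D_('e_i) m x * partials l' u x); last first.
    by apply/funext => x /=; congr (_ + _); rewrite mulrC.
  apply: span_add; apply: span_mul => //.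
  - by rewrite /= eqxx.
  - exact: subseq_trans sl (subseq_cons _ _).
rewrite derive_addE; [exact: span_add|exact: span_has_partials hf|].
exact: span_has_partials hg.
Qed.

Lemma span_rapid u l f : ordered l -> rschwartz u -> span u l f -> rapid_bound f.
Proof.
move=> ol [su ru]; elim=> {f} [m l' mm sl|f g _ bf _ bg]; last exact: rapid_boundD.
by apply: rapid_bound_mul => //; apply: ru; exact: ordered_subseq sl ol.
Qed.

Lemma span_partials m u l : multiplier m -> smooth u ->
  span u l (partials l (fun x => m x * u x)).
Proof.
move=> mm su; elim: l => [|i l IH].
  exact: (@span_mul u [::] m [::] mm (sub0seq _)).
exact: span_derive.
Qed.

Lemma rschwartz_mul m u : multiplier m -> rschwartz u -> rschwartz (fun x => m x * u x).
Proof.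
move=> mm ru; have [su _] := ru; split.
  by move=> l; exact: span_has_partials su (span_partials l mm su).
by move=> l ol; apply: (span_rapid ol ru); exact: (span_partials l mm su).
Qed.

Lemma rschwartz_lin (a b : R) u v : rschwartz u -> rschwartz v ->
  rschwartz (fun x => a * u x + b * v x).
Proof.
move=> [su ru] [sv rv]; split; first exact: smooth_lin.
move=> l ol; rewrite partials_lin//; apply: rapid_boundD.
  exact: (rapid_bound_mul (mult_cst n a) (ru l ol)).
exact: (rapid_bound_mul (mult_cst n b) (rv l ol)).
Qed.

(** Monomials are indexed by arbitrary words, so that multiplying by the bracket, a sum of squares
    of coordinates plus 1, only lengthens words. Bounds on monomials thus become bounds on powers of
    the bracket. *)
Definition monomial_bound u := forall l, exists C, forall x,
  `|\prod_(i <- l) x ord0 i * u x| <= C.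

Lemma monomial_bound_bracket u : monomial_bound u -> monomial_bound (fun x => bracket x * u x).
Proof.
move=> bu l; have [C0 h0] := bu l.
have /choice [C hC] : forall i, exists C, forall x,
    `|\prod_(j <- [:: i, i & l]) x ord0 j * u x| <= C by move=> i; exact: bu.
exists (C0 + \sum_i C i) => x.
rewrite /bracket mulrDl mul1r mulrDr (le_trans (ler_normD _ _))// lerD//.
rewrite /dot mulr_suml mulr_sumr (le_trans (ler_norm_sum _ _ _))//.
apply: ler_sum => i _; have := hC i x; rewrite !big_cons.
by congr (`|_| <= _); ring.
Qed.

Lemma monomial_bound_rapid u : monomial_bound u -> rapid_bound u.
Proof.
move=> bu N; have bN : monomial_bound (fun x => bracket x ^+ N * u x).
  elim: N => [|N /monomial_bound_bracket]; first by under eq_fun do rewrite expr0 mul1r.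
  by under eq_fun do rewrite mulrA -exprS.
have [C h] := bN [::]; exists C => x; have := h x; rewrite big_nil mul1r normrM.
by rewrite [`|_ ^+ _|]ger0_norm// exprn_ge0// ltW// bracket_gt0.
Qed.

Lemma monomial_word (b : multiindex n) x : monomial b x = \prod_(i <- word b) x ord0 i.
Proof.
rewrite /word big_flatten/= big_map big_enum/=; apply: eq_bigr => i _.
by rewrite big_nseq iter_mulr_1.
Qed.

Lemma monomial_counts l x : monomial (counts l) x = \prod_(i <- l) x ord0 i.
Proof. by rewrite monomial_word; exact/perm_big/perm_word. Qed.

(** Coordinates commute in a monomial, so [counts] represents every weight [l']; for a derivative it
    represents [l] itself only when [l] is sorted. *)
Lemma schwartz_rschwartz (f : 'rV[R]_n -> R[i]) : schwartz f ->
  rschwartz (fun x => Re (f x)) /\ rschwartz (fun x => Im (f x)).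
Proof.
move=> [s1 s2 fb]; split; split => // l ol; apply: monomial_bound_rapid => l';
  have [C hC] := fb (counts l) (counts l'); exists C => x.
  apply: le_trans (hC _ (ex_intro2 _ _ x I erefl)).
  rewrite normcM normc_real monomial_counts normrM ler_wpM2l//.
  by apply: le_trans (Re_le_normc _); rewrite /cderiv/= word_counts.
apply: le_trans (hC _ (ex_intro2 _ _ x I erefl)).
rewrite normcM normc_real monomial_counts normrM ler_wpM2l//.
by apply: le_trans (Im_le_normc _); rewrite /cderiv/= word_counts.
Qed.

Lemma rschwartz_schwartz (f : 'rV[R]_n -> R[i]) :
  rschwartz (fun x => Re (f x)) -> rschwartz (fun x => Im (f x)) -> schwartz f.
Proof.
move=> [s1 r1] [s2 r2]; split => // a b.
have [C hC] := r1 _ (ordered_word a) (size (word b)).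
have [D hD] := r2 _ (ordered_word a) (size (word b)).
exists (C + D) => _ [x _ <-].
rewrite normcM normc_real monomial_word.
apply: (@le_trans _ _ (bracket x ^+ size (word b) * normc (cderiv a f x))).
  by rewrite ler_wpM2r ?normc_ge0// prod_coord_le_bracket.
have b0 : 0 <= bracket x ^+ size (word b) by rewrite exprn_ge0// ltW// bracket_gt0.
by rewrite (le_trans (ler_wpM2l b0 (normc_le_ReIm _)))// mulrDr lerD.
Qed.

End real_schwartz.

(** * Integrating along one coordinate *)

Section coordinate_integrals.
Variable R : realType.
Local Notation leb := (@lebesgue_measure R).

Definition upd n (t : n.-tuple R) (i : 'I_n) (a : R) : n.-tuple R :=
  [tuple if j == i then a else tnth t j | j < n].

Lemma upd_tcons0 n a b (t : n.-tuple R) : upd (tcons (b, t)) ord0 a = tcons (a, t).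
Proof.
apply: eq_from_tnth => j; rewrite tnth_mktuple.
have [j' ->|->//] := unliftP ord0 j.
by rewrite !tnth_tconsS.
Qed.

Lemma upd_tconsS n a b (t : n.-tuple R) i :
  upd (tcons (b, t)) (lift ord0 i) a = tcons (b, upd t i a).
Proof.
apply: eq_from_tnth => j; rewrite tnth_mktuple.
have [j' ->|->//] := unliftP ord0 j.
by rewrite (inj_eq lift_inj) !tnth_tconsS tnth_mktuple.
Qed.

(** Fubini with coordinate [i] innermost. The induction freezes leading coordinates until [i] comes
    first; each frozen one is absorbed into the constant of the decay bound, so slices satisfy the
    same hypotheses. *)
Lemma Rintegral_tuple_coord0 n (f : n.-tuple R -> R) (i : 'I_n) (C : R) :
  measurable_fun setT f ->
  (forall t, `|f t| <= C * \prod_j (1 + tnth t j ^+ 2)^-1) ->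
  (forall t, \int[leb]_a f (upd t i a) = 0) ->
  \int[lebesgue_tuple R n]_t f t = 0.
Proof.
elim: n f i C => [|n IH] f i C mf fC f0; first by case: i f0.
have d0 (j : nat) (a : R) : 0 <= (1 + a ^+ 2)^-1 by rewrite invr_ge0 addr_ge0 ?sqr_ge0.
have fi : rintegrable (lebesgue_tuple R n.+1) f.
  apply: (le_rintegrable mf fC); apply: rintegrableZ.
  apply: (rintegrable_prod_tuple (f := fun _ a => (1 + a ^+ 2)^-1)); first by move=> *; exact: d0.
  by move=> _; exact: rintegrable_cauchy.
have pi : rintegrable (leb \x lebesgue_tuple R n)%E (f \o @tcons R n).
  exact/(rintegrable_tcons mf).
rewrite Rintegral_tcons//.
case: (unliftP ord0 i) f0 => [j ->|->] f0; last first.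
  rewrite -(Rintegral_fubini2 pi).
  under eq_Rintegral => t _.
    rewrite (_ : Rintegral _ _ _ = 0); last first.
      rewrite -(f0 (tcons (0, t))); apply: eq_Rintegral => a _ /=.
      by rewrite upd_tcons0.
    over.
  by rewrite Rintegral_cst// mul0r.
rewrite -(Rintegral_fubini1 pi).
under eq_Rintegral => a _.
  rewrite (_ : Rintegral _ _ _ = 0); last first.
    apply: (IH (fun t => f (tcons (a, t))) j (C * (1 + a ^+ 2)^-1)) => [|t|t].
    - apply: (measurableT_comp mf); apply: (measurableT_comp (@measurable_tcons R n)).
      exact: pair1_measurable.
    - apply: le_trans (fC _) _; rewrite big_ord_recl tnth_tcons0 mulrA.
      rewrite le_eqVlt; apply/orP; left; apply/eqP; congr (_ * _).
      by apply: eq_bigr => k _; rewrite tnth_tconsS.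
    - by under eq_Rintegral do rewrite -upd_tconsS; exact: f0.
  over.
by rewrite Rintegral_cst// mul0r.
Qed.

End coordinate_integrals.

(** * The cosine transform and its derivatives *)

Section cosine_transform.
Variables (R : realType) (n : nat).
Local Notation "''e_' i" := (delta_mx 0 i : 'rV[R]_n).
Local Notation E := (borel 'rV[R]_n).
Local Notation mu := (@lambda_rV R n).
Local Notation leb := (@lebesgue_measure R).
Implicit Types (u v m : 'rV[R]_n -> R) (x xi : 'rV[R]_n) (l : seq 'I_n) (b : R).

Lemma rapid_bound_decay u : rapid_bound u -> exists C, forall x, `|u x| <= C * decay x.
Proof.
move=> bu; have [C Cu] := bu n; exists `|C| => x.
have b0 : 0 < bracket x ^+ n by rewrite exprn_gt0// bracket_gt0.
apply: (@le_trans _ _ (`|C| * bracket x ^- n)); last by rewrite ler_wpM2l// decay_le_bracket.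
by rewrite ler_pdivlMr// mulrC (le_trans (Cu x))// ler_norm.
Qed.

Lemma rapid_rintegrable u : continuous u -> rapid_bound u -> rintegrable mu u.
Proof.
move=> cu /rapid_bound_decay[C Cu].
apply: (le_rintegrable (continuous_measurable_row cu) Cu).
by apply: rintegrableZ; exact: rintegrable_decay.
Qed.

Lemma rapid_mul m u : multiplier m -> continuous u -> rapid_bound u ->
  continuous (fun x => m x * u x) /\ rapid_bound (fun x => m x * u x).
Proof.
move=> mm cu bu; split; last exact: rapid_bound_mul.
by move=> x; have [[cm _] _ _] := multiplierP mm; exact: (cvgM (cm x) (cu x)).
Qed.

Lemma rintegrable_mul m u : multiplier m -> continuous u -> rapid_bound u ->
  rintegrable mu (fun x => m x * u x).
Proof.
by move=> mm cu bu; have [] := rapid_mul mm cu bu; exact: rapid_rintegrable.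
Qed.

(* The shift [b] gives the real part at [b = 0] and the imaginary part at
   [b = - pi / 2], and a partial derivative in [xi] increases it by [pi / 2]. *)
Definition ctransform b u xi : R := \int[mu]_x (u x * cos (2 * pi * dot x xi + b)).

Lemma rintegrable_ctransform b u xi : rintegrable mu u ->
  rintegrable mu (fun x => u x * cos (2 * pi * dot x xi + b)).
Proof.
move=> ui; apply: (le_rintegrable _ _ (rintegrable_norm ui)).
  apply: measurable_funM; last exact: measurable_phase.
  exact: rintegrable_measurable ui.
by move=> x; rewrite normrM ler_piMr// normr_cos_le1.
Qed.

Lemma normr_ctransform_le b u xi : rintegrable mu u ->
  `|ctransform b u xi| <= \int[mu]_x `|u x|.
Proof.
move=> ui; apply: (le_norm_Rintegral _ _ (rintegrable_norm ui)).
  exact: (rintegrable_measurable (rintegrable_ctransform b xi ui)).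
by move=> x; rewrite normrM ler_piMr// normr_cos_le1.
Qed.

Lemma dot_line x xi i (h : R) : dot x (h *: 'e_i + xi) = dot x xi + h * x ord0 i.
Proof.
rewrite /dot (bigD1 i)//= [in RHS](bigD1 i)//= !mxE !eqxx mulr1.
rewrite (eq_bigr (fun j => x ord0 j * xi ord0 j)); first by ring.
by move=> j ji; rewrite !mxE eqxx (negbTE ji) mulr0 add0r.
Qed.

Lemma cos_pihalfD (a : R) : cos (a + pi / 2) = - sin a.
Proof. by rewrite cosD cos_pihalf sin_pihalf mulr0 mulr1 sub0r. Qed.

(** The Taylor remainder of the cosine is at most (2 pi h x_i)^2, and x_i^2 u is integrable by rapid
    decay. *)
Lemma is_derive_ctransform b u xi i : continuous u -> rapid_bound u ->
  is_derive xi 'e_i (ctransform b u)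
    (2 * pi * ctransform (b + pi / 2) (fun x => x ord0 i * u x) xi).
Proof.
move=> cu bu; have ui := rapid_rintegrable cu bu.
have xui := rintegrable_mul (mult_coord R i) cu bu.
have xxui := rintegrable_mul (mult_mul (mult_coord R i) (mult_coord R i)) cu bu.
apply: (is_derive_quadratic (K := (2 * pi) ^+ 2 *
  \int[mu]_x `|x ord0 i * x ord0 i * u x|)) => h.
have i1 := rintegrable_ctransform b (h *: 'e_i + xi) ui.
have i2 := rintegrable_ctransform b xi ui.
have i3 := rintegrable_ctransform (b + pi / 2) xi xui.
have i4 := rintegrableZ (h * (2 * pi)) i3.
have i12 := rintegrableD i1 (rintegrableN i2).
have i5 := rintegrable_norm xxui.
have -> : ctransform b u (h *: 'e_i + xi) - ctransform b u xi -
    h * (2 * pi * ctransform (b + pi / 2) (fun x => x ord0 i * u x) xi) =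
  \int[mu]_x (u x * cos (2 * pi * dot x (h *: 'e_i + xi) + b) -
    u x * cos (2 * pi * dot x xi + b) -
    h * (2 * pi) * (x ord0 i * u x * cos (2 * pi * dot x xi + (b + pi / 2)))).
  by rewrite RintegralB// RintegralB// RintegralZl// mulrA.
rewrite mulrAC -RintegralZl//; apply: le_norm_Rintegral.
- exact: (rintegrable_measurable (rintegrableD i12 (rintegrableN i4))).
- move=> x; rewrite dot_line addrA cos_pihalfD.
  have e1 : u x * cos (2 * pi * (dot x xi + h * x ord0 i) + b) -
      u x * cos (2 * pi * dot x xi + b) -
      h * (2 * pi) * (x ord0 i * u x * - sin (2 * pi * dot x xi + b)) =
    u x * (cos (2 * pi * dot x xi + b + h * (2 * pi) * x ord0 i) -
      cos (2 * pi * dot x xi + b) + h * (2 * pi) * x ord0 i * sin (2 * pi * dot x xi + b)).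
    rewrite (_ : 2 * pi * (dot x xi + h * x ord0 i) + b =
      2 * pi * dot x xi + b + h * (2 * pi) * x ord0 i); last by move: (@pi R) => p; ring.
    set c1 := cos (_ + h * _ * _); set c2 := cos _; set s1 := sin _.
    by clearbody c1 c2 s1; move: (@pi R) => p; ring.
  rewrite e1 normrM (le_trans (ler_wpM2l (normr_ge0 _) (cos_taylor _ _)))//.
  rewrite !normrM -expr2 real_normK ?num_real// le_eqVlt; apply/orP; left; apply/eqP.
  by move: (@pi R) (`|u x|) => p U; ring.
- exact: rintegrableZ.
Qed.

End cosine_transform.

(** * Stability of the Schwartz class under the cosine transform *)

Section cosine_transform_schwartz.
Variables (R : realType) (n : nat).
Local Notation "''e_' i" := (delta_mx 0 i : 'rV[R]_n).
Local Notation E := (borel 'rV[R]_n).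
Local Notation mu := (@lambda_rV R n).
Local Notation leb := (@lebesgue_measure R).
Implicit Types (u v m : 'rV[R]_n -> R) (x xi : 'rV[R]_n) (l : seq 'I_n) (b : R).

(** Partial derivatives do not give joint continuity; it comes from the cosine being 1-Lipschitz and
    from the integrability of each x_i u. *)
Lemma ctransform_lipschitz b u xi eta : continuous u -> rapid_bound u ->
  `|ctransform b u xi - ctransform b u eta| <=
  \sum_i `|xi ord0 i - eta ord0 i| * (2 * pi * \int[mu]_x `|x ord0 i * u x|).
Proof.
move=> cu bu; have ui := rapid_rintegrable cu bu.
have p0 := pi_gt0 R.
have i1 := rintegrable_ctransform b xi ui.
have i2 := rintegrable_ctransform b eta ui.
have ic i : rintegrable mu (fun x => `|x ord0 i * u x|).
  by apply: rintegrable_norm; exact: (rintegrable_mul (mult_coord R i) cu bu).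
have id i : rintegrable mu (fun x => `|xi ord0 i - eta ord0 i| * (2 * pi) * `|x ord0 i * u x|).
  exact: rintegrableZ.
have -> : ctransform b u xi - ctransform b u eta = \int[mu]_x
    (u x * cos (2 * pi * dot x xi + b) - u x * cos (2 * pi * dot x eta + b)).
  by rewrite RintegralB.
have -> : \sum_i `|xi ord0 i - eta ord0 i| * (2 * pi * \int[mu]_x `|x ord0 i * u x|) =
    \sum_i \int[mu]_x (`|xi ord0 i - eta ord0 i| * (2 * pi) * `|x ord0 i * u x|).
  by apply: eq_bigr => i _; have ici := ic i; rewrite RintegralZl// mulrA.
rewrite -Rintegral_sum//; apply: le_norm_Rintegral.
- exact: (rintegrable_measurable (rintegrableD i1 (rintegrableN i2))).
- move=> x; rewrite -mulrBr normrM.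
  rewrite (le_trans (ler_wpM2l (normr_ge0 _) (cos_lipschitz _ _)))//.
  rewrite opprD addrACA subrr addr0 -mulrBr -dotBr normrM gtr0_norm ?mulr_gt0//.
  rewrite /dot (le_trans (ler_wpM2l (normr_ge0 _) (ler_wpM2l _ (ler_norm_sum _ _ _))))//.
    by rewrite mulr_ge0// ltW.
  rewrite !mulr_sumr; apply: ler_sum => i _.
  rewrite !mxE !normrM le_eqVlt; apply/orP; left; apply/eqP.
  by move: (@pi R) `|u x| `|x _ _| => p U X; ring.
- exact: rintegrable_sum.
Qed.

Lemma continuous_ctransform b u : continuous u -> rapid_bound u ->
  continuous (ctransform b u).
Proof.
move=> cu bu xi.
pose c i := 2 * pi * \int[mu]_x `|x ord0 i * u x|.
have ci i : continuous (fun eta : 'rV[R]_n => `|eta ord0 i - xi ord0 i| * c i).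
  move=> eta.
  have h1 : continuous (fun eta : 'rV[R]_n => eta ord0 i) := @continuous_coord R n i.
  have h2 : {for eta, continuous (fun y : 'rV[R]_n => `|y ord0 i - xi ord0 i|)}.
    apply: (@continuous_comp _ _ _ (fun y : 'rV[R]_n => y ord0 i) (fun t : R => `|t - xi ord0 i|)).
      exact: h1.
    apply: continuous_comp; last exact: norm_continuous.
    by apply: cvgB; [exact: cvg_id|exact: cvg_cst].
  have h3 : continuous (fun _ : 'rV[R]_n => c i) by exact: cst_continuous.
  exact: (@cvgM _ _ _ (nbhs_filter eta) _ _ _ _ h2 (h3 eta)).
have ca : continuous (fun z : R * R => z.1 + z.2) by exact: add_continuous.
have h := @continuous_big R 'I_n +%R 0 predT ca 'rV[R]_n (index_enum 'I_n) _ (fun i _ => ci i).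
have h0 : \sum_i `|xi ord0 i - xi ord0 i| * c i = 0.
  by rewrite big1// => i _; rewrite subrr normr0 mul0r.
apply/(@cvgrPdist_le _ _ _ _ (nbhs_filter xi)) => e e0.
have : {for xi, continuous (fun eta : 'rV[R]_n =>
    \sum_i `|eta ord0 i - xi ord0 i| * c i)} by exact: h.
move=> /cvgrPdist_le hx; have := hx e e0; apply: filterS => eta.
rewrite h0 sub0r normrN => he.
rewrite distrC (le_trans (ctransform_lipschitz b eta xi cu bu))//.
by apply: le_trans he; exact: ler_norm.
Qed.

Lemma has_partials_ctransform b u : continuous u -> rapid_bound u ->
  has_partials (ctransform b u).
Proof.
move=> cu bu; split; first exact: continuous_ctransform.
by move=> xi i; have [] := is_derive_ctransform b xi i cu bu.
Qed.

Lemma eq_ctransform b u v xi : u =1 v -> ctransform b u xi = ctransform b v xi.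
Proof. by move=> uv; apply: eq_Rintegral => x _; rewrite uv. Qed.

Lemma partials_ctransform l b u : continuous u -> rapid_bound u ->
  exists c b' m, multiplier m /\
    partials l (ctransform b u) = fun xi => c * ctransform b' (fun x => m x * u x) xi.
Proof.
move=> cu bu; elim: l => [|i l [c [b' [m [mm e]]]]].
  exists 1, b, (fun=> 1); split; first exact: mult_cst.
  apply/funext => xi; rewrite mul1r; apply: eq_ctransform => x.
  by rewrite mul1r.
have [cv bv] := rapid_mul mm cu bu.
exists (c * (2 * pi)), (b' + pi / 2), (fun x => x ord0 i * m x); split.
  by apply: mult_mul => //; exact: mult_coord.
have hc : has_partials (fun _ : 'rV[R]_n => c) by have [] := multiplierP (mult_cst n c).
have hp := has_partials_ctransform b' cv bv.
transitivity (fun xi => 'D_('e_i) (partials l (ctransform b u)) xi) => //.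
rewrite e derive_mulE//; apply/funext => xi.
rewrite (_ : 'D_('e_i) (fun _ : 'rV[R]_n => c) xi = 0); last exact: derive_cst.
rewrite mulr0 addr0.
have d := is_derive_ctransform b' xi i cv bv; rewrite derive_val mulrA; congr (_ * _).
by apply: eq_ctransform => x; rewrite mulrA.
Qed.

Lemma smooth_ctransform b u : continuous u -> rapid_bound u -> smooth (ctransform b u).
Proof.
move=> cu bu l; have [c [b' [m [mm ->]]]] := partials_ctransform l b cu bu.
have [cv bv] := rapid_mul mm cu bu.
apply: has_partials_mul; last exact: has_partials_ctransform.
by have [] := multiplierP (mult_cst n c).
Qed.

Lemma Rintegral_coord0 (F : 'rV[R]_n -> R) (i : 'I_n) (C : R) :
  measurable_fun setT (F : E -> R) -> (forall x, `|F x| <= C * decay x) ->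
  (forall x, x ord0 i = 0 -> \int[leb]_a F (a *: 'e_i + x) = 0) -> \int[mu]_x F x = 0.
Proof.
move=> mF FC F0.
have Fi : rintegrable mu F.
  by apply: (le_rintegrable mF FC); apply: rintegrableZ; exact: rintegrable_decay.
rewrite Rintegral_rV//; last exact/rintegrable_rV.
apply: (Rintegral_tuple_coord0 (f := fun t => F (row_of_tuple t)) (i := i) (C := C)).
- exact: (measurableT_comp mF (@measurable_row_of_tuple R n)).
- by move=> t; apply: le_trans (FC _) _; rewrite /decay; under eq_bigr do rewrite mxE.
- move=> t; rewrite -(F0 (row_of_tuple (upd t i 0))); last first.
    by rewrite mxE tnth_mktuple eqxx.
  apply: eq_Rintegral => a _.
  congr F; apply/rowP => j; rewrite !mxE !tnth_mktuple eqxx /=.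
  by case: eqP => _; rewrite ?mulr1 ?mulr0 ?addr0 ?add0r.
Qed.

(** Integration by parts: on every line in direction [i] the sum [F] of the two integrands is the
    derivative of [u] times the cosine, which tends to 0 at both ends. *)
Lemma ctransform_derive b u i xi : has_partials u -> rapid_bound u ->
  continuous ('D_('e_i) u) -> rapid_bound ('D_('e_i) u) ->
  ctransform b ('D_('e_i) u) xi = - (2 * pi) * xi ord0 i * ctransform (b + pi / 2) u xi.
Proof.
move=> [cu du] bu cdu bdu.
pose ph x := cos (2 * pi * dot x xi + b).
pose ph' x := cos (2 * pi * dot x xi + (b + pi / 2)).
pose F x := 'D_('e_i) u x * ph x + 2 * pi * xi ord0 i * (u x * ph' x).
have ui := rapid_rintegrable cu bu; have dui := rapid_rintegrable cdu bdu.
have i1 := rintegrable_ctransform b xi dui.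
have i2 := rintegrable_ctransform (b + pi / 2) xi ui.
have i3 := rintegrableZ (2 * pi * xi ord0 i) i2.
suff : \int[mu]_x F x = 0.
  rewrite /F RintegralD// RintegralZl// => /eqP; rewrite addr_eq0 => /eqP.
  by rewrite -/(ctransform _ _ _) => ->; rewrite !mulNr.
have [C Cu] := rapid_bound_decay bu; have [D Du] := rapid_bound_decay bdu.
have mF : measurable_fun setT (F : E -> R).
  exact: (rintegrable_measurable (rintegrableD i1 i3)).
have FC x : `|F x| <= (D + `|2 * pi * xi ord0 i| * C) * decay x.
  rewrite /F (le_trans (ler_normD _ _))// [leRHS]mulrDl lerD//.
    by rewrite normrM (le_trans _ (Du x))// ler_piMr// normr_cos_le1.
  rewrite normrM -[leRHS]mulrA ler_wpM2l// normrM (le_trans _ (Cu x))//.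
  by rewrite ler_piMr// normr_cos_le1.
apply: (Rintegral_coord0 (i := i) mF FC) => x xi0.
pose G a := u (a *: 'e_i + x) * cos (2 * pi * xi ord0 i * a + (2 * pi * dot x xi + b)).
have dotE a : 2 * pi * dot (a *: 'e_i + x) xi + b =
    2 * pi * xi ord0 i * a + (2 * pi * dot x xi + b).
  by rewrite dotC dot_line dotC; move: (@pi R) => p; ring.
have FE a : F (a *: 'e_i + x) = 'D_('e_i) u (a *: 'e_i + x) *
      cos (2 * pi * xi ord0 i * a + (2 * pi * dot x xi + b)) +
    u (a *: 'e_i + x) * (- sin (2 * pi * xi ord0 i * a + (2 * pi * dot x xi + b)) *
      (2 * pi * xi ord0 i)).
  rewrite /F /ph /ph' addrA cos_pihalfD dotE; congr (_ + _).
  set s := sin _; clearbody s; move: (@pi R) => p; ring.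
have dG a : is_derive (a : R) (1 : R) G (F (a *: 'e_i + x)).
  rewrite FE; apply: is_derive_mul.
    by apply: is_derive_line; exact: derivableP.
  exact: (is_derive_comp1 (is_derive_cos _) (is_derive_affine _ _ _)).
have cl : continuous (fun a : R => a *: 'e_i + x).
  move=> a; apply: cvgD; last exact: cvg_cst.
  exact: scalel_continuous.
have ccos (g : R -> R) : continuous g ->
    continuous (fun a => g (2 * pi * xi ord0 i * a + (2 * pi * dot x xi + b))).
  move=> cg a; apply: continuous_comp; last exact: cg.
  by apply: cvgD; [apply: cvgM; [exact: cvg_cst|exact: cvg_id]|exact: cvg_cst].
have cFl : continuous (fun a : R => F (a *: 'e_i + x)).
  rewrite (funext FE) => a.
  have h1 : {for a, continuous (fun a : R => u (a *: 'e_i + x))}.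
    by apply: continuous_comp; [exact: cl|exact: cu].
  have h2 : {for a, continuous (fun a : R => 'D_('e_i) u (a *: 'e_i + x))}.
    exact: (@continuous_comp _ _ _ (fun a : R => a *: 'e_i + x) ('D_('e_i) u) a (cl a) (cdu _)).
  have h3 := ccos _ (@continuous_cos R) a; have h4 := ccos _ (@continuous_sin R) a.
  exact: (cvgD (cvgM h2 h3) (cvgM h1 (cvgM (cvgN h4) (cvg_cst (2 * pi * xi ord0 i))))).
have dl (a : R) : decay (a *: 'e_i + x) <= (1 + a ^+ 2)^-1.
  rewrite /decay (bigD1 i)//= !mxE eqxx mulr1 xi0 addr0 ler_piMr//.
    by rewrite invr_ge0 addr_ge0 ?sqr_ge0.
  apply: (@le_trans _ _ (\prod_(j < n | j != i) 1)); last by rewrite big1.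
  apply: ler_prod => j _.
  by rewrite invr_ge0 addr_ge0 ?sqr_ge0//= invf_le1 ?lerDl ?ltr_pwDl ?sqr_ge0.
have nonneg (c v : R) : 0 <= v -> forall y : R, `|y| <= c * v -> `|y| <= `|c| * v.
  by move=> v0 y /le_trans; apply; rewrite ler_wpM2r// ler_norm.
have G0 (t : nat -> R) : (forall k, `|t k| = k%:R) -> G (t k) @[k --> \oo] --> 0.
  move=> tk; apply/norm_cvg0P.
  (* The factor 2 comes from k + 1 <= 2 (1 + k^2), which compares the decay at [t k] with the
     harmonic sequence. *)
  have hc : `|C| * 2 * k.+1%:R^-1 @[k --> \oo] --> `|C| * 2 * 0.
    by apply: cvgM; [exact: cvg_cst|exact: (@cvg_harmonic R)].
  rewrite mulr0 in hc; apply: (squeeze_cvgr _ (cvg_cst 0) hc).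
  apply: nearW => k; rewrite normr_ge0/= /G normrM.
  apply: (@le_trans _ _ `|u (t k *: 'e_i + x)|); first by rewrite ler_piMr// normr_cos_le1.
  apply: (le_trans (nonneg C _ (ltW (decay_gt0 (t k *: 'e_i + x))) _ (Cu _))).
  rewrite -mulrA ler_wpM2l// (le_trans (dl _))// -real_normK ?num_real// tk.
  rewrite -ler_pdivrMl// -invfM lef_pV2 ?posrE ?mulr_gt0// ?ltr_pwDl ?sqr_ge0//.
  rewrite -natr1; have := sqr_ge0 (k%:R - 1 : R); rewrite sqrrB expr1n mulr1.
  have := sqr_ge0 (k%:R : R); move: (k%:R : R) => z; lra.
apply: (Rintegral_derive dG cFl).
- have i0 := rintegrableZ `|D + `|2 * pi * xi ord0 i| * C| (rintegrable_cauchy R).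
  apply: (le_rintegrable _ _ i0); first exact: continuous_measurable_fun.
  move=> a; apply: (le_trans (nonneg _ _ (ltW (decay_gt0 (a *: 'e_i + x))) _ (FC _))).
  by rewrite ler_wpM2l.
- by apply: G0 => k; rewrite ger0_norm.
- by apply: G0 => k; rewrite normrN ger0_norm.
Qed.

(** A derivative in [xi] becomes a multiplier on [u], giving [v], and a monomial in [xi] becomes a
    derivative of [v]; a transform is bounded by the integral of the absolute value. *)
Lemma rschwartz_ctransform b u : rschwartz u -> rschwartz (ctransform b u).
Proof.
move=> ru; have [su bu] := ru.
have cu : continuous u by have [] := su [::].
have bu0 : rapid_bound u by exact: (bu [::] isT).
split; first exact: smooth_ctransform.
move=> l _; have [c [b' [m [mm ->]]]] := partials_ctransform l b cu bu0.
have [sv bv] := rschwartz_mul mm ru; set v := (fun x => m x * u x) in sv bv *.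
apply: (rapid_bound_mul (mult_cst n c)); apply: monomial_bound_rapid => l'.
(* Sorting [l'] leaves the monomial unchanged and makes [partials k v] one of the controlled
   derivatives. *)
pose k := word (counts l').
have ok : ordered k by exact: ordered_word.
have ind j b2 xi : ordered j -> ctransform b2 (partials j v) xi =
    (- (2 * pi)) ^+ size j * \prod_(i <- j) xi ord0 i *
    ctransform (b2 + (size j)%:R * (pi / 2)) v xi.
  elim: j b2 => [|i j IH] b2 oj; first by rewrite big_nil expr0 !mul1r mul0r addr0.
  have oj' := ordered_tl oj.
  transitivity (ctransform b2 ('D_('e_i) (partials j v)) xi); first by [].
  rewrite ctransform_derive.
  - have -> : b2 + (size (i :: j))%:R * (pi / 2) = b2 + pi / 2 + (size j)%:R * (pi / 2).
      by rewrite /= -natr1 mulrDl mul1r addrAC addrA.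
    rewrite IH// big_cons /= exprS; set t := ctransform _ _ _; clearbody t.
    move: (@pi R) => p; ring.
  - exact: smooth_has_partials.
  - exact: bv.
  - by have [] := sv (i :: j).
  - exact: (bv (i :: j)).
have p0 : 0 < (2 * pi) ^+ size k :> R by rewrite exprn_gt0// mulr_gt0// pi_gt0.
exists ((\int[mu]_x `|partials k v x|) / (2 * pi) ^+ size k) => xi.
(* Each integration by parts adds pi / 2, so starting this far below ends at the shift [b']. *)
have := ind k (b' - (size k)%:R * (pi / 2)) xi ok; rewrite subrK => e.
have ki : rintegrable mu (partials k v).
  by apply: rapid_rintegrable; [have [] := sv k|exact: bv].
have := normr_ctransform_le (b' - (size k)%:R * (pi / 2)) xi ki.
have p1 : 0 <= 2 * pi :> R by rewrite mulr_ge0// ltW// pi_gt0.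
rewrite e -mulrA normrM normrX normrN (ger0_norm p1).
rewrite -monomial_word monomial_counts ler_pdivlMr// mulrC; exact.
Qed.

End cosine_transform_schwartz.

(** * Bessel potentials *)

Section schwartz_fourier.
Variables (R : realType) (n : nat).
Local Notation E := (borel 'rV[R]_n).
Local Notation RIn := (borel (RI R n)).
Local Notation mu := (@lambda_rV R n).
Implicit Types (f : 'rV[R]_n -> R[i]) (xi x : 'rV[R]_n).

Lemma cintegral_RI (F : RIn -> R[i]) : cmeasurable F ->
  cintegrable mu (fun x : E => F (section0 x)) ->
  cintegral (@lambda_RI R n) F = cintegral mu (fun x : E => F (section0 x)).
Proof.
move=> [m1 m2] [i1 i2]; congr (_ +i* _).
  exact: (Rintegral_RI (f := fun y => Re (F y))).
exact: (Rintegral_RI (f := fun y => Im (F y))).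
Qed.

Lemma cmeasurable_proj (h : E -> R[i]) : cmeasurable h ->
  cmeasurable (fun y : RIn => h (proj_n y)).
Proof.
by move=> [h1 h2]; split;
  [exact: (measurableT_comp h1 (@measurable_proj_n R n))|
   exact: (measurableT_comp h2 (@measurable_proj_n R n))].
Qed.

Lemma cintegral_proj (h : E -> R[i]) : cintegrable mu h ->
  cintegral (@lambda_RI R n) (fun y => h (proj_n y)) = cintegral mu h.
Proof.
move=> hi; rewrite cintegral_RI//.
by apply: cmeasurable_proj; exact: cintegrable_measurable hi.
Qed.

Lemma rschwartz_continuous (u : 'rV[R]_n -> R) : rschwartz u -> continuous u.
Proof. by move=> [su _]; have [] := su [::]. Qed.

Lemma rschwartz_rapid (u : 'rV[R]_n -> R) : rschwartz u -> rapid_bound u.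
Proof. by move=> [_ bu]; exact: (bu [::] isT). Qed.

Lemma rschwartz_rintegrable (u : 'rV[R]_n -> R) : rschwartz u -> rintegrable mu u.
Proof.
by move=> ru; apply: rapid_rintegrable; [exact: rschwartz_continuous|exact: rschwartz_rapid].
Qed.

Lemma schwartz_cintegrable f : schwartz f -> cintegrable mu f.
Proof. by move=> /schwartz_rschwartz[r1 r2]; split; exact: rschwartz_rintegrable. Qed.

Lemma schwartz_bounded f : schwartz f -> exists M, forall x, normc (f x) <= M.
Proof.
move=> /schwartz_rschwartz[/rschwartz_rapid r1 /rschwartz_rapid r2].
have [C hC] := r1 0%N; have [D hD] := r2 0%N; exists (C + D) => x.
have := hC x; have := hD x; rewrite expr0 !mul1r => h1 h2.
by rewrite (le_trans (normc_le_ReIm _))// lerD.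
Qed.

(** For a sign [s], the cosine of s t does not depend on [s] and the sine is multiplied by it. The
    right-hand sides keep their factor 1 to fit [rschwartz_lin]. *)
Lemma FT_ReIm (s : R) f xi : s = 1 \/ s = -1 -> cintegrable mu f ->
  Re (FT s f xi) = 1 * ctransform 0 (fun x => Re (f x)) xi +
    - s * ctransform (- (pi / 2)) (fun x => Im (f x)) xi /\
  Im (FT s f xi) = 1 * ctransform 0 (fun x => Im (f x)) xi +
    s * ctransform (- (pi / 2)) (fun x => Re (f x)) xi.
Proof.
move=> s1 [i1 i2].
have Rph x : Re (phase s x xi) = cos (2 * pi * dot x xi + 0).
  by rewrite addr0 /phase Re_cis; case: s1 => ->; rewrite ?mul1r ?mulN1r ?cosN.
have Iph x : Im (phase s x xi) = s * cos (2 * pi * dot x xi + - (pi / 2)).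
  by rewrite -Im_cis /phase /=; case: s1 => ->; rewrite ?mul1r ?mulN1r ?sinN.
have j1 := rintegrable_ctransform 0 xi i1; have j2 := rintegrable_ctransform 0 xi i2.
have j3 := rintegrable_ctransform (- (pi / 2)) xi i1.
have j4 := rintegrable_ctransform (- (pi / 2)) xi i2.
have k3 := rintegrableZ s j3; have k4 := rintegrableZ (- s) j4.
split.
  rewrite mul1r -RintegralZl// -RintegralD//; apply: eq_Rintegral => x _.
  by rewrite ReM Rph Iph mulNr; congr (_ - _); rewrite mulrCA.
rewrite mul1r -RintegralZl// -RintegralD//; apply: eq_Rintegral => x _.
by rewrite ImM Rph Iph [RHS]addrC; congr (_ + _); rewrite mulrCA.
Qed.

Lemma schwartz_FT (s : R) f : s = 1 \/ s = -1 -> schwartz f -> schwartz (FT s f).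
Proof.
move=> s1 sf; have fi := schwartz_cintegrable sf.
have [r1 r2] := schwartz_rschwartz sf.
apply: rschwartz_schwartz.
  rewrite (funext (fun xi => (FT_ReIm xi s1 fi).1)).
  by apply: rschwartz_lin; exact: rschwartz_ctransform.
rewrite (funext (fun xi => (FT_ReIm xi s1 fi).2)).
by apply: rschwartz_lin; exact: rschwartz_ctransform.
Qed.

Lemma schwartz_bracket_pow (r : R) f : schwartz f ->
  schwartz (fun x => (bracket_pow r x)%:C * f x).
Proof.
move=> /schwartz_rschwartz[r1 r2]; apply: rschwartz_schwartz.
  under eq_fun do rewrite ReM mul0r subr0.
  exact: (rschwartz_mul (mult_pow n r)).
under eq_fun do rewrite ImM mul0r addr0.
exact: (rschwartz_mul (mult_pow n r)).
Qed.

Lemma fourierE f xi : cintegrable mu f -> fourier f xi = FT (-1) f xi.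
Proof.
move=> fi; rewrite /fourier /FT -(cintegral_proj (cintegrable_phase (-1) xi fi)).
by apply: eq_cintegral => y; rewrite /phase mulN1r dotC.
Qed.

Lemma bessel_funE s f : schwartz f ->
  bessel_fun s f = FT 1 (fun xi => (bracket_pow (s / 2) xi)%:C * FT (-1) f xi).
Proof.
move=> sf; apply/funext => x.
have fi := schwartz_cintegrable sf.
have hi := schwartz_cintegrable (schwartz_bracket_pow (s / 2)
  (schwartz_FT (or_intror erefl) sf)).
rewrite /bessel_fun /FT -(cintegral_proj (cintegrable_phase 1 x hi)).
by apply: eq_cintegral => y; rewrite fourierE// /phase mul1r.
Qed.

(** Both transforms and the symbol preserve the Schwartz class, so [insubd] returns the function
    itself. *)
Lemma bessel_val s (phi : schwartz_fun R n) : bessel s phi = bessel_fun s phi :> ('rV[R]_n -> R[i]).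
Proof.
have sphi : schwartz phi by apply/asboolP; exact: (valP phi).
have sb : schwartz (bessel_fun s phi).
  rewrite bessel_funE//; apply: schwartz_FT; first by left.
  by apply: schwartz_bracket_pow; apply: schwartz_FT => //; right.
by rewrite /bessel -[LHS]/(val _) insubdK//; apply/asboolP.
Qed.

Lemma schwartz_inversion f xi : schwartz f -> FT (-1) (FT 1 f) xi = f xi.
Proof.
move=> sf; have [M fM] := schwartz_bounded sf.
have [r1 r2] := schwartz_rschwartz sf.
apply: (FT_inversion (M := M)) => //.
- exact: schwartz_cintegrable.
- by apply: schwartz_cintegrable; apply: schwartz_FT => //; left.
- by apply: continuous_continuous_at_row; exact: (rschwartz_continuous r1).
- by apply: continuous_continuous_at_row; exact: (rschwartz_continuous r2).
Qed.

Lemma schwartz_fun_schwartz (phi : schwartz_fun R n) : schwartz phi.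
Proof. by apply/asboolP; exact: (valP phi). Qed.

(** Inversion cancels the outer [FT 1] of the potential: P^s multiplies transforms by its symbol. *)
Lemma FT_bessel s (phi : schwartz_fun R n) xi :
  FT (-1) (bessel s phi) xi = (bracket_pow (s / 2) xi)%:C * FT (-1) phi xi.
Proof.
have sphi := schwartz_fun_schwartz phi.
rewrite bessel_val bessel_funE// schwartz_inversion//.
by apply: schwartz_bracket_pow; apply: schwartz_FT => //; right.
Qed.

End schwartz_fourier.

(** * Distributions with an integrable Fourier transform *)

Section fourier_functionals.
Variables (R : realType) (n : nat).
Local Notation E := (borel 'rV[R]_n).
Local Notation mu := (@lambda_rV R n).
Implicit Types (phi psi : schwartz_fun R n).

(* The tempered distribution whose Fourier transform is [k]. *)
Definition fourier_dual (k : E -> R[i]) : functional R n :=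
  fun phi => cintegral mu (fun xi => k xi * FT (-1) phi xi).

Lemma schwartz_fun_cintegrable phi : cintegrable mu phi.
Proof. exact/schwartz_cintegrable/schwartz_fun_schwartz. Qed.

Lemma cintegrable_mul_FT (k f : E -> R[i]) s : cintegrable mu k -> cintegrable mu f ->
  cintegrable mu (fun xi => k xi * FT s f xi).
Proof.
move=> ki fi.
apply: (le_cintegrable _ _ (rintegrableZ (2 * \int[mu]_x normc (f x)) (cintegrable_normc ki))).
  by apply: cmeasurableM; [exact: (cintegrable_measurable ki)|exact: cmeasurable_FT].
by move=> x; rewrite normcM mulrC ler_wpM2r ?normc_ge0// normc_FT_le.
Qed.

Lemma FTD (s : R) (f g : E -> R[i]) xi : cintegrable mu f -> cintegrable mu g ->
  FT s (fun x => f x + g x) xi = FT s f xi + FT s g xi.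
Proof.
move=> fi gi; rewrite /FT -cintegralD; [|exact: cintegrable_phase..].
by apply: eq_cintegral => x; rewrite mulrDl.
Qed.

Lemma FTZ (s : R) (c : R[i]) (f : E -> R[i]) xi : cintegrable mu f ->
  FT s (fun x => c * f x) xi = c * FT s f xi.
Proof.
move=> fi; rewrite /FT -cintegralZ; last exact: cintegrable_phase.
by apply: eq_cintegral => x; rewrite mulrA.
Qed.

Lemma cintegrableZ (c : R[i]) (f : E -> R[i]) : cintegrable mu f ->
  cintegrable mu (fun x => c * f x).
Proof.
move=> fi; apply: (le_cintegrable _ _ (rintegrableZ (normc c) (cintegrable_normc fi))).
  apply: cmeasurableM; first exact: cmeasurable_cst.
  exact: (cintegrable_measurable fi).
by move=> x; rewrite normcM.
Qed.

Lemma fourier_dual_linear k (c : R[i]) phi psi : cintegrable mu k ->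
  fourier_dual k (c *: phi + psi) = c * fourier_dual k phi + fourier_dual k psi.
Proof.
move=> ki; have i1 := schwartz_fun_cintegrable phi; have i2 := schwartz_fun_cintegrable psi.
have j1 := cintegrable_mul_FT (-1) ki i1; have j2 := cintegrable_mul_FT (-1) ki i2.
rewrite /fourier_dual -cintegralZ// -cintegralD//; last exact: cintegrableZ.
apply: eq_cintegral => xi.
rewrite (_ : schwartz_val (c *: phi + psi) = fun x => c * phi x + psi x)//.
rewrite FTD//; last exact: cintegrableZ.
by rewrite FTZ// mulrDr mulrCA.
Qed.

(** The exponents, 0 or 2 in each coordinate, of the monomials in the expansion of the product of
    the 1 + x_i^2. Finitely many seminorms thus bound a function by a multiple of [decay]. *)
Definition square_index (f : {ffun 'I_n -> bool}) : multiindex n := [ffun i => (2 * f i)%N].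

Definition multiindex0 : multiindex n := [ffun=> 0%N].

Lemma word0 : word multiindex0 = [::].
Proof.
rewrite /word; elim: (enum 'I_n) => [//|i s IH] /=.
by rewrite IH ffunE.
Qed.

Lemma inv_decay (x : 'rV[R]_n) :
  (decay x)^-1 = \sum_(f : {ffun 'I_n -> bool}) monomial (square_index f) x.
Proof.
rewrite /decay prodfV invrK.
rewrite (eq_bigr (fun i => \sum_(j : bool) x ord0 i ^+ (2 * j))); last first.
  by move=> i _; rewrite big_bool /= muln1 muln0 expr0 addrC.
rewrite bigA_distr_bigA /=; apply: eq_bigr => f _.
by apply: eq_bigr => i _; rewrite ffunE.
Qed.

Lemma le_seminorm (b : multiindex n) phi x :
  `|monomial b x| * normc (phi x) <= seminorm multiindex0 b phi.
Proof.
have [_ _ /(_ multiindex0 b) ub] := schwartz_fun_schwartz phi.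
apply: (ub_le_sup ub); exists x => //.
have -> : cderiv multiindex0 phi x = phi x.
  by rewrite /cderiv word0 /=; case: (schwartz_val phi x).
by rewrite normcM normc_real.
Qed.

Lemma seminorm_decay phi x :
  normc (phi x) <= (\sum_(f : {ffun 'I_n -> bool}) seminorm multiindex0 (square_index f) phi) * decay x.
Proof.
rewrite -ler_pdivrMr ?decay_gt0// inv_decay mulr_sumr; apply: ler_sum => f _.
apply: le_trans (le_seminorm (square_index f) phi x); rewrite mulrC.
by rewrite ler_wpM2r ?normc_ge0// ler_norm.
Qed.

(** The functional is linear and bounded by a constant times the finite sum [Q] of seminorms: [Q]
    bounds the integral of a test function, hence its transform, and [k] is integrable. *)
Lemma tempered_fourier_dual k : cintegrable mu k -> tempered (fourier_dual k).
Proof.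
move=> ki; split=> [c phi psi|phi_ phi cphi]; first exact: fourier_dual_linear.
pose Q psi := \sum_(f : {ffun 'I_n -> bool}) seminorm multiindex0 (square_index f) psi.
have bnd psi : normc (fourier_dual k psi) <=
    2 * (2 * \int[mu]_x decay x * \int[mu]_x normc (k x)) * Q psi.
  have psii := schwartz_fun_cintegrable psi.
  have i0 := @rintegrable_decay R n.
  have F xi : normc (FT (-1) psi xi) <= 2 * \int[mu]_x decay x * Q psi.
    apply: (@le_trans _ _ (2 * \int[mu]_x (Q psi * decay x))); last first.
      by rewrite RintegralZl// mulrAC mulrA.
    apply: normc_cintegral_le.
    - exact: (cintegrable_measurable (cintegrable_phase (-1) xi psii)).
    - by move=> x; rewrite normcM normc_phase mulr1; exact: seminorm_decay.
    - exact: rintegrableZ.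
  have nk := cintegrable_normc ki.
  apply: (@le_trans _ _ (2 * \int[mu]_x (2 * \int[mu]_x decay x * Q psi * normc (k x)))).
    apply: normc_cintegral_le.
    - exact: (cintegrable_measurable (cintegrable_mul_FT (-1) ki psii)).
    - by move=> x; rewrite normcM mulrC ler_wpM2r ?normc_ge0.
    - exact: rintegrableZ.
  rewrite RintegralZl// le_eqVlt; apply/orP; left; apply/eqP.
  by move: (Rintegral _ _ _) (Rintegral _ _ _) (Q psi) => a b c; ring.
have cQ : Q (phi_ k - phi) @[k --> \oo] --> (0 : R).
  have -> : (0 : R) = \sum_(f : {ffun 'I_n -> bool}) 0 by rewrite big1.
  apply: cvg_big => [|f _]; last exact: cphi.
  exact: add_continuous.
pose C := 2 * (2 * \int[mu]_x decay x * \int[mu]_x normc (k x)).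
have cC : C * Q (phi_ k - phi) @[k --> \oo] --> C * 0.
  by apply: cvgM => //; exact: cvg_cst.
rewrite mulr0 in cC; apply: (squeeze_cvgr _ (cvg_cst 0) cC); apply: nearW => j.
have e : fourier_dual k (phi_ j - phi) = fourier_dual k (phi_ j) - fourier_dual k phi.
  have := fourier_dual_linear (-1) phi (phi_ j) ki.
  by rewrite scaleN1r addrC => ->; rewrite mulN1r addrC.
by rewrite -e normc_ge0; exact: bnd.
Qed.

Lemma regularE (g : E -> R[i]) phi : cmeasurable g -> (exists M, forall x, normc (g x) <= M) ->
  regular (fun y => g (proj_n y)) phi = cintegral mu (fun x => g x * phi x).
Proof.
move=> mg [M gM]; rewrite /regular.
have phii := schwartz_fun_cintegrable phi.
rewrite -(cintegral_proj (h := fun x => g x * phi x))//.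
apply: (le_cintegrable _ _ (rintegrableZ M (cintegrable_normc phii))).
  by apply: cmeasurableM => //; exact: (cintegrable_measurable phii).
by move=> x; rewrite normcM ler_wpM2r ?normc_ge0.
Qed.

(** By [FT_bessel] the symbol passes from the test function to [k] and turns it into [m]; the
    multiplication formula then passes the transform to [m]. *)
Lemma Bessel_fourier_dual s (k m : E -> R[i]) : cintegrable mu k -> cintegrable mu m ->
  (forall x, m x = (bracket_pow (s / 2) x)%:C * k x) ->
  Bessel s (fourier_dual k) = regular (fun y => FT (-1) m (proj_n y)).
Proof.
move=> ki mi mk; apply/funext => phi.
have phii := schwartz_fun_cintegrable phi.
rewrite regularE; last 2 first.
- exact: cmeasurable_FT.
- by exists (2 * \int[mu]_x normc (m x)) => x; exact: normc_FT_le.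
rewrite /Bessel /fourier_dual.
transitivity (cintegral mu (fun xi => m xi * FT (-1) phi xi)).
  by apply: eq_cintegral => xi; rewrite FT_bessel mk mulrCA mulrA.
rewrite cintegral_mul_FT//; apply: eq_cintegral => x; exact: mulrC.
Qed.

(** For L > 0, 1 + x <= exp x gives t exp(-e t / L) <= L / e, and this is raised to the power L. *)
Lemma expR_ge_pow (e t : R) (L : nat) : 0 < e -> 0 <= t ->
  t ^+ L * expR (- (e * t)) <= (L%:R / e) ^+ L.
Proof.
move=> e0 t0; case: L => [|L].
  by rewrite !expr0 mul1r -expR0 ler_expR oppr_le0 mulr_ge0// ltW.
have L0 : 0 < L.+1%:R :> R by rewrite ltr0n.
rewrite (_ : - (e * t) = L.+1%:R * (- (e * t / L.+1%:R))); last first.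
  by rewrite mulrN mulrCA mulfV ?mulr1// gt_eqF.
have key : t * expR (- (e * t / L.+1%:R)) <= L.+1%:R / e.
  rewrite expRN ler_pdivrMr ?expR_gt0//.
  rewrite (@le_trans _ _ (L.+1%:R / e * (1 + e * t / L.+1%:R)))//.
    rewrite mulrDr mulr1 (_ : _ * (e * t / _) = t); first by rewrite lerDr divr_ge0// ltW.
    by field; rewrite !gt_eqF.
  by rewrite ler_wpM2l ?divr_ge0 ?(ltW e0)// expR_ge1Dx.
rewrite expRM_natl -exprMn lerXn2r// nnegrE; first by rewrite mulr_ge0 ?expR_ge0.
by rewrite divr_ge0// ltW.
Qed.

(** The window is an exponential of the l^1 norm, which dominates every coordinate. *)
Lemma rapid_window e : 0 < e -> rapid_bound (window e : 'rV[R]_n -> R).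
Proof.
move=> e0; apply: monomial_bound_rapid => l; exists (((size l)%:R / e) ^+ size l) => x.
set S := \sum_i `|x ord0 i|.
have xS i : `|x ord0 i| <= S by rewrite /S (bigD1 i)//= lerDl sumr_ge0.
have S0 : 0 <= S by rewrite sumr_ge0.
rewrite normrM (@ger0_norm _ (window e x)) ?window_ge0// windowE -/S.
apply: le_trans (expR_ge_pow (size l) e0 S0).
rewrite ler_wpM2r ?expR_ge0//; elim: (l) => [|i l' IH]; first by rewrite big_nil expr0 normr1.
by rewrite big_cons normrM exprS ler_pM.
Qed.

(** For positive [r] the bracket grows polynomially; the window absorbs the growth, and [FT 1 f] is
    bounded. *)
Lemma cintegrable_bracket_window r e (f : E -> R[i]) : 0 < e -> cintegrable mu f ->
  cintegrable mu (fun x => (bracket_pow r x)%:C * ((window e x)%:C * FT 1 f x)).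
Proof.
move=> e0 fi.
have [C hC] := rapid_bound_decay (rapid_bound_mul (mult_pow n r) (rapid_window e0)).
have mb := continuous_measurable_row (@continuous_bracket_pow R n r).
pose B := 2 * \int[mu]_x normc (f x).
apply: (le_cintegrable _ _ (rintegrableZ (B * C) (@rintegrable_decay R n))).
  apply: cmeasurableM; first exact: cmeasurable_real.
  exact: (cintegrable_measurable (cintegrable_window_FT 1 e0 fi)).
move=> x; rewrite mulrA -rmorphM normcM normc_real mulrC -mulrA.
by rewrite ler_pM ?normc_ge0// normc_FT_le.
Qed.

Lemma bracket_powK r (x : 'rV[R]_n) : bracket_pow r x * bracket_pow (- r) x = 1 :> R.
Proof. by rewrite !bracket_powE -expRD mulNr subrr expR0. Qed.

End fourier_functionals.

(** * Poisson smoothing *)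

Section poisson_smoothing.
Variables (R : realType) (n : nat).
Local Notation E := (borel 'rV[R]_n).
Local Notation RIn := (borel (RI R n)).
Local Notation mu := (@lambda_rV R n).
Implicit Types (x y z : 'rV[R]_n).

(* Damping the frequencies of [g] by [window e] convolves [g] with the Poisson
   kernel and makes the result lie in the image of every Bessel potential. *)
Definition smoothing (e : R) (g : E -> R[i]) (y : 'rV[R]_n) : R[i] :=
  FT (-1) (fun x => (window e x)%:C * FT 1 g x) y.

Lemma measurable_poisson2 e : 0 < e ->
  measurable_fun setT (fun p : E * E => poisson e (p.1 - p.2)).
Proof.
move=> e0; under eq_fun do rewrite poissonB.
apply: measurable_prod => i _.
have mp : measurable_fun setT (pker e).
  rewrite (_ : pker e = fun t => pker e (t - 0)); last by apply/funext => t; rewrite subr0.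
  by apply: continuous_measurable_fun; exact: continuous_pker.
apply: (measurableT_comp mp); apply: measurable_funB.
  exact: (measurableT_comp (@measurable_coord R n i) measurable_fst).
exact: (measurableT_comp (@measurable_coord R n i) measurable_snd).
Qed.

Lemma L2_proj_bounded (h : E -> R[i]) M : cintegrable mu h ->
  (forall x, normc (h x) <= M) ->
  L2 (@lambda_RI R n) (fun y : RIn => h (@proj_n R n y)).
Proof.
move=> hi hM; have mG := cintegrable_measurable hi.
have nG := cintegrable_normc hi.
have mn := measurable_normc mG.
split; first exact: cmeasurable_proj.
rewrite /sqint ge0_integral_RI/=; last 2 first.
- apply/measurable_EFinP; apply: measurable_funX.
  exact: (measurable_normc (cmeasurable_proj mG)).
- by move=> y; rewrite lee_fin exprn_ge0// normc_ge0.
apply: (@le_lt_trans _ _ (\int[mu]_x (M * normc (h x))%:E)%E).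
  apply: ge0_le_integral => //.
  + by move=> x _; rewrite lee_fin exprn_ge0// normc_ge0.
  + by apply/measurable_EFinP; apply: measurable_funX.
  + by apply/measurable_EFinP; apply: measurable_funM.
  + by move=> x _; rewrite lee_fin expr2 ler_wpM2r ?normc_ge0.
have i2 := rintegrableZ M nG.
by rewrite -EFin_Rintegral// ltry.
Qed.

Section fixed_function.
Variables (g : E -> R[i]) (M : R).
Hypotheses (gi : cintegrable mu g) (gM : forall x, normc (g x) <= M).

Let M0 : 0 <= M. Proof. exact: le_trans (normc_ge0 _) (gM 0). Qed.

Section fixed_width.
Variable e : R.
Hypothesis e0 : 0 < e.

Lemma smoothingE y : smoothing e g y =
  cintegral mu (fun z => g z * (poisson e (z - y))%:C).
Proof. exact: FT_window_FT. Qed.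

Let mgP y : cmeasurable (fun z : E => g z * (poisson e (z - y))%:C).
Proof.
apply: cmeasurableM; first exact: (cintegrable_measurable gi).
by apply: cmeasurable_real; exact: measurable_poisson.
Qed.

Lemma normc_smoothing_le y : normc (smoothing e g y) <= 2 * M.
Proof.
rewrite smoothingE; have Pi := rintegrable_poisson y e0.
have -> : 2 * M = 2 * \int[mu]_z (M * poisson e (z - y)).
  by rewrite RintegralZl// /Rintegral integral_poisson// mulr1.
apply: normc_cintegral_le => //; last exact: rintegrableZ.
move=> z; rewrite normcM normc_real ger0_norm ?poisson_ge0//.
by rewrite ler_wpM2r ?poisson_ge0.
Qed.

Let h (p : E * E) := normc (g p.1) * poisson e (p.1 - p.2).

Let h0 p : 0 <= h p. Proof. by rewrite mulr_ge0 ?normc_ge0 ?poisson_ge0. Qed.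

Let mh : measurable_fun setT h.
Proof.
apply: measurable_funM; last exact: measurable_poisson2.
have mn := measurable_normc (cintegrable_measurable gi).
exact: (measurableT_comp mn measurable_fst).
Qed.

(** Tonelli with [y] innermost, where the kernel has mass 1 and |g| is left. *)
Let hi : rintegrable (mu \x mu)%E h.
Proof.
have mhE : measurable_fun setT (EFin \o h) by exact/measurable_EFinP.
apply/(@integrable12ltyP _ _ _ _ R mu mu _ mhE).
have -> : (\int[mu]_x \int[mu]_y `|(EFin \o h) (x, y)| =
    \int[mu]_x `|(EFin \o (fun x => normc (g x))) x|)%E.
  apply: eq_integral => x _ /=.
  transitivity (\int[mu]_y ((normc (g x))%:E * (poisson e (y - x))%:E))%E.
    apply: eq_integral => y _; rewrite ger0_norm ?h0// /h /= EFinM.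
    by rewrite -poissonN opprB.
  rewrite ge0_integralZl//.
  - by rewrite integral_poisson// mule1 ger0_norm ?normc_ge0.
  - by apply/measurable_EFinP; exact: measurable_poisson.
  - by move=> y _; rewrite lee_fin poisson_ge0.
  - by rewrite lee_fin normc_ge0.
by have /integrableP[] := cintegrable_normc gi.
Qed.

Lemma cintegrable_smoothing : cintegrable mu (smoothing e g).
Proof.
have i2 := rintegrable_fubini2 hi.
apply: (le_cintegrable _ _ (rintegrableZ 2 i2)).
  by apply: cmeasurable_FT; exact: cintegrable_window_FT.
move=> y; rewrite smoothingE; apply: normc_cintegral_le => //.
  by move=> z; rewrite normcM normc_real /h/= ger0_norm ?poisson_ge0.
(* The bound [M] makes the slice integrable for every [y], where Fubini would say almost every. *)
have i3 := rintegrableZ M (rintegrable_poisson y e0).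
apply: (le_rintegrable _ _ i3).
  exact: (measurableT_comp mh (@pair2_measurable _ _ E E y)).
by move=> z; rewrite ger0_norm// /h /= ler_wpM2r ?poisson_ge0.
Qed.

Lemma L2_smoothing : L2 (@lambda_RI R n) (fun y : RIn => smoothing e g (@proj_n R n y)).
Proof. exact: L2_proj_bounded cintegrable_smoothing normc_smoothing_le. Qed.

Variable B : set E.
Hypothesis mB : measurable B.

Definition poisson_indic z : R := \int[mu]_y (\1_B y * poisson e (y - z)).

Let indic_le1 (y : E) : 0 <= (\1_B y : R) <= 1.
Proof. by rewrite indicE; case: (_ \in _); rewrite ?ler01 ?lexx. Qed.

Let PBi z : rintegrable mu (fun y => \1_B y * poisson e (y - z)).
Proof.
apply: (le_rintegrable _ _ (rintegrable_poisson z e0)).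
  by apply: measurable_funM; [exact: measurable_indic|exact: measurable_poisson].
move=> y; have /andP[i0 i1] := indic_le1 y.
by rewrite ger0_norm ?mulr_ge0 ?poisson_ge0// ler_piMl ?poisson_ge0.
Qed.

Lemma poisson_indic_le1 z : `|poisson_indic z| <= 1.
Proof.
have -> : 1 = \int[mu]_y poisson e (y - z) by rewrite /Rintegral integral_poisson.
apply: le_norm_Rintegral; [exact: (rintegrable_measurable (PBi z))| |exact: rintegrable_poisson].
move=> y; have /andP[i0 i1] := indic_le1 y.
by rewrite ger0_norm ?mulr_ge0 ?poisson_ge0// ler_piMl ?poisson_ge0.
Qed.

Let F (p : E * E) := g p.1 * (\1_B p.2 * poisson e (p.1 - p.2))%:C.

Let Fi : cintegrable (mu \x mu)%E F.
Proof.
have [mg1 mg2] := cintegrable_measurable gi.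
apply: (le_cintegrable _ _ hi).
  apply: cmeasurableM.
    by split; [exact: (measurableT_comp mg1 measurable_fst)|
               exact: (measurableT_comp mg2 measurable_fst)].
  apply: cmeasurable_real; apply: measurable_funM; last exact: measurable_poisson2.
  have mi : measurable_fun setT (\1_B : E -> R) by exact: measurable_indic.
  exact: (measurableT_comp mi measurable_snd).
move=> p; rewrite normcM normc_real ler_wpM2l ?normc_ge0//.
have /andP[i0 i1] := indic_le1 p.2.
by rewrite ger0_norm ?mulr_ge0 ?poisson_ge0// ler_piMl ?poisson_ge0.
Qed.

Let FE z : cintegral mu (fun y => F (z, y)) = g z * (poisson_indic z)%:C.
Proof.
rewrite (_ : (poisson_indic z)%:C = cintegral mu (fun y => (\1_B y * poisson e (y - z))%:C)).
  rewrite -cintegralZ; last exact: cintegrable_real.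
  by apply: eq_cintegral => y; rewrite /F/= -poissonN opprB.
by rewrite /cintegral/= Rintegral_cst// mul0r.
Qed.

Lemma cmeasurable_mul_poisson_indic : cmeasurable (fun z : E => g z * (poisson_indic z)%:C).
Proof.
by have := cintegrable_measurable (cintegrable_fubini1 Fi); rewrite (funext FE).
Qed.

(** The Poisson kernel is even, so Fubini moves the smoothing from [g] to the indicator. *)
Lemma cintegral_indic_smoothing :
  cintegral mu (fun y => (\1_B y : R)%:C * smoothing e g y) =
  cintegral mu (fun z : E => g z * (poisson_indic z)%:C).
Proof.
transitivity (cintegral mu (fun y => cintegral mu (fun z => F (z, y)))).
  apply: eq_cintegral => y; rewrite smoothingE -cintegralZ.
    by apply: eq_cintegral => z; rewrite /F/= rmorphM mulrCA.
  have Pi := rintegrable_poisson y e0.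
  apply: (le_cintegrable (mgP y) _ (rintegrableZ M Pi)) => z.
  rewrite normcM normc_real ger0_norm ?poisson_ge0//.
  by rewrite ler_wpM2r ?poisson_ge0.
by rewrite -(cintegral_fubini Fi); apply: eq_cintegral => z; rewrite FE.
Qed.

Lemma normc_cintegral_indic_smoothing_le :
  normc (cintegral mu (fun y => (\1_B y : R)%:C * smoothing e g y)) <=
  2 * \int[mu]_x normc (g x).
Proof.
rewrite cintegral_indic_smoothing; apply: normc_cintegral_le.
- exact: cmeasurable_mul_poisson_indic.
- by move=> z; rewrite normcM normc_real ler_piMr ?normc_ge0 ?poisson_indic_le1.
- exact: cintegrable_normc.
Qed.

End fixed_width.

(** Once the smoothing is on the indicator, [poisson_cvg] applies at its points of continuity, and
    |g| dominates because smoothed indicators are at most 1. *)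
Lemma cvg_cintegral_indic_smoothing (B : set E) : measurable B ->
  {ae mu, forall z, continuous_at_row (\1_B : 'rV[R]_n -> R) z} ->
  normc (cintegral mu (fun y => (\1_B y : R)%:C * smoothing k.+1%:R^-1 g y) -
         cintegral mu (fun y => (\1_B y : R)%:C * g y)) @[k --> \oo] --> 0.
Proof.
move=> mB cB; have mi : measurable_fun setT (\1_B : E -> R) by exact: measurable_indic.
have e0 k : 0 < k.+1%:R^-1 :> R by rewrite invr_gt0.
have mg := cintegrable_measurable gi.
rewrite (_ : cintegral mu (fun y => (\1_B y : R)%:C * g y) =
    cintegral mu (fun y => g y * (\1_B y : R)%:C)); last first.
  by apply: eq_cintegral => y; exact: mulrC.
under eq_fun do rewrite cintegral_indic_smoothing//.
apply: (cintegral_cvg _ _ _ (cintegrable_normc gi)).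
- by move=> k; exact: cmeasurable_mul_poisson_indic.
- by apply: cmeasurableM => //; exact: cmeasurable_real.
- apply: (@filterS _ _ (ae_filter_ringOfSetsType mu) _ _ _ cB) => z cz.
  have hz : poisson_indic k.+1%:R^-1 B z @[k --> \oo] --> (\1_B z : R).
    apply: (poisson_cvg (M := 1) mi) => // y.
    by rewrite indicE; case: (_ \in _); rewrite ?normr1 ?normr0.
  have hz' : `|poisson_indic k.+1%:R^-1 B z - \1_B z| @[k --> \oo] --> (0 : R).
    by apply/norm_cvg0P/subr_cvg0.
  have hc : normc (g z) * `|poisson_indic k.+1%:R^-1 B z - \1_B z| @[k --> \oo] -->
      normc (g z) * 0 by apply: cvgM => //; exact: cvg_cst.
  rewrite mulr0 in hc.
  by under eq_fun do rewrite -mulrBr -rmorphB normcM normc_real.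
- by move=> k z; rewrite normcM normc_real ler_piMr ?normc_ge0 ?poisson_indic_le1.
Qed.
End fixed_function.

End poisson_smoothing.

(** * The form of KS^2 *)

Section square_integrable.
Context d (T : measurableType d) (R : realType).
Variable mu : {measure set T -> \bar R}.
Implicit Types f g : T -> R[i].

Lemma L2_rintegrable f : L2 mu f -> rintegrable mu (fun x => normc (f x) ^+ 2).
Proof.
move=> [mf fi]; apply/integrableP; split.
  by apply/measurable_EFinP; apply: measurable_funX; exact: measurable_normc.
apply: le_lt_trans fi; rewrite /sqint le_eqVlt; apply/orP; left; apply/eqP.
by apply: eq_integral => x _ /=; rewrite ger0_norm// exprn_ge0// normc_ge0.
Qed.

Lemma rintegrable_L2 f : cmeasurable f ->
  rintegrable mu (fun x => normc (f x) ^+ 2) -> L2 mu f.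
Proof.
move=> mf fi; split=> //; have := EFin_Rintegral fi.
by rewrite /sqint => <-; rewrite ltry.
Qed.

Lemma fine_sqint f : fine (sqint mu f) = \int[mu]_x (normc (f x) ^+ 2).
Proof. by []. Qed.

Lemma normcD_sqr_le (z w : R[i]) : normc (z + w) ^+ 2 <= 2 * normc z ^+ 2 + 2 * normc w ^+ 2.
Proof.
rewrite !normc_sqrE ReD ImD.
have := sqr_ge0 (Re z - Re w); have := sqr_ge0 (Im z - Im w); nra.
Qed.

Lemma L2B f g : L2 mu f -> L2 mu g -> L2 mu (fun x => f x - g x).
Proof.
move=> fL gL; have mfg : cmeasurable (fun x => f x - g x).
  by apply: cmeasurableB; [exact: fL.1|exact: gL.1].
apply: rintegrable_L2 => //.
apply: (le_rintegrable _ _ (rintegrableD (rintegrableZ 2 (L2_rintegrable fL))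
  (rintegrableZ 2 (L2_rintegrable gL)))).
  by apply: measurable_funX; exact: measurable_normc.
move=> x; rewrite ger0_norm ?exprn_ge0 ?normc_ge0//.
by apply: le_trans (normcD_sqr_le _ _) _; rewrite normcN.
Qed.

Lemma cintegrableM_L2 f g : L2 mu f -> L2 mu g -> cintegrable mu (fun x => f x * g x).
Proof.
move=> fL gL; have mfg : cmeasurable (fun x => f x * g x).
  by apply: cmeasurableM; [exact: fL.1|exact: gL.1].
apply: (le_cintegrable mfg _ (rintegrableD (L2_rintegrable fL) (L2_rintegrable gL))) => x.
by rewrite normcM; have := normc_ge0 (f x); have := normc_ge0 (g x); nra.
Qed.

Section indicator.
Variable B : set T.
Hypotheses (mB : measurable B) (B1 : (mu B <= 1)%E).

Lemma rintegrable_indic : rintegrable mu (\1_B : T -> R).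
Proof.
apply/integrableP; split; first by apply/measurable_EFinP; exact: measurable_indic.
under eq_integral do rewrite /= ger0_norm//.
by rewrite integral_indic// setIT (le_lt_trans B1)// ltry.
Qed.

Lemma L2_indic : L2 mu (fun x => (\1_B x : R)%:C).
Proof.
apply: rintegrable_L2; first by apply: cmeasurable_real; exact: measurable_indic.
rewrite (_ : (fun x => _) = (\1_B : T -> R)); first exact: rintegrable_indic.
apply/funext => x; rewrite normc_real indicE.
by case: (_ \in _); rewrite ?normr1 ?normr0 ?expr1n ?expr0n.
Qed.

(** Cauchy-Schwarz on a set of measure at most 1; the 4 is the square of the factor 2 of
    [normc_cintegral_le]. *)
Lemma normc_cintegral_indic_le f : L2 mu f ->
  normc (cintegral mu (fun x => (\1_B x : R)%:C * f x)) ^+ 2 <= 4 * fine (sqint mu f).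
Proof.
move=> fL; have ci := cintegrableM_L2 L2_indic fL.
have ni := cintegrable_normc ci.
have h : normc (cintegral mu (fun x => (\1_B x : R)%:C * f x)) <=
    2 * \int[mu]_x normc ((\1_B x : R)%:C * f x).
  exact: (normc_cintegral_le (cintegrable_measurable ci) _ ni).
set I := \int[mu]_x _ in h; rewrite fine_sqint; set Q := Rintegral _ _ _.
suff IQ : I ^+ 2 <= Q.
  have I0 : 0 <= I by apply: Rintegral_ge0 => x _; exact: normc_ge0.
  have := normc_ge0 (cintegral mu (fun x => (\1_B x : R)%:C * f x)); nra.
have fi := L2_rintegrable fL; have Bi := rintegrable_indic.
(* AM-GM: [2 I |f| <= |f|^2 + I^2] on [B], integrated. *)
have : 2 * I * I <= Q + I ^+ 2 * \int[mu]_x (\1_B x : R).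
  rewrite -RintegralZl// -[X in _ <= _ + X]RintegralZl// -RintegralD//; last exact: rintegrableZ.
  apply: le_Rintegral => //; [exact: rintegrableZ|by apply: rintegrableD => //; exact: rintegrableZ|].
  move=> x _; rewrite normcM normc_real indicE; case: (_ \in _).
    by rewrite normr1 mul1r mulr1; have := sqr_ge0 (I - normc (f x)); nra.
  by rewrite normr0 mul0r !mulr0 addr0 exprn_ge0// normc_ge0.
have : \int[mu]_x (\1_B x : R) <= 1.
  by rewrite -lee_fin EFin_Rintegral// integral_indic// setIT.
by move=> h1 h2; have := sqr_ge0 I; nra.
Qed.

End indicator.

End square_integrable.

(** * Closed boxes and their faces *)

Section cubes.
Variables (R : realType) (n : nat).
Local Notation E := (borel 'rV[R]_n).
Local Notation mu := (@lambda_rV R n).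

Definition box (c : 'rV[R]_n) (a : R) : set E :=
  [set x | forall i, `|x ord0 i - c ord0 i| <= a].

Lemma box_itv c a :
  box c a = [set x : E | forall i, [set` `[c ord0 i - a, c ord0 i + a]] (x ord0 i)].
Proof.
apply/seteqP; split=> x h i; have := h i; rewrite /= in_itv/= ler_distl; lra.
Qed.

Lemma measurable_box c a : measurable (box c a).
Proof.
rewrite box_itv (_ : [set x | _] = \bigcap_(i in [set: 'I_n])
  (fun x : E => x ord0 i) @^-1` [set` `[c ord0 i - a, c ord0 i + a]]).
  apply: fin_bigcap_measurable => // i _; rewrite -[X in measurable X]setTI.
  by apply: measurable_coord.
by apply/seteqP; split=> x h => [i _|i]; exact: h.
Qed.

Lemma box_measure_le1 c a : 0 <= a -> a <= 2^-1 -> (mu (box c a) <= 1)%E.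
Proof.
move=> a0 a1; pose I (i : 'I_n) := [set` `[c ord0 i - a, c ord0 i + a]].
rewrite box_itv (@lambda_rV_box R n I); last by move=> i; exact: measurable_itv.
have h (i : 'I_n) : (0 <= @lebesgue_measure R (I i) <= 1)%E.
  rewrite measure_ge0/= /I lebesgue_measure_itv/= lte_fin; case: ifP => _ //.
  by rewrite -EFinB lee_fin; lra.
suff : (0 <= \prod_(i < n) (@lebesgue_measure R (I i)) <= 1)%E.
  by move=> /andP[].
elim/big_ind : _ => // [|x y /andP[x0 x1] /andP[y0 y1]]; first by rewrite lee01/=.
by rewrite mule_ge0//= -[leRHS]mule1; apply: lee_pmul.
Qed.

(* The indicator of a box is continuous off the hyperplanes that carry its faces. *)
Lemma ae_continuous_box c a : {ae mu, forall z, continuous_at_row (\1_(box c a) : 'rV[R]_n -> R) z}.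
Proof.
pose H (i : 'I_n) := [set x : E | x ord0 i = c ord0 i - a] `|` [set x : E | x ord0 i = c ord0 i + a].
have mH i (t : R) : measurable [set x : E | x ord0 i = t].
  rewrite -[X in measurable X]setTI; exact: (@measurable_coord R n i measurableT [set t]).
have H0 i : mu.-negligible (H i).
  by apply: negligibleU; apply/negligibleP; [exact: mH|exact: lambda_rV_hyperplane|exact: mH|exact: lambda_rV_hyperplane].
have : mu.-negligible (\big[setU/set0]_(i <- index_enum 'I_n) H i).
  elim/big_ind : _ => //; [exact: negligible_set0|by move=> X Y; exact: negligibleU].
apply: negligibleS => z; apply: contra_notP; rewrite -bigcup_seq => zH e e0.
have d_gt0 i : 0 < `| `|z ord0 i - c ord0 i| - a|.
  rewrite normr_gt0 subr_eq0; apply/eqP => zc; apply: zH; exists i; first exact: mem_index_enum.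
  rewrite /H /=; case: (ler0P (z ord0 i - c ord0 i)) zc => _ zc; [left|right]; lra.
(* Moving each coordinate by less than [dl] cannot carry its distance to the centre across the value
   [a]. The 1 is the value of an empty minimum. *)
pose dl := \big[Num.min/1]_(i < n) `| `|z ord0 i - c ord0 i| - a|.
have dl0 : 0 < dl by rewrite /dl; elim/big_ind : _ => // x y x0 y0; rewrite lt_min x0.
exists dl => // y yz; rewrite (_ : \1_(box c a) y = \1_(box c a) z) ?subrr ?normr0 ?ltW//.
have key i : (`|y ord0 i - c ord0 i| <= a) = (`|z ord0 i - c ord0 i| <= a).
  have h1 : dl <= `| `|z ord0 i - c ord0 i| - a| by apply: bigmin_le_cond.
  have h2 : `| `|y ord0 i - c ord0 i| - `|z ord0 i - c ord0 i| | < dl.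
    apply: le_lt_trans (ler_dist_dist _ _) _; rewrite opprB addrA subrK; exact: yz.
  move: (lt_le_trans h2 h1); move: `|_ - c _ _| `|_ - c _ _| => u v.
  by rewrite ltr_norml; case: (ler0P (u - a)) => ?; move=> /andP[? ?]; apply/idP/idP => ?; lra.
rewrite !indicE; congr (_%:R); congr nat_of_bool.
by apply/idP/idP; rewrite !inE => h i; have := h i; rewrite /= key.
Qed.
End cubes.

(** * Series with positive weights of sum 1 *)

Section weighted_series.
Variables (R : realType) (w : nat -> R).
Hypotheses (w0 : forall r, 0 < w r) (w1 : series w @ \oo --> (1 : R)).

Lemma weight_partial_le1 N : series w N <= 1.
Proof.
have nd : nondecreasing_seq (series w).
  by apply/nondecreasing_seqP => k; rewrite seriesSr lerDl ltW.
have cw : cvgn (series w) by apply/cvg_ex; exists 1.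
by have := nondecreasing_cvgn_le nd cw N; rewrite (cvg_lim _ w1).
Qed.

Lemma weighted_series_le (a : nat -> R) C : (forall r, 0 <= a r) ->
  (exists N, forall M, (N <= M)%N -> series (fun r => w r * a r) M <= C) ->
  limn (series (fun r => w r * a r)) <= C.
Proof.
move=> a0 [N aC].
have nd : nondecreasing_seq (series (fun r => w r * a r)).
  by apply/nondecreasing_seqP => k; rewrite seriesSr lerDl mulr_ge0// ltW.
apply: limr_le; last by exists N => // M /= NM; exact: aC.
apply: nondecreasing_is_cvgn => //; exists C => _ [M _ <-].
by apply: le_trans (nd _ _ (leq_maxl M N)) _; apply: aC; exact: leq_maxr.
Qed.

Lemma weighted_series_le_sup (a : nat -> R) C : (forall r, 0 <= a r <= C) ->
  limn (series (fun r => w r * a r)) <= C.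
Proof.
move=> aC; have C0 : 0 <= C by have /andP[a0] := aC 0%N; exact: le_trans.
apply: weighted_series_le; first by move=> r; have /andP[] := aC r.
exists 0%N => M _; apply: (@le_trans _ _ (series w M * C)).
  rewrite /series/= mulr_suml; apply: ler_sum => r _; rewrite ler_wpM2l ?(ltW (w0 r))//.
  by have /andP[] := aC r.
by rewrite ler_piMl// weight_partial_le1.
Qed.

(* Tannery: finitely many weights carry almost all of the mass. *)
Lemma weighted_series_small (a : nat -> nat -> R) C d : 0 < d ->
  (forall k r, 0 <= a k r <= C) ->
  (forall r, \forall k \near \oo, a k r <= d) ->
  exists k, limn (series (fun r => w r * a k r)) <= 2 * d.
Proof.
move=> d0 aC ad; have C0 : 0 <= C by have /andP[a0] := aC 0%N 0%N; exact: le_trans.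
(* Beyond [N] the weights sum to at most d / (C + 1), so terms bounded by [C] contribute at most [d]
   there; the first [N] terms contribute the other [d]. *)
have [N wN] : exists N, 1 - d / (C + 1) <= series w N.
  have dC : 0 < d / (C + 1) by rewrite divr_gt0// ltr_wpDl.
  have [N _ hN] := (@cvgrPdist_le _ _ _ _ _ _ _).1 w1 _ dC.
  by exists N; have := hN N (leqnn N); rewrite ler_norml; lra.
have [k ak] : exists k, forall r, (r < N)%N -> a k r <= d.
  suff [K _ hK] : \forall k \near \oo, forall r, (r < N)%N -> a k r <= d.
    by exists K; exact: (hK K (leqnn K)).
  elim: N {wN} => [|N IH]; first by apply: nearW.
  apply: filterS2 IH (ad N) => k h1 h2 r.
  by rewrite ltnS leq_eqVlt => /orP[/eqP->//|]; exact: h1.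
exists k; apply: weighted_series_le; first by move=> r; have /andP[] := aC k r.
exists N => M NM.
have wM := weight_partial_le1 M.
rewrite /series/= (big_cat_nat (leq0n N) NM)/=.
have h1 : \sum_(0 <= r < N) w r * a k r <= d.
  apply: (@le_trans _ _ (series w N * d)); last by rewrite ler_piMl ?(ltW d0) ?weight_partial_le1.
  rewrite /series/= mulr_suml; apply: ler_sum_nat => r /andP[_ rN].
  by rewrite ler_wpM2l ?(ltW (w0 r))// ak.
have h2 : \sum_(N <= r < M) w r * a k r <= d.
  apply: (@le_trans _ _ ((series w M - series w N) * C)).
    rewrite sub_series_geq// mulr_suml; apply: ler_sum_nat => r _.
    by rewrite ler_wpM2l ?(ltW (w0 r))//; have /andP[] := aC k r.
  apply: (@le_trans _ _ (d / (C + 1) * C)); first by rewrite ler_wpM2r//; lra.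
  by rewrite mulrAC ler_pdivrMr ?ltr_wpDl// ler_wpM2l ?(ltW d0)//; lra.
lra.
Qed.

End weighted_series.

(** * Integrals over the cubes *)

Section KS_coefficients.
Variables (R : realType) (n : nat) (hn : (0 < n)%N) (D : cube_system R n).
Local Notation E := (borel 'rV[R]_n).
Local Notation RIn := (borel (RI R n)).
Local Notation mu := (@lambda_rV R n).
Local Notation lam := (@lambda_RI R n).
Implicit Types (f g : RIn -> R[i]) (r : nat).

Definition cube_base r : set E :=
  box (map_mx ratr (Defs.center D (cube_index D r).2)) (edge D r / 2).

Lemma cube_baseE r : cube D r = @proj_n R n @^-1` cube_base r.
Proof. by apply/seteqP; split=> y h i; have := h i; rewrite /= !mxE. Qed.

(** Since n >= 1, the edge is at most 1; its half is the radius in [box_measure_le1]. *)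
Lemma edge_bounds r : 0 <= edge D r / 2 <= 2^-1.
Proof.
have s1 : 1 <= Num.sqrt n%:R :> R by rewrite -[leLHS]sqrtr1 ler_sqrt ?ler1n ?ltr0n.
have p1 : 1 <= 2 ^+ (cube_index D r).1.+1 :> R by rewrite exprn_ege1// ler1n.
have q1 : 1 <= 2 ^+ (cube_index D r).1.+1 * Num.sqrt n%:R :> R by rewrite mulr_ege1.
have q0 := lt_le_trans ltr01 q1.
rewrite /edge divr_ge0 ?invr_ge0 ?(ltW q0)//= ler_pdivrMr// mulVf//.
by rewrite invf_le1.
Qed.

Lemma measurable_cube r : measurable (cube D r).
Proof.
rewrite cube_baseE -[X in measurable X]setTI.
by apply: measurable_proj_n => //; exact: measurable_box.
Qed.

Lemma lambda_cube_le1 r : (lam (cube D r) <= 1)%E.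
Proof.
have /andP[e0 e1] := edge_bounds r.
by rewrite cube_baseE lambda_RIE; exact: box_measure_le1.
Qed.

Definition coef r f : R[i] := cintegral lam (fun y => zeta D r y * f y).

Lemma normc_coef_sqr_le r f : L2 lam f -> normc (coef r f) ^+ 2 <= 4 * fine (sqint lam f).
Proof.
by apply: normc_cintegral_indic_le; [exact: measurable_cube|exact: lambda_cube_le1].
Qed.

Lemma coefB r f g : L2 lam f -> L2 lam g ->
  coef r (fun y => f y - g y) = coef r f - coef r g.
Proof.
move=> fL gL; have zL := L2_indic (measurable_cube r) (lambda_cube_le1 r).
rewrite /coef -cintegralB; [|exact: cintegrableM_L2..].
by apply: eq_cintegral => y; rewrite mulrBr.
Qed.

Lemma coef_proj r (h : E -> R[i]) : cintegrable mu h ->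
  coef r (fun y => h (proj_n y)) =
  cintegral mu (fun x => (\1_(cube_base r) x : R)%:C * h x).
Proof.
move=> hi; rewrite -(cintegral_proj (h := fun x => (\1_(cube_base r) x : R)%:C * h x)).
  apply: eq_cintegral => y; rewrite /zeta cube_baseE; congr (_%:C * _).
apply: (le_cintegrable _ _ (cintegrable_normc hi)).
  apply: cmeasurableM; last exact: (cintegrable_measurable hi).
  by apply: cmeasurable_real; apply: measurable_indic; exact: measurable_box.
move=> x; rewrite normcM normc_real ler_piMl ?normc_ge0// indicE.
by case: (_ \in _); rewrite ?normr1 ?normr0 ?ler01.
Qed.

Lemma Re_KS_form f : Re (KS_form D f f) =
  limn (series (fun r => tau D r * normc (coef r f) ^+ 2)).
Proof.
rewrite /KS_form /cseries [LHS]/=; congr (limn (series _)); apply/funext => r.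
by rewrite normc_sqrE /=; ring.
Qed.

Lemma Re_KS_form_le f : L2 lam f -> Re (KS_form D f f) <= 4 * fine (sqint lam f).
Proof.
move=> fL; rewrite Re_KS_form.
apply: (weighted_series_le_sup (tau_gt0 D) (tau_sum1 D)) => r.
by rewrite exprn_ge0 ?normc_ge0//= normc_coef_sqr_le.
Qed.

End KS_coefficients.

(** * Truncation, and preimages under the Bessel potential *)

Section approximation.
Variables (R : realType) (n : nat).
Local Notation E := (borel 'rV[R]_n).
Local Notation RIn := (borel (RI R n)).
Local Notation mu := (@lambda_rV R n).
Local Notation lam := (@lambda_RI R n).

Lemma L2_truncation (g : RIn -> R[i]) d : L2 lam g -> 0 < d ->
  exists (h : E -> R[i]) (M : R), [/\ cintegrable mu h, forall x, normc (h x) <= M &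
    fine (sqint lam (fun y => g y - h (proj_n y))) <= d].
Proof.
move=> gL d0; pose q (x : E) := g (section0 x).
have [mg1 mg2] := gL.1.
have mq : cmeasurable q.
  by split; [exact: (measurableT_comp mg1 (@measurable_section0 R n))|
             exact: (measurableT_comp mg2 (@measurable_section0 R n))].
have mnq := measurable_normc mq.
have mG : measurable_fun setT (fun y : RIn => normc (g y) ^+ 2).
  by apply: measurable_funX; exact: measurable_normc gL.1.
have q2 : rintegrable mu (fun x => normc (q x) ^+ 2).
  exact: (rintegrable_RI mG).1 (L2_rintegrable gL).
(* The upper cutoff makes the truncation bounded, the lower one makes it integrable: on [A k], |q|
   <= (k + 1) |q|^2. *)
pose A k := [set x : E | normc (q x) \in `[k.+1%:R^-1, k.+1%:R]].
have mA k : measurable (A k).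
  rewrite -[X in measurable X]setTI.
  exact: (mnq measurableT [set` `[k.+1%:R^-1, k.+1%:R]]).
pose h k (x : E) : R[i] := (\1_(A k) x : R)%:C * q x.
have mh k : cmeasurable (h k).
  by apply: cmeasurableM => //; apply: cmeasurable_real; exact: measurable_indic.
have hP k x : (normc (q x) \in `[k.+1%:R^-1, k.+1%:R] /\ h k x = q x) \/ h k x = 0.
  rewrite /h indicE; have [xA|xA] := boolP (x \in A k); [left|right].
    by rewrite mul1r; split=> //; move: xA; rewrite inE.
  by rewrite mul0r.
have hle k x : normc (q x - h k x) <= normc (q x).
  by have [[_ ->]|->] := hP k x; rewrite ?subrr ?normc0 ?normc_ge0// subr0.
have hc : \int[mu]_x (normc (q x - h k x) ^+ 2) @[k --> \oo] --> \int[mu]_x (0 : R).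
  apply: (Rintegral_cvg _ _ _ q2) => //.
  - by move=> k; apply: measurable_funX; apply: measurable_normc; exact: cmeasurableB.
  - apply: aeW => x; apply/cvgrPdist_le => e e0.
    (* A zero of [q] lies in no [A k], but there the truncation equals [q] all the same. *)
    have [q0|/eqP q0] := eqVneq (normc (q x)) 0.
      apply: nearW => k; have := hle k x; rewrite q0 => h0.
      have -> : normc (q x - h k x) = 0 by apply/eqP; rewrite eq_le h0 normc_ge0.
      by rewrite expr0n subrr normr0 ltW.
    have qp : 0 < normc (q x) by rewrite lt_neqAle normc_ge0 andbT eq_sym; exact/eqP.
    exists (maxn (Num.truncn (normc (q x))) (Num.truncn (normc (q x))^-1)) => // k /=.
    rewrite geq_max => /andP[k1 k2].
    have xA : normc (q x) \in `[k.+1%:R^-1, k.+1%:R].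
      rewrite in_itv/=; apply/andP; split.
        rewrite invf_ple ?posrE// ltW// (lt_le_trans (truncnS_gt _))// ler_nat ltnS//.
      by rewrite ltW// (lt_le_trans (truncnS_gt _))// ler_nat ltnS.
    have -> : h k x = q x by rewrite /h indicE mem_set// mul1r.
    by rewrite subrr normc0 expr0n subrr normr0 ltW.
  - move=> k x; rewrite ger0_norm ?exprn_ge0 ?normc_ge0//.
    by rewrite lerXn2r ?nnegrE ?normc_ge0.
rewrite Rintegral_cst// mul0r in hc.
have [k _ /(_ k (leqnn k)) kd] := (@cvgrPdist_le _ _ _ _ _ _ _).1 hc _ d0.
exists (h k), k.+1%:R; split.
- apply: (le_cintegrable (mh k) _ (rintegrableZ k.+1%:R q2)) => x.
  have [[+ ->]|->] := hP k x; last by rewrite normc0 mulr_ge0 ?exprn_ge0 ?normc_ge0.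
  rewrite in_itv/= => /andP[h1 _].
  rewrite expr2 mulrA ler_peMl ?normc_ge0//.
  by rewrite -ler_pdivrMl// mulr1.
- move=> x; have [[+ ->]|->] := hP k x; last by rewrite normc0.
  by rewrite in_itv/= => /andP[].
- rewrite fine_sqint Rintegral_RI/=.
  + by move: kd; rewrite sub0r normrN; apply: le_trans; exact: ler_norm.
  + apply: measurable_funX; apply: measurable_normc; apply: cmeasurableB; first exact: gL.1.
    exact: cmeasurable_proj.
  + apply: (le_rintegrable _ _ q2).
      by apply: measurable_funX; apply: measurable_normc; exact: cmeasurableB.
    move=> x /=; rewrite ger0_norm ?exprn_ge0 ?normc_ge0//.
    by rewrite lerXn2r ?nnegrE ?normc_ge0//; exact: hle.
Qed.

Lemma regularB (f g : RIn -> R[i]) : L2 lam f -> L2 lam g ->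
  regular f - regular g = regular (fun y => f y - g y).
Proof.
move=> fL gL; apply/funext => phi.
have [M hM] := schwartz_bounded (schwartz_fun_schwartz phi).
have pL := L2_proj_bounded (schwartz_fun_cintegrable phi) hM.
have -> : (regular f - regular g) phi = regular f phi - regular g phi by [].
rewrite /regular -cintegralB; [|exact: cintegrableM_L2..].
by apply: eq_cintegral => y; rewrite mulrBl.
Qed.

Lemma smoothing_Bessel s e (h : E -> R[i]) : 0 < e -> cintegrable mu h ->
  exists2 T : functional R n, tempered T &
    Bessel s T = regular (fun y => smoothing e h (proj_n y)).
Proof.
move=> e0 hi.
have mi := cintegrable_window_FT 1 e0 hi.
have ki := cintegrable_bracket_window (- (s / 2)) e0 hi.
exists (fourier_dual (fun x => (bracket_pow (- (s / 2)) x)%:C * ((window e x)%:C * FT 1 h x))).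
  exact: tempered_fourier_dual.
apply: (Bessel_fourier_dual ki mi) => x.
by rewrite mulrA -rmorphM bracket_powK mul1r.
Qed.

End approximation.

(** * The squared norm of KS^2 *)

Section KS2_norm.
Variables (R : realType) (n : nat) (D : cube_system R n) (K : KS2_space D).
Local Notation RIn := (borel (RI R n)).
Local Notation lam := (@lambda_RI R n).

Definition KS2_sqnorm (T : functional R n) : R := Re (KS2_ip K T T).

Lemma KS2_sqnorm_ge0 T : KS2 K T -> 0 <= KS2_sqnorm T.
Proof.
by move=> /KS2_ip_ge0; rewrite /KS2_sqnorm; case: (KS2_ip K T T) => a b; rewrite lecE/= => /andP[].
Qed.

(** The parallelogram law, with the nonnegative square of T - U dropped. It needs only the algebraic
    axioms of the inner product. *)
Lemma KS2_sqnormD_le T U : KS2 K T -> KS2 K U ->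
  KS2_sqnorm (T + U) <= 2 * KS2_sqnorm T + 2 * KS2_sqnorm U.
Proof.
move=> KT KU.
have key c : KS2 K (c *: U + T) /\ KS2_ip K (c *: U + T) (c *: U + T) =
    c * (c * KS2_ip K U U + KS2_ip K T U)^* + (c * KS2_ip K U T + KS2_ip K T T)^*.
  have Kc := KS2_lin c KU KT; split=> //.
  rewrite (KS2_ip_lin c KU KT Kc) (KS2_ip_conj Kc KU) (KS2_ip_conj Kc KT).
  by rewrite !(KS2_ip_lin c KU KT).
have [K1 e1] := key 1; have [K2 e2] := key (-1).
have n2 := KS2_sqnorm_ge0 K2.
rewrite scale1r in e1; move: n2; rewrite (addrC T) /KS2_sqnorm e1 e2.
case: (KS2_ip K U U) (KS2_ip K T U) (KS2_ip K U T) (KS2_ip K T T) => [? ?] [? ?] [? ?] [? ?] /=.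
lra.
Qed.

Lemma KS2_sqnorm_regular g : L2 lam g -> KS2_sqnorm (regular g) = Re (KS_form D g g).
Proof. by move=> gL; rewrite /KS2_sqnorm KS2_ip_L2. Qed.

Lemma ip_norm_lt T e : KS2 K T -> 0 < e ->
  (ip_norm (KS2_ip K) T < e) = (KS2_sqnorm T < e ^+ 2).
Proof.
move=> KT e0; rewrite /ip_norm -/(KS2_sqnorm T) -[in LHS](ger0_norm (ltW e0)) -sqrtr_sqr.
by rewrite ltr_sqrt// exprn_gt0.
Qed.

End KS2_norm.

(** * Approximation in KS^2 and the embedding *)

Lemma KS_smoothing_approximation (R : realType) (n : nat) (hn : (0 < n)%N)
    (D : cube_system R n) (g : borel (RI R n) -> R[i]) (d : R) :
  L2 (@lambda_RI R n) g -> 0 < d ->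
  exists (h : borel 'rV[R]_n -> R[i]) (e : R),
    let G := fun y : borel (RI R n) => smoothing e h (proj_n y) in
    [/\ 0 < e, cintegrable (@lambda_rV R n) h, L2 (@lambda_RI R n) G &
        Re (KS_form D (fun y => g y - G y) (fun y => g y - G y)) <= 2 * d].
Proof.
(* The truncation error enters a squared coefficient as 2 * 4 * (d / 16), the smoothing error as 2 *
   (d / 4); together they make [d]. *)
move=> gL d0; have d16 : 0 < d / 16 by rewrite divr_gt0.
have [h [M [hi hM gh]]] := L2_truncation gL d16.
have e0 k : 0 < k.+1%:R^-1 :> R by rewrite invr_gt0.
pose G k (y : borel (RI R n)) := smoothing k.+1%:R^-1 h (proj_n y).
have GL k : L2 (@lambda_RI R n) (G k) := L2_smoothing hi hM (e0 k).
have hL := L2_proj_bounded hi hM.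
set I := \int[@lambda_rV R n]_x normc (h x).
have cG k r : normc (coef D r (G k)) <= 2 * I.
  rewrite (coef_proj D r (cintegrable_smoothing hi hM (e0 k))).
  exact: (normc_cintegral_indic_smoothing_le hi hM (e0 k) (measurable_box _ _)).
pose a k r := normc (coef D r (fun y => g y - G k y)) ^+ 2.
(* A bound uniform in [k] and [r], as [weighted_series_small] requires. *)
have a_le k r : 0 <= a k r <= 2 * (4 * fine (sqint (@lambda_RI R n) g)) + 2 * (2 * I) ^+ 2.
  rewrite exprn_ge0 ?normc_ge0//= /a (coefB hn)//.
  apply: le_trans (normcD_sqr_le _ _) _; rewrite normcN lerD//.
    by rewrite ler_wpM2l// normc_coef_sqr_le.
  by rewrite ler_wpM2l// lerXn2r ?nnegrE ?normc_ge0// (le_trans (normc_ge0 _) (cG k r)).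
have a_cvg r : \forall k \near \oo, a k r <= d.
  have dr : normc (coef D r (G k) - coef D r (fun y => h (proj_n y))) @[k --> \oo] --> (0 : R).
    under eq_fun do rewrite (coef_proj D r (cintegrable_smoothing hi hM (e0 _))).
    rewrite (coef_proj D r hi).
    apply: (cvg_cintegral_indic_smoothing hi hM (measurable_box _ _)).
    exact: ae_continuous_box.
  have c0 : 0 < Num.sqrt (d / 4) by rewrite sqrtr_gt0 divr_gt0.
  have [N _ NP] := (@cvgrPdist_le _ _ _ _ _ _ _).1 dr _ c0.
  exists N => // k /NP; rewrite sub0r normrN ger0_norm ?normc_ge0// => hk.
  have hk2 : normc (coef D r (G k) - coef D r (fun y => h (proj_n y))) ^+ 2 <= d / 4.
    rewrite -[leRHS]sqr_sqrtr ?divr_ge0 ?(ltW d0)//.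
    by rewrite lerXn2r ?nnegrE ?normc_ge0// ltW.
  rewrite /a (coefB hn)//.
  rewrite (_ : _ - _ = coef D r (fun y => g y - h (proj_n y)) +
     - (coef D r (G k) - coef D r (fun y => h (proj_n y)))).
    apply: le_trans (normcD_sqr_le _ _) _; rewrite normcN.
    have := normc_coef_sqr_le hn D r (L2B gL hL); lra.
  by rewrite (coefB hn)//; ring.
have [k kd] := weighted_series_small (tau_gt0 D) (tau_sum1 D) d0 a_le a_cvg.
exists h, k.+1%:R^-1; split; [exact: e0|exact: hi|exact: GL|].
by rewrite (Re_KS_form D (fun y => g y - G k y)).
Qed.

Theorem theorem4p5 (R : realType) (n : nat) (hn : (0 < n)%N) (s : R)
    (D : cube_system R n) (K : KS2_space D) :
  dense_continuous_embedding
    (@W R n s) (@W_norm R n s) (@WS R n D K s) (@WS_norm R n D K s).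
Proof.
split.
- move=> T [tT [g gL TE]]; split=> //.
  by rewrite TE; exact: KS2_L2.
(* The square root of the constant 4 in [Re_KS_form_le]. *)
- exists 2 => T [_ [g gL TE]].
  (* [xget] may pick a density other than [g], so both norms are computed with the one it picks. *)
  have [g' [g'L TE' ->]] : exists g', [/\ L2 (@lambda_RI R n) g', Bessel s T = regular g' &
      W_norm s T = L2norm (@lambda_RI R n) g'].
    rewrite /W_norm /distr_L2norm; case: xgetP => [x -> [g' [? ? ?]]|/(_ (L2norm (@lambda_RI R n) g))].
      by exists g'.
    by case; exists g.
  rewrite /WS_norm /ip_norm /WS_ip TE' -/(KS2_sqnorm K (regular g')) KS2_sqnorm_regular//.
  have q0 : 0 <= fine (sqint (@lambda_RI R n) g').
    by rewrite fine_sqint; apply: Rintegral_ge0 => y _; rewrite exprn_ge0 ?normc_ge0.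
  have -> : 2 * L2norm (@lambda_RI R n) g' = Num.sqrt (4 * fine (sqint (@lambda_RI R n) g')).
    rewrite sqrtrM// (_ : 4 = 2 ^+ 2) ?sqrtr_sqr ?ger0_norm//.
    by rewrite -natrX.
  by rewrite ler_wsqrtr// Re_KS_form_le.
- move=> T [tT KT] e e0.
  have e2 : 0 < e / 2 by rewrite divr_gt0.
  have [g gL] := KS2_dense KT e2.
  have Kg := KS2_L2 K gL.
  have KB U V : KS2 K U -> KS2 K V -> KS2 K (U - V).
    by move=> KU KV; rewrite addrC -scaleN1r; exact: KS2_lin.
  rewrite ip_norm_lt//; last exact: KB.
  (* The squared errors are below e^2 / 4 for [g] and at most 2 e^2 / 16 for its smoothing; doubled
     by the parallelogram bound they stay below 3 e^2 / 4. *)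
  move=> Tg; have d0 : 0 < e ^+ 2 / 16 by rewrite divr_gt0 ?exprn_gt0.
  have [h [w [w0 hi GL gG]]] := KS_smoothing_approximation hn D gL d0.
  set G := (fun y => smoothing w h (proj_n y)) in GL gG.
  have [a ta aE] := smoothing_Bessel s w0 hi.
  have KG := KS2_L2 K GL.
  exists a; first by split=> //; exists G.
  rewrite /WS_norm /ip_norm /WS_ip.
  have -> : Bessel s (T - a) = (Bessel s T - regular g) + (regular g - regular G).
    by rewrite addrA subrK -aE.
  rewrite -/(ip_norm (KS2_ip K) _) ip_norm_lt//; last first.
    rewrite addrA subrK; exact: KB.
  apply: le_lt_trans (KS2_sqnormD_le (KB _ _ KT Kg) (KB _ _ Kg KG)) _.
  rewrite [KS2_sqnorm K (regular g - _)](_ : _ = Re (KS_form D (fun y => g y - G y) (fun y => g y - G y))).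
    by have := exprn_gt0 2 e0; rewrite expr_div_n in Tg; move: Tg gG; set x := e ^+ 2; lra.
  by rewrite regularB// KS2_sqnorm_regular//; exact: L2B.
Qed.
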